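(* Let $m>0$. If $m<\sqrt2$, let $U_s\in C^2(\mathbb R)$ be any profile satisfying the structural assumptions (S) given in the context; if $m\ge\sqrt2$, let $U_s(Y)=\tanh Y$. Then there exists $\alpha_0>0$ such that for every $0<\alpha<\alpha_0$ there is $c=c(\alpha)\in\mathbb C$ such that the linearized system (L) of the context has a non-trivial solution of the form $$(\varrho,U_1,U_2)(t,X,Y)=(\rho,u,v)(Y)\,e^{\mathrm i\alpha(X-ct)}+\mathrm{c.c.},$$ where $(\rho,u,v)\in W^{1,\infty}(\mathbb R)\times W^{1,\infty}(\mathbb R)\times W^{2,\infty}(\mathbb R)$ solves $$\begin{cases}\mathrm i\alpha(U_s-c)\rho+\mathrm i\alpha u+\partial_Y v=0,\\ \mathrm i\alpha(U_s-c)u+v\,\partial_YU_s+\mathrm i\alpha m^{-2}\rho=0,\\ \mathrm i\alpha(U_s-c)v+m^{-2}\partial_Y\rho=0,\end{cases}\qquad \lim_{Y\to\pm\infty}v(Y)=0 .$$ Moreover, writing $c=c_r+\mathrm i c_i$, as $\alpha\to0^+$: (1) If $0<m<\sqrt2$, then $c(\alpha)=\mathrm i\sigma(m)+O(\alpha)$, where $$\sigma(m)=\Big(\frac{\sqrt{4m^2+1}-(m^2+1)}{m^2}\Big)^{1/2}>0.$$ In particular $c_r(\alpha)=O(\alpha)$ and $c_i(\alpha)=\sigma(m)+O(\alpha)>0$. (2) If $m=\sqrt2$, then $c(\alpha)=e^{\pi\mathrm i/6}(\alpha/3)^{1/3}+o(\alpha^{1/3})$. In particular $c_r(\alpha)=\frac{\sqrt3}{2}(\alpha/3)^{1/3}+o(\alpha^{1/3})$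 and $c_i(\alpha)=\frac12(\alpha/3)^{1/3}+o(\alpha^{1/3})>0$. (3) If $m>\sqrt2$, then $c(\alpha)=c_*(m)+K_m\alpha+o(\alpha)$, where $$c_*=c_*(m)=\Big(\frac{m^2+1-\sqrt{4m^2+1}}{m^2}\Big)^{1/2}\in(0,1),$$ $$K_m=\frac{1-c_*^2}{8c_*^2\sqrt{4m^2+1}}\Big[2\pi c_*+\mathrm i\Big(4+2c_*\log\frac{1+c_*}{1-c_*}\Big)\Big],\qquad \operatorname{Re}K_m>0,\quad \operatorname{Im}K_m>0.$$ In particular $c_r(\alpha)=c_*(m)+\operatorname{Re}K_m\,\alpha+o(\alpha)$ and $c_i(\alpha)=\operatorname{Im}K_m\,\alpha+o(\alpha)>0$.
   Context: Structural assumptions (S) on $U_s\in C^2(\mathbb R)$: there is a constant $\theta>0$ such that $U_s(0)=0$, $\lim_{Y\to\pm\infty}U_s(Y)=\pm1$, $\partial_YU_s(Y)>0$ for all $Y$, and for $k=0,1,2$ $$\sup_{Y\ge0}|e^{\theta Y}\partial_Y^k(U_s(Y)-1)|<\infty,\qquad \sup_{Y\le0}|e^{-\theta Y}\partial_Y^k(U_s(Y)+1)|<\infty.$$ Linearized system (L) (compressible Euler linearized around density $1$ and velocity $(U_s(Y),0)$, Mach number $m>0$), for $(X,Y)\in\mathbb R\times\mathbb R$ and $U=(U_1,U_2)$: $$\begin{cases}\partial_t\varrho+U_s\partial_X\varrho+\nabla\cdot U=0,\\ \partial_tU+U_s\partial_XU+\partial_YU_s\,(U_2,0)+m^{-2}\nabla\varrho=0,\\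 \lim_{Y\to\pm\infty}U_2=0.\end{cases}$$ Here ''c.c.'' denotes the complex conjugate of the preceding term. The constants in $O(\cdot)$ and the rates in $o(\cdot)$ may depend on $m$ and $U_s$ but not on $\alpha$. *)

(* Defs.v *)
From mathcomp Require Import all_boot all_order all_algebra.
From mathcomp Require Import all_classical all_reals all_analysis.
From mathcomp Require Export complex.

Set Implicit Arguments.
Unset Strict Implicit.
Unset Printing Implicit Defensive.

Import Order.TTheory GRing.Theory Num.Theory.
Import numFieldNormedType.Exports.

Local Open Scope ring_scope.
Local Open Scope complex_scope.
Local Open Scope classical_set_scope.

Section ComplexValued.
Context {R : realType}.

Definition tanh (y : R) : R := (expR y - expR (- y)) / (expR y + expR (- y)).

Definition expC (z : R[i]) : R[i] :=
  (expR (complex.Re z))%:C * (cos (complex.Im z) +i* sin (complex.Im z)).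

(* [R[i]] carries no normed-module structure over [R], so functions
   [R -> R[i]] are differentiated componentwise. *)
Definition derivable_cplx (f : R -> R[i]) (y : R) : Prop :=
  derivable (fun x => complex.Re (f x)) y 1 /\
  derivable (fun x => complex.Im (f x)) y 1.

Definition derive_cplx (f : R -> R[i]) (y : R) : R[i] :=
  derive1 (fun x => complex.Re (f x)) y
  +i* derive1 (fun x => complex.Im (f x)) y.

Definition vanishes_at_infty (f : R -> R) : Prop :=
  f y @[y --> +oo] --> 0 /\ f y @[y --> -oo] --> 0.

End ComplexValued.

Section Sobolev.
Context {R : realType}.

Definition test_function (phi : R -> R) : Prop :=
  (forall (n : nat) (y : R), derivable (derive1n n phi) y 1) /\
  exists M : R, forall y, M < `|y| -> phi y = 0.

Definition weak_derivative (f g : R -> R) : Prop :=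
  forall phi : R -> R, test_function phi ->
    \int[@lebesgue_measure R]_y (f y * derive1 phi y) =
    - \int[@lebesgue_measure R]_y (g y * phi y).

(* [Winfty k f] : the function [f] belongs to W^{k,oo}(R). *)
Fixpoint Winfty (k : nat) (f : R -> R) : Prop :=
  f \in Lfun (@lebesgue_measure R) +oo%E /\
  if k is k'.+1 then
    exists g : R -> R, weak_derivative f g /\ Winfty k' g
  else True.

Definition WinftyC (k : nat) (f : R -> R[i]) : Prop :=
  Winfty k (fun y => complex.Re (f y)) /\ Winfty k (fun y => complex.Im (f y)).

End Sobolev.

Section Euler.
Context {R : realType}.

Definition class_C2 (U : R -> R) : Prop :=
  (forall (k : nat) (y : R), (k < 2)%N -> derivable (derive1n k U) y 1) /\
  continuous (derive1n 2 U).

Definition shear_profile (U : R -> R) : Prop :=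
  class_C2 U /\
  exists theta : R,
    [/\ 0 < theta,
        U 0 = 0,
        U y @[y --> +oo] --> (1 : R) /\ U y @[y --> -oo] --> (-1 : R),
        forall y, 0 < derive1 U y &
        forall k : nat, (k <= 2)%N ->
          has_ubound [set `|expR (theta * y) * derive1n k (fun x => U x - 1) y|
                     | y in [set y | 0 <= y]] /\
          has_ubound [set `|expR (- theta * y) * derive1n k (fun x => U x + 1) y|
                     | y in [set y | y <= 0]]].

(* Partial derivatives of a function of (t, X, Y). *)
Definition pdt (f : R -> R -> R -> R) (t x y : R) : R :=
  derive1 (fun s => f s x y) t.
Definition pdX (f : R -> R -> R -> R) (t x y : R) : R :=
  derive1 (fun s => f t s y) x.
Definition pdY (f : R -> R -> R -> R) (t x y : R) : R :=
  derive1 (fun s => f t x s) y.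

(* The derivability clause covers exactly the partial derivatives occurring
   in the system (the Y-derivative of the first velocity does not occur). *)
Definition linearized_euler_solution (m : R) (Us : R -> R)
    (rho U1 U2 : R -> R -> R -> R) : Prop :=
  [/\ forall t x y,
        [/\ derivable (fun s => rho s x y) t 1,
            derivable (fun s => U1 s x y) t 1 &
            derivable (fun s => U2 s x y) t 1] /\
        [/\ derivable (fun s => rho t s y) x 1,
            derivable (fun s => U1 t s y) x 1 &
            derivable (fun s => U2 t s y) x 1] /\
        derivable (fun s => rho t x s) y 1 /\
        derivable (fun s => U2 t x s) y 1,
      forall t x y,
        pdt rho t x y + Us y * pdX rho t x y
        + (pdX U1 t x y + pdY U2 t x y) = 0,
      forall t x y,
        pdt U1 t x y + Us y * pdX U1 t x y + derive1 Us y * U2 t x y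
        + m ^- 2 * pdX rho t x y = 0,
      forall t x y,
        pdt U2 t x y + Us y * pdX U2 t x y + m ^- 2 * pdY rho t x y = 0 &
      forall t x, vanishes_at_infty (fun y => U2 t x y)].

Definition nontrivial (rho U1 U2 : R -> R -> R -> R) : Prop :=
  exists t x y, (rho t x y, U1 t x y, U2 t x y) != (0, 0, 0).

(* The real-valued field a(Y) e^{i alpha (X - c t)} + c.c. *)
Definition wave (alpha : R) (c : R[i]) (a : R -> R[i]) (t x y : R) : R :=
  let w := a y * expC ('i%C * alpha%:C * (x%:C - c * t%:C)) in
  complex.Re (w + (w^*)%C).

Definition mode_equations (m : R) (Us : R -> R) (alpha : R) (c : R[i])
    (rho u v : R -> R[i]) : Prop :=
  [/\ forall y, [/\ derivable_cplx rho y, derivable_cplx u y & derivable_cplx v y],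
      forall y,
        'i%C * alpha%:C * ((Us y)%:C - c) * rho y + 'i%C * alpha%:C * u y
        + derive_cplx v y = 0,
      forall y,
        'i%C * alpha%:C * ((Us y)%:C - c) * u y + v y * (derive1 Us y)%:C
        + 'i%C * alpha%:C * (m ^- 2)%:C * rho y = 0,
      forall y,
        'i%C * alpha%:C * ((Us y)%:C - c) * v y + (m ^- 2)%:C * derive_cplx rho y = 0 &
      vanishes_at_infty (fun y => Normc.normc (v y))].

Definition sigma (m : R) : R :=
  Num.sqrt ((Num.sqrt (4 * m ^+ 2 + 1) - (m ^+ 2 + 1)) / m ^+ 2).

Definition cstar (m : R) : R :=
  Num.sqrt ((m ^+ 2 + 1 - Num.sqrt (4 * m ^+ 2 + 1)) / m ^+ 2).

Definition Kcoef (m : R) : R[i] :=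
  let cs := cstar m in
  ((1 - cs ^+ 2) / (8 * cs ^+ 2 * Num.sqrt (4 * m ^+ 2 + 1)))%:C *
  ((2 * pi * cs) +i* (4 + 2 * cs * ln ((1 + cs) / (1 - cs)))).

End Euler.

(* Main.v *)
Require Import Defs.
From mathcomp Require Import all_boot all_order all_algebra.
From mathcomp Require Import all_classical all_reals all_analysis.
From mathcomp Require Import measurable_realfun ess_sup_inf.
From mathcomp Require Import ring lra.
Import Order.TTheory GRing.Theory Num.Theory.
Import numFieldNormedType.Exports.
Local Open Scope ring_scope.
Local Open Scope complex_scope.
Local Open Scope classical_set_scope.
Set Implicit Arguments.
Unset Strict Implicit.
Unset Printing Implicit Defensive.


(** A mode with wave number [alpha] and speed [c] is long compared with the shear
    layer, so it should see the layer as a vortex sheet, plus a correction of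
    relative size [alpha].  The proof makes this quantitative.

    With [w = U - c], [rho = m^2 p] and [v = i w r p], the mode equations become
    the Riccati equation [r' = alpha (w^-2 - m^2 - w^2 r^2)] and the linear
    equation [p' = alpha w^2 r p], from which [p] follows by a quadrature and [u]
    algebraically ([mode_of_riccati]).  At each end of the line the Riccati
    equation has an equilibrium for which [p] decays exponentially
    ([limit_rate_gt0]).  Integrating from infinity, a contraction argument gives
    on each half-line a solution that tends to this equilibrium, for small [alpha]
    and uniformly in [c] ([riccati_ex], [layer_solutions]).  A mode exists once the
    two half-line solutions agree at [Y = 0].  Since the equilibria are square
    roots, this condition can be rationalised; it then reads
    [dispersion m c = alpha * correction], where [dispersion] is the polynomial
    of the vortex sheet and [correction] is bounded and Lipschitz in [c]
    ([matching_condition], [layer_reduction]).  A Newton iteration started at an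
    approximate root yields [c] together with its expansion ([newton_root]).

    For [m < sqrt 2] the sheet has the simple root [i sigma], at a positive
    distance from the range of [U], and [w^-2] is harmless ([subsonic_modes]).
    For [m >= sqrt 2] the relevant root [c0] is real, [w] is almost zero where
    [U = c0], and only [alpha <= K Im c] is available.  For the tanh profile,
    [w^-2 = G' + h] with [h] smooth and [G] explicit, a logarithm plus a simple
    pole in [tanh Y - c].  Subtracting [alpha G] from [r] leaves an equation in
    which every singular factor comes with enough powers of [alpha] and [w] to
    be bounded and Lipschitz in [c] ([BLip_HG1], [BLip_HG2]).  The limit of
    [correction] as [alpha] tends to [0] and [c] to [c0] is computed from the
    jump of [G] across the layer, in which the logarithm contributes a multiple
    of [i pi] ([tanh_reduction]).  For [m > sqrt 2] the root is simple, and
    dividing this limit by the derivative of [dispersion] gives [Kcoef]; since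
    [Im Kcoef > 0], the iteration stays where [alpha <= K Im c]
    ([supersonic_modes]).  For [m = sqrt 2] the root [c0 = 0] is triple and the
    leading balance is [24 c^3 = 8 i alpha] ([sonic_modes]). *)

Notation cRe := complex.Re.
Notation cIm := complex.Im.
Notation nrm := Normc.normc.

(** * Complex numbers and complex-valued functions of a real variable *)

Section ComplexNorm.
Context {R : realType}.
Implicit Types z w : R[i].

Lemma nrm_ge0 z : 0 <= nrm z.
Proof. by case: z => a b /=; rewrite sqrtr_ge0. Qed.

Lemma nrmD z w : nrm (z + w) <= nrm z + nrm w.
Proof. exact: le_normcD. Qed.

Lemma nrmN z : nrm (- z) = nrm z.
Proof. exact: normcN. Qed.

Lemma nrmB z w : nrm (z - w) <= nrm z + nrm w.
Proof. by rewrite -(nrmN w) nrmD. Qed.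

Lemma nrmC z w : nrm (z - w) = nrm (w - z).
Proof. by rewrite -nrmN opprB. Qed.

Lemma nrmM z w : nrm (z * w) = nrm z * nrm w.
Proof. exact: Normc.normcM. Qed.

Lemma nrmV z : nrm z^-1 = (nrm z)^-1.
Proof. exact: Normc.normcV. Qed.

Lemma nrmX z n : nrm (z ^+ n) = nrm z ^+ n.
Proof.
elim: n => [|n ih]; first by rewrite !expr0 Normc.normc1.
by rewrite !exprS nrmM ih.
Qed.

Lemma nrmR (x : R) : nrm x%:C = `|x|.
Proof. by rewrite /= expr0n addr0 sqrtr_sqr. Qed.

Lemma nrm0 : nrm (0 : R[i]) = 0.
Proof. exact: Normc.normc0. Qed.

Lemma nrm1 : nrm (1 : R[i]) = 1.
Proof. exact: Normc.normc1. Qed.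

Lemma nrmi : nrm ('i%C : R[i]) = 1.
Proof. by rewrite /= expr0n expr1n add0r sqrtr1. Qed.

Lemma nrm_eq0 z : (nrm z == 0) = (z == 0).
Proof.
apply/eqP/eqP => [/Normc.eq0_normc //|->]; exact: nrm0.
Qed.

Lemma nrm_gt0 z : (0 < nrm z) = (z != 0).
Proof. by rewrite lt_neqAle nrm_ge0 andbT eq_sym nrm_eq0. Qed.

Lemma nrm_sqr z : nrm z ^+ 2 = cRe z ^+ 2 + cIm z ^+ 2.
Proof. by case: z => a b /=; rewrite sqr_sqrtr // addr_ge0 // sqr_ge0. Qed.

Lemma ler_Re_nrm z : `|cRe z| <= nrm z.
Proof.
rewrite -(@ler_pXn2r _ 2) ?nnegrE ?normr_ge0 ?nrm_ge0 // nrm_sqr real_normK ?num_real //.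
by rewrite lerDl sqr_ge0.
Qed.

Lemma ler_Im_nrm z : `|cIm z| <= nrm z.
Proof.
rewrite -(@ler_pXn2r _ 2) ?nnegrE ?normr_ge0 ?nrm_ge0 // nrm_sqr real_normK ?num_real //.
by rewrite lerDr sqr_ge0.
Qed.

Lemma ler_nrm_ReIm z : nrm z <= `|cRe z| + `|cIm z|.
Proof.
have h0 : 0 <= `|cRe z| + `|cIm z| by rewrite addr_ge0.
rewrite -(@ler_pXn2r _ 2) ?nnegrE ?nrm_ge0 // nrm_sqr.
rewrite sqrrD !real_normK ?num_real // addrAC lerDl.
by rewrite mulrn_wge0 // mulr_ge0.
Qed.

Lemma nrm_subr_ge z w : nrm z - nrm w <= nrm (z - w).
Proof. by rewrite lerBlDr (le_trans _ (nrmD _ _)) // subrK. Qed.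

Lemma nrm_split z w v : nrm (z - w) <= nrm (z - v) + nrm (v - w).
Proof. by rewrite (le_trans _ (nrmD _ _)) // addrA subrK. Qed.

Lemma cReD z w : cRe (z + w) = cRe z + cRe w.
Proof. by case: z; case: w. Qed.
Lemma cImD z w : cIm (z + w) = cIm z + cIm w.
Proof. by case: z; case: w. Qed.
Lemma cReN z : cRe (- z) = - cRe z.
Proof. by case: z. Qed.
Lemma cImN z : cIm (- z) = - cIm z.
Proof. by case: z. Qed.
Lemma cReB z w : cRe (z - w) = cRe z - cRe w.
Proof. by rewrite cReD cReN. Qed.
Lemma cImB z w : cIm (z - w) = cIm z - cIm w.
Proof. by rewrite cImD cImN. Qed.
Lemma cReM z w : cRe (z * w) = cRe z * cRe w - cIm z * cIm w.
Proof. by case: z; case: w. Qed.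
Lemma cImM z w : cIm (z * w) = cRe z * cIm w + cIm z * cRe w.
Proof. by case: z; case: w. Qed.
Lemma cReV z : cRe z^-1 = cRe z / (cRe z ^+ 2 + cIm z ^+ 2).
Proof. by case: z. Qed.
Lemma cImV z : cIm z^-1 = - (cIm z) / (cRe z ^+ 2 + cIm z ^+ 2).
Proof. by case: z => a b /=; rewrite mulNr. Qed.
Lemma cReMr (x : R) z : cRe (x%:C * z) = x * cRe z.
Proof. by rewrite cReM /= mul0r subr0. Qed.
Lemma cImMr (x : R) z : cIm (x%:C * z) = x * cIm z.
Proof. by rewrite cImM /= mul0r addr0. Qed.

Lemma complex_ext z w : cRe z = cRe w -> cIm z = cIm w -> z = w.
Proof. by case: z w => [a b] [c d] /= -> ->. Qed.

End ComplexNorm.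

Section ComplexDerivative.
Context {R : realType}.
Implicit Types (f g : R -> R[i]) (x y : R).

(** [R[i]] is not a normed space over [R], hence the componentwise encoding. *)
Definition dC f y (l : R[i]) : Prop :=
  is_derive y 1 (fun x => cRe (f x)) (cRe l) /\
  is_derive y 1 (fun x => cIm (f x)) (cIm l).

Definition contC f : Prop :=
  continuous (fun x => cRe (f x)) /\ continuous (fun x => cIm (f x)).

Lemma is_derive_eqf (f g : R -> R) y (a b : R) :
  is_derive y 1 f a -> f =1 g -> a = b -> is_derive y 1 g b.
Proof. by move=> H /funext <- <-. Qed.

Lemma is_derive1E (f : R -> R) y (a : R) : is_derive y 1 f a ->
  derivable f y 1 /\ derive1 f y = a.
Proof. by move=> H; split; [exact: ex_derive | rewrite derive1E; exact: derive_val]. Qed.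

Lemma is_derive_derive1 (f : R -> R) y : derivable f y 1 ->
  is_derive y 1 f (derive1 f y).
Proof. by move=> H; apply: DeriveDef => //; rewrite derive1E. Qed.

Lemma is_derive_cont (f : R -> R) y a : is_derive y 1 f a -> {for y, continuous f}.
Proof.
by move=> H; apply: differentiable_continuous; apply/derivable1_diffP; exact: ex_derive.
Qed.

Lemma dC_eqf f g y a b : dC f y a -> f =1 g -> a = b -> dC g y b.
Proof. by move=> H /funext <- <-. Qed.

Lemma dC_cst c y : dC (fun=> c) y 0.
Proof. by split; apply: is_derive_cst. Qed.

Lemma dC_real (f : R -> R) y a : is_derive y 1 f a -> dC (fun x => (f x)%:C) y a%:C.
Proof. by move=> H; split => //=; apply: is_derive_cst. Qed.

Lemma dCD f g y a b : dC f y a -> dC g y b -> dC (fun x => f x + g x) y (a + b).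
Proof.
move=> [f1 f2] [g1 g2]; split.
  by apply: (is_derive_eqf (is_deriveD f1 g1)) => [x|]; rewrite cReD.
by apply: (is_derive_eqf (is_deriveD f2 g2)) => [x|]; rewrite cImD.
Qed.

Lemma dCN f y a : dC f y a -> dC (fun x => - f x) y (- a).
Proof.
move=> [f1 f2]; split.
  by apply: (is_derive_eqf (is_deriveN f1)) => [x|]; rewrite cReN.
by apply: (is_derive_eqf (is_deriveN f2)) => [x|]; rewrite cImN.
Qed.

Lemma dCB f g y a b : dC f y a -> dC g y b -> dC (fun x => f x - g x) y (a - b).
Proof. by move=> Hf Hg; apply: dCD => //; apply: dCN. Qed.

Lemma dCM f g y a b : dC f y a -> dC g y b ->
  dC (fun x => f x * g x) y (a * g y + f y * b).
Proof.
move=> [f1 f2] [g1 g2]; split.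
  apply: (is_derive_eqf (is_deriveB (is_deriveM f1 g1) (is_deriveM f2 g2))).
    by move=> x; rewrite cReM.
  by rewrite !(cReD, cReM) /GRing.scale /=; ring.
apply: (is_derive_eqf (is_deriveD (is_deriveM f1 g2) (is_deriveM f2 g1))).
  by move=> x; rewrite cImM.
by rewrite !(cImD, cImM) /GRing.scale /=; ring.
Qed.

Lemma dCZ (c : R[i]) f y a : dC f y a -> dC (fun x => c * f x) y (c * a).
Proof.
move=> Hf; apply: (dC_eqf (dCM (dC_cst c y) Hf)) => //.
by rewrite mul0r add0r.
Qed.

Lemma nz_dbl (p q : R) : p * p + q * q != 0 ->
  (p * p - q * q) * (p * p - q * q) + (p * q + q * p) * (p * q + q * p) != 0.
Proof.
move=> n0; have -> : (p * p - q * q) * (p * p - q * q) + (p * q + q * p) * (p * q + q * p)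
  = (p * p + q * q) ^+ 2 by ring.
by rewrite sqrf_eq0.
Qed.

Lemma dCV f y a : f y != 0 -> dC f y a -> dC (fun x => (f x)^-1) y (- a / f y ^+ 2).
Proof.
move=> fy0 [f1 f2].
have n0 : cRe (f y) ^+ 2 + cIm (f y) ^+ 2 != 0 by rewrite -nrm_sqr sqrf_eq0 nrm_eq0.
have dn : is_derive y 1 (fun x => cRe (f x) * cRe (f x) + cIm (f x) * cIm (f x))
   (2 * (cRe (f y) * cRe a + cIm (f y) * cIm a)).
  apply: (is_derive_eqf (is_deriveD (is_deriveM f1 f1) (is_deriveM f2 f2))) => //.
  by rewrite /GRing.scale /=; ring.
have n0' : cRe (f y) * cRe (f y) + cIm (f y) * cIm (f y) != 0 by rewrite -!expr2.
have dv := @is_deriveV _ (fun x => cRe (f x) * cRe (f x) + cIm (f x) * cIm (f x)) _ _ _ n0' dn.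
split.
  apply: (is_derive_eqf (is_deriveM f1 dv)) => [x|].
    by rewrite cReV !expr2.
  rewrite !(cReM, cReN, cImN, cReV, cImV, expr2, cImM) /GRing.scale /=.
  move: n0'; clear; move: (cRe (f y)) (cIm (f y)) (cRe a) (cIm a) => p q s t n0.
  by field; rewrite n0 andbT nz_dbl.
apply: (is_derive_eqf (is_deriveN (is_deriveM f2 dv))) => [x|].
  by rewrite cImV !expr2 mulNr.
rewrite !(cReM, cReN, cImN, cReV, cImV, expr2, cImM) /GRing.scale /=.
move: n0'; clear; move: (cRe (f y)) (cIm (f y)) (cRe a) (cIm a) => p q s t n0.
by field; rewrite n0 andbT nz_dbl.
Qed.

Lemma dC_compR f (h : R -> R) y a b :
  dC f (h y) a -> is_derive y 1 h b -> dC (fun x => f (h x)) y (b%:C * a).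
Proof.
move=> [f1 f2] hh; split.
  apply: (is_derive_eqf (is_derive1_comp f1 hh)) => //.
  by rewrite cReM /=; ring.
apply: (is_derive_eqf (is_derive1_comp f2 hh)) => //.
by rewrite cImM /=; ring.
Qed.

Lemma dC_opp f y a : dC f (- y) a -> dC (fun x => f (- x)) y (- a).
Proof.
move=> H; apply: (dC_eqf (@dC_compR f (fun x => - x) y a (-1) H _)) => //.
by rewrite rmorphN /= mulN1r.
Qed.

Lemma expC0 : expC (0 : R[i]) = 1.
Proof. by rewrite /expC /= expR0 cos0 sin0 mul1r. Qed.

Lemma nrm_expC (z : R[i]) : nrm (expC z) = expR (cRe z).
Proof.
rewrite /expC nrmM nrmR ger0_norm ?expR_ge0 //=.
by rewrite cos2Dsin2 sqrtr1 mulr1.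
Qed.

Lemma dC_expC f y a : dC f y a -> dC (fun x => expC (f x)) y (a * expC (f y)).
Proof.
move=> [f1 f2].
have e1 := is_derive1_comp (is_derive_expR (cRe (f y))) f1.
have c1 := is_derive1_comp (is_derive_cos (cIm (f y))) f2.
have s1 := is_derive1_comp (is_derive_sin (cIm (f y))) f2.
split.
  apply: (is_derive_eqf (is_deriveM e1 c1)) => [x|].
    by rewrite /expC cReM /= mul0r subr0.
  by rewrite /expC !(cReM, cImM) /GRing.scale /=; ring.
apply: (is_derive_eqf (is_deriveM e1 s1)) => [x|].
  by rewrite /expC cImM /= mul0r addr0.
by rewrite /expC !(cReM, cImM) /GRing.scale /=; ring.
Qed.

Lemma dC_cplx f y a : dC f y a -> derivable_cplx f y /\ derive_cplx f y = a.
Proof.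
move=> [/is_derive1E[f1 e1] /is_derive1E[f2 e2]]; split; first by [].
by apply: complex_ext; rewrite /derive_cplx /=.
Qed.

Lemma dC_contC f f' : (forall y, dC f y (f' y)) -> contC f.
Proof. by move=> H; split => y; have [h1 h2] := H y; apply: is_derive_cont. Qed.

Lemma contC_cst c : contC (fun=> c).
Proof. by split; apply: cst_continuous. Qed.

Lemma contC_real (f : R -> R) : continuous f -> contC (fun x => (f x)%:C).
Proof. by move=> H; split => //; apply: cst_continuous. Qed.

Lemma contCD f g : contC f -> contC g -> contC (fun x => f x + g x).
Proof.
move=> [f1 f2] [g1 g2]; split.
  under [X in continuous X]eq_fun do rewrite cReD.
  by move=> y; apply: continuousD; [exact: f1|exact: g1].
under [X in continuous X]eq_fun do rewrite cImD.
by move=> y; apply: continuousD; [exact: f2|exact: g2].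
Qed.

Lemma contCM f g : contC f -> contC g -> contC (fun x => f x * g x).
Proof.
move=> [f1 f2] [g1 g2]; split.
  under [X in continuous X]eq_fun do rewrite cReM.
  by move=> y; exact: (continuousB (continuousM (f1 y) (g1 y)) (continuousM (f2 y) (g2 y))).
under [X in continuous X]eq_fun do rewrite cImM.
by move=> y; exact: (continuousD (continuousM (f1 y) (g2 y)) (continuousM (f2 y) (g1 y))).
Qed.

Lemma contCN f : contC f -> contC (fun x => - f x).
Proof.
move=> Hf; have := contCM (contC_cst (-1)) Hf.
by under [X in contC X]eq_fun do rewrite mulN1r.
Qed.

Lemma contCB f g : contC f -> contC g -> contC (fun x => f x - g x).
Proof. by move=> Hf Hg; apply: contCD => //; apply: contCN. Qed.

Lemma contC_comp f (h : R -> R) : contC f -> continuous h -> contC (fun x => f (h x)).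
Proof.
move=> [f1 f2] hh; split => y.
  exact: (continuous_comp (hh y) (f1 _)).
exact: (continuous_comp (hh y) (f2 _)).
Qed.

End ComplexDerivative.
(** * Antiderivatives and exponential decay *)

Section MeanValue.
Context {R : realType}.

Lemma mvt_real (f f' : R -> R) (a b : R) : a <= b ->
  (forall x, a <= x <= b -> is_derive x 1 f (f' x)) ->
  exists2 x, a <= x <= b & f b - f a = f' x * (b - a).
Proof.
rewrite le_eqVlt => /predU1P[<-|ab] df.
  by exists a; rewrite ?lexx // !subrr mulr0.
have [||x /[!in_itv]/= /andP[ax xb] e] := @MVT R f f' a b ab.
- by move=> x; rewrite in_itv/= => /andP[ax xb]; apply: df; rewrite !ltW.
- apply: derivable_within_continuous => x; rewrite in_itv/= => h.
  by have [] := is_derive1E (df x h).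
by exists x; rewrite ?(ltW ax) ?(ltW xb).
Qed.

Lemma mvt_norm (f f' : R -> R) (a b B : R) : a <= b ->
  (forall x, a <= x <= b -> is_derive x 1 f (f' x)) ->
  (forall x, a <= x <= b -> `|f' x| <= B) ->
  `|f b - f a| <= B * (b - a).
Proof.
move=> ab df fB; have [x xab ->] := mvt_real ab df.
have ba : 0 <= b - a by rewrite subr_ge0.
by rewrite normrM (ger0_norm ba) ler_wpM2r // fB.
Qed.

Lemma mvt_nincr (f f' : R -> R) (a b : R) : a <= b ->
  (forall x, a <= x <= b -> is_derive x 1 f (f' x)) ->
  (forall x, a <= x <= b -> f' x <= 0) -> f b <= f a.
Proof.
move=> ab df f0; have [x xab e] := mvt_real ab df.
by rewrite -subr_le0 e mulr_le0_ge0 ?f0 // subr_ge0.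
Qed.

Lemma mvt_ndecr (f f' : R -> R) (a b : R) : a <= b ->
  (forall x, a <= x <= b -> is_derive x 1 f (f' x)) ->
  (forall x, a <= x <= b -> 0 <= f' x) -> f a <= f b.
Proof.
move=> ab df f0; have [x xab e] := mvt_real ab df.
by rewrite -subr_ge0 e mulr_ge0 ?f0 // subr_ge0.
Qed.

Lemma mvt_nrm (f f' : R -> R[i]) (a b B : R) : a <= b ->
  (forall x, a <= x <= b -> dC f x (f' x)) ->
  (forall x, a <= x <= b -> nrm (f' x) <= B) ->
  nrm (f b - f a) <= 2 * B * (b - a).
Proof.
move=> ab df fB; rewrite (le_trans (ler_nrm_ReIm _)) // cReB cImB.
rewrite -mulrA mulr_natl mulr2n lerD //.
  apply: (mvt_norm ab (fun x h => (df x h).1)) => x h.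
  by rewrite (le_trans (ler_Re_nrm _)) // fB.
apply: (mvt_norm ab (fun x h => (df x h).2)) => x h.
by rewrite (le_trans (ler_Im_nrm _)) // fB.
Qed.

End MeanValue.

Section Glue.
Context {R : realType}.

Lemma is_derive_cvg (f : R -> R) (y l : R) : is_derive y 1 f l ->
  (fun h : R => h^-1 * (f (h * 1 + y) - f y)) @ 0^' --> l.
Proof.
move=> df; have := @ex_derive _ _ _ _ _ _ _ df; rewrite /derivable /= => c.
by rewrite -(@derive_val _ _ _ _ _ _ _ df); exact: c.
Qed.

(** Each difference quotient of the glued function at [0] is a difference
    quotient of one of the two pieces. *)
Lemma is_derive_glue (f g : R -> R) (l : R) : f 0 = g 0 ->
  is_derive (0 : R) 1 f l -> is_derive (0 : R) 1 g l ->
  is_derive (0 : R) 1 (fun x => if 0 <= x then f x else g x) l.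
Proof.
move=> fg df dg; set k := fun x => _.
have Hf := is_derive_cvg df; have Hg := is_derive_cvg dg.
have Hk : (fun h : R => h^-1 * (k (h * 1 + 0) - k 0)) @ 0^' --> l.
  apply/cvgrPdist_lt => e e0.
  move/cvgrPdist_lt : Hf => /(_ e e0) Hf; move/cvgrPdist_lt : Hg => /(_ e e0) Hg.
  near=> h; rewrite {1}/k.
  case: ifPn => _; rewrite /k lexx.
    by near: h.
  by rewrite fg; near: h.
apply: DeriveDef; first by apply/cvg_ex; exists l.
exact: (cvg_lim (@norm_hausdorff _ _) Hk).
Unshelve. all: by end_near.
Qed.

Lemma is_derive_glue_all (f g f' g' : R -> R) : f 0 = g 0 -> f' 0 = g' 0 ->
  (forall y : R, 0 <= y -> is_derive y 1 f (f' y)) ->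
  (forall y : R, y <= 0 -> is_derive y 1 g (g' y)) ->
  forall y : R, is_derive y 1 (fun x => if 0 <= x then f x else g x)
                          (if 0 <= y then f' y else g' y).
Proof.
move=> fg fg' df dg y; have [y0|y0|->] := ltgtP y 0.
- apply: (@near_eq_is_derive _ _ _ g); last exact: dg (ltW y0).
  near=> x; have xn : x < 0 by near: x; exact: lt_nbhsl.
  by rewrite leNgt xn.
- apply: (@near_eq_is_derive _ _ _ f); last exact: df (ltW y0).
  near=> x; have xp : 0 < x by near: x; exact: lt_nbhsr.
  by rewrite (ltW xp).
- by apply: is_derive_glue => //; [exact: df | rewrite fg'; exact: dg].
Unshelve. all: by end_near.
Qed.

Lemma dC_glue_all (f g f' g' : R -> R[i]) : f 0 = g 0 -> f' 0 = g' 0 ->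
  (forall y : R, 0 <= y -> dC f y (f' y)) ->
  (forall y : R, y <= 0 -> dC g y (g' y)) ->
  forall y : R, dC (fun x => if 0 <= x then f x else g x) y
               (if 0 <= y then f' y else g' y).
Proof.
move=> fg fg' df dg y; split.
  apply: (is_derive_eqf (@is_derive_glue_all (fun x => cRe (f x)) (fun x => cRe (g x))
     (fun x => cRe (f' x)) (fun x => cRe (g' x)) _ _ _ _ y)) => [|||x|x|].
  - by rewrite fg.
  - by rewrite fg'.
  - by move=> x /df[].
  - by move=> /dg[].
  - by case: ifP.
  - by case: ifP.
apply: (is_derive_eqf (@is_derive_glue_all (fun x => cIm (f x)) (fun x => cIm (g x))
   (fun x => cIm (f' x)) (fun x => cIm (g' x)) _ _ _ _ y)) => [|||x|x|].
- by rewrite fg.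
- by rewrite fg'.
- by move=> x /df[].
- by move=> /dg[].
- by case: ifP.
- by case: ifP.
Qed.

End Glue.

Section Antiderivative.
Context {R : realType}.

Lemma ex_antideriv_right (f : R -> R) (a : R) : continuous f ->
  exists F : R -> R, forall y : R, a < y -> is_derive y 1 F (f y).
Proof.
move=> cf; exists (fun y => \int[@lebesgue_measure R]_(t in `[a, y]) f t) => y ay.
have yy : y < y + 1 by rewrite ltrDl.
have [||d1 d2] := @continuous_FTC1_closed R f a y (y + 1) yy _ ay.
- apply: continuous_compact_integrable; first exact: segment_compact.
  exact: continuous_subspaceT.
- exact: cf.
- by rewrite -d2; exact: is_derive_derive1.
Qed.

(** The integral from a fixed base point is an antiderivative on a half-line
    only, so two of them, one for the reflected function, are glued at the
    origin. *)
Lemma ex_antideriv (f : R -> R) : continuous f ->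
  exists F : R -> R, forall y : R, is_derive y 1 F (f y).
Proof.
move=> cf; have [F dF] := ex_antideriv_right (-1) cf.
have cf' : continuous (fun x => - f (- x)).
  move=> x; apply: continuousN; apply: (@continuous_comp _ _ _ (fun x : R => - x) f).
    exact: opp_continuous.
  exact: cf.
have [G dG] := ex_antideriv_right (-1) cf'.
exists (fun y => if 0 <= y then F y - F 0 else G (- y) - G 0) => y.
apply: (is_derive_eqf (@is_derive_glue_all R (fun y => F y - F 0)
  (fun y => G (- y) - G 0) f f _ _ _ _ y)) => [||x x0|x x0||] //.
- by rewrite oppr0 !subrr.
- have dx := dF x (lt_le_trans (ltrN10 _) x0).
  by apply: (is_derive_eqf (is_deriveB dx (is_derive_cst (F 0) x 1))) => //; rewrite subr0.
- have x1 : -1 < - x by rewrite ltrN2 (le_lt_trans x0).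
  have dx := is_derive1_comp (dG (- x) x1) (is_deriveNid x 1).
  apply: (is_derive_eqf (is_deriveB dx (is_derive_cst (G 0) x 1))) => //.
  by rewrite subr0 mulrN1 opprK opprK.
- by case: ifP.
Qed.

Lemma ex_antiderivC (f : R -> R[i]) : contC f ->
  exists F : R -> R[i], forall y : R, dC F y (f y).
Proof.
move=> [/ex_antideriv[F1 d1] /ex_antideriv[F2 d2]].
by exists (fun y => F1 y +i* F2 y) => y; split; [exact: d1|exact: d2].
Qed.

End Antiderivative.

Section DecayingAntiderivative.
Context {R : realType} (theta : R) (theta_gt0 : 0 < theta).

Definition edecay (y : R) : R := expR (- (theta * y)).

Lemma edecay_gt0 y : 0 < edecay y. Proof. exact: expR_gt0. Qed.
Lemma edecay_ge0 y : 0 <= edecay y. Proof. exact: expR_ge0. Qed.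
Lemma edecay0 : edecay 0 = 1. Proof. by rewrite /edecay mulr0 oppr0 expR0. Qed.
Lemma edecay_le1 y : 0 <= y -> edecay y <= 1.
Proof. by move=> y0; rewrite /edecay expR_le1 oppr_le0 mulr_ge0 // ltW. Qed.

Lemma is_derive_edecay (y : R) : is_derive y 1 edecay (- theta * edecay y).
Proof.
have d : is_derive y 1 (fun x => - (theta * x)) (- theta).
  apply: (is_derive_eqf (is_deriveZ (- theta) (is_derive_id y 1))).
    by move=> x; rewrite /= /GRing.scale /= mulNr.
  by rewrite /GRing.scale /= mulr1.
apply: (is_derive_eqf (is_derive1_comp (is_derive_expR _) d)) => //.
by rewrite mulrC.
Qed.

Lemma edecay_small (e y : R) : 0 < e -> exists2 z, y <= z & edecay z <= e.
Proof.
move=> e0.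
pose z := Num.max `|y| (1 / (theta * e)).
have z0 : 0 < z.
  by rewrite lt_max; apply/orP; right; rewrite divr_gt0 // mulr_gt0.
exists z; first by rewrite le_max ler_norm.
rewrite /edecay expRN invf_ple ?posrE ?expR_gt0 //.
rewrite (le_trans _ (expR_ge1Dx _)) // (le_trans (y := theta * z)) ?lerDr //.
rewrite -ler_pdivrMl // le_max; apply/orP; right.
by rewrite mul1r invfM.
Qed.

(** The crude constant [K] improves to [B / theta]: [F + (B / theta) edecay] is
    nonincreasing, [F - (B / theta) edecay] is nondecreasing, and both tend to
    [0]. *)
Lemma decay_bound (F f : R -> R) (B K : R) : 0 <= K ->
  (forall y : R, 0 <= y -> is_derive y 1 F (f y)) ->
  (forall y : R, 0 <= y -> `|f y| <= B * edecay y) ->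
  (forall y : R, 0 <= y -> `|F y| <= K * edecay y) ->
  forall y : R, 0 <= y -> `|F y| <= B / theta * edecay y.
Proof.
move=> K0 dF fB FK y y0.
have dE (z : R) : is_derive z 1 (fun x => B / theta * edecay x) (- (B * edecay z)).
  apply: (is_derive_eqf (is_deriveZ (B / theta) (is_derive_edecay z))) => //.
  by rewrite /GRing.scale /=; field; rewrite lt0r_neq0.
have kp : 0 < K + `|B / theta| + 1 by rewrite ltr_wpDl // addr_ge0.
have P (x z : R) : y <= x <= z -> 0 <= x by move=> /andP[? _]; exact: le_trans y0 _.
rewrite ler_norml; apply/andP; split.
  rewrite -subr_ge0 opprK leNgt; apply/negP => neg.
  have [|z yz] := @edecay_small ((- (F y + B / theta * edecay y)) / (2 * (K + `|B / theta| + 1))) y.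
    by rewrite divr_gt0 ?oppr_gt0 // mulr_gt0.
  rewrite ler_pdivlMr ?mulr_gt0 // => zs.
  have := @mvt_nincr _ (fun x => F x + B / theta * edecay x)
            (fun x => f x + - (B * edecay x)) y z yz.
  move=> /(_ (fun x h => is_deriveD (dF x (P x z h)) (dE x))).
  have h (x : R) : y <= x <= z -> f x - B * edecay x <= 0.
    by move=> /P /fB; rewrite subr_le0; apply: le_trans; exact: ler_norm.
  move=> /(_ h).
  have z0 := le_trans y0 yz; have zp := edecay_ge0 z.
  have : - (K * edecay z) <= F z by have := FK z z0; rewrite ler_norml => /andP[].
  have : - (`|B / theta| * edecay z) <= B / theta * edecay z.
    by rewrite -mulNr ler_wpM2r // lerNl -normrN ler_norm.
  move: kp zs zp neg; move: (B / theta) => c.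
  move: (edecay z) (edecay y) (F y) (F z) => *; lra.
rewrite -subr_le0 leNgt; apply/negP => neg.
have [|z yz] := @edecay_small ((F y - B / theta * edecay y) / (2 * (K + `|B / theta| + 1))) y.
  by rewrite divr_gt0 // mulr_gt0.
rewrite ler_pdivlMr ?mulr_gt0 // => zs.
have := @mvt_ndecr _ (fun x => F x - B / theta * edecay x)
          (fun x => f x - - (B * edecay x)) y z yz.
move=> /(_ (fun x h => is_deriveB (dF x (P x z h)) (dE x))).
have h (x : R) : y <= x <= z -> 0 <= f x - - (B * edecay x).
  by move=> /P /fB; rewrite opprK ler_norml => /andP[h _]; rewrite addrC -lerBlDl sub0r.
move=> /(_ h).
have z0 := le_trans y0 yz; have zp := edecay_ge0 z.
have : F z <= K * edecay z by have := FK z z0; rewrite ler_norml => /andP[].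
have : - (`|B / theta| * edecay z) <= B / theta * edecay z.
  by rewrite -mulNr ler_wpM2r // lerNl -normrN ler_norm.
move: kp zs zp neg; move: (B / theta) => c.
move: (edecay z) (edecay y) (F y) (F z) => *; lra.
Qed.

(** For any antiderivative [F], the function [F - (B / theta) edecay] increases
    and [F + (B / theta) edecay] decreases; subtracting from [F] the number
    between the two gives the solution that vanishes at infinity. *)
Lemma ex_decay_antideriv (f : R -> R) (B : R) : continuous f ->
  (forall y : R, 0 <= y -> `|f y| <= B * edecay y) ->
  exists2 F : R -> R, (forall y : R, is_derive y 1 F (f y)) &
    forall y : R, 0 <= y -> `|F y| <= B / theta * edecay y.
Proof.
move=> cf fB; have [F dF] := ex_antideriv cf.
pose E y := B / theta * edecay y.
have dE (z : R) : is_derive z 1 E (- (B * edecay z)).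
  apply: (is_derive_eqf (is_deriveZ (B / theta) (is_derive_edecay z))) => //.
  by rewrite /GRing.scale /=; field; rewrite lt0r_neq0.
have B0 : 0 <= B by move: (fB 0 (lexx _)); rewrite edecay0 mulr1; apply: le_trans.
have E0 y : 0 <= E y by rewrite mulr_ge0 ?edecay_ge0 // divr_ge0 // ltW.
have hi (y z : R) : 0 <= y -> y <= z -> F z + E z <= F y + E y.
  move=> y0 yz; apply: (@mvt_nincr _ (fun x => F x + E x)
            (fun x => f x + - (B * edecay x)) y z yz (fun x _ => is_deriveD (dF x) (dE x))).
  move=> x /andP[yx _]; rewrite subr_le0.
  by apply: le_trans (fB _ (le_trans y0 yx)); exact: ler_norm.
have lo (y z : R) : 0 <= y -> y <= z -> F y - E y <= F z - E z.
  move=> y0 yz; apply: (@mvt_ndecr _ (fun x => F x - E x)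
            (fun x => f x - - (B * edecay x)) y z yz (fun x _ => is_deriveB (dF x) (dE x))).
  move=> x /andP[yx _]; have := fB _ (le_trans y0 yx).
  by rewrite opprK ler_norml => /andP[h _]; rewrite addrC -lerBlDl sub0r.
have lohi (y z : R) : 0 <= y -> 0 <= z -> F y - E y <= F z + E z.
  move=> y0 z0; have [yz|/ltW zy] := leP y z.
    apply: (le_trans (lo _ _ y0 yz)); have := E0 z; lra.
  by apply: (le_trans _ (hi _ _ z0 zy)); have := E0 y; lra.
pose S := [set F y - E y | y in [set y | 0 <= y]].
have S0 : S !=set0 by exists (F 0 - E 0); exists 0 => //=.
have SB z : 0 <= z -> ubound S (F z + E z) by move=> z0 _ [y y0 <-]; exact: lohi.
pose l := sup S.
have l1 y : 0 <= y -> F y - E y <= l.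
  move=> y0; apply: ub_le_sup; first by exists (F 0 + E 0); exact: SB.
  by exists y.
have l2 y : 0 <= y -> l <= F y + E y by move=> y0; apply: ge_sup => //; exact: SB.
exists (fun y => F y - l) => [y|y y0].
  by apply: (is_derive_eqf (is_deriveB (dF y) (is_derive_cst l y 1))) => //; rewrite subr0.
rewrite ler_norml -/(E y); have := l1 y y0; have := l2 y y0 => *.
by apply/andP; split; lra.
Qed.

Lemma decay_boundC (F f : R -> R[i]) (B K : R) : 0 <= K ->
  (forall y : R, 0 <= y -> dC F y (f y)) ->
  (forall y : R, 0 <= y -> nrm (f y) <= B * edecay y) ->
  (forall y : R, 0 <= y -> nrm (F y) <= K * edecay y) ->
  forall y : R, 0 <= y -> nrm (F y) <= 2 * B / theta * edecay y.
Proof.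
move=> K0 dF fB FK y y0; rewrite (le_trans (ler_nrm_ReIm _)) //.
rewrite -2!mulrA mulr_natl mulr2n lerD // mulrA.
  apply: (@decay_bound (fun y => cRe (F y)) (fun y => cRe (f y)) B K) => // x x0.
  - by have [] := dF x x0.
  - by rewrite (le_trans (ler_Re_nrm _)) // fB.
  - by rewrite (le_trans (ler_Re_nrm _)) // FK.
apply: (@decay_bound (fun y => cIm (F y)) (fun y => cIm (f y)) B K) => // x x0.
- by have [] := dF x x0.
- by rewrite (le_trans (ler_Im_nrm _)) // fB.
- by rewrite (le_trans (ler_Im_nrm _)) // FK.
Qed.

Lemma ex_decay_antiderivC (f : R -> R[i]) (B : R) : contC f ->
  (forall y : R, 0 <= y -> nrm (f y) <= B * edecay y) ->
  exists2 F : R -> R[i], (forall y : R, dC F y (f y)) &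
    forall y : R, 0 <= y -> nrm (F y) <= 2 * B / theta * edecay y.
Proof.
move=> [c1 c2] fB.
have [|F1 d1 b1] := @ex_decay_antideriv (fun y => cRe (f y)) B c1.
  by move=> y y0; rewrite (le_trans (ler_Re_nrm _)) // fB.
have [|F2 d2 b2] := @ex_decay_antideriv (fun y => cIm (f y)) B c2.
  by move=> y y0; rewrite (le_trans (ler_Im_nrm _)) // fB.
exists (fun y => F1 y +i* F2 y) => [y|y y0]; first by split; [exact: d1|exact: d2].
rewrite (le_trans (ler_nrm_ReIm _)) //.
by rewrite -2!mulrA mulr_natl mulr2n lerD // mulrA ?b1 ?b2.
Qed.

End DecayingAntiderivative.
(** * The Riccati equation on a half-line *)

Section FixedPoint.
Context {R : realType}.

Lemma half_pow_small (b e : R) : 0 < e -> exists n : nat, b / 2 ^+ n <= e.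
Proof.
move=> e0; have [n nb] : exists n : nat, b / e <= n%:R.
  exists (Num.bound (b / e)); apply/ltW; have [b0|b0] := leP 0 (b / e).
    exact: archi_boundP.
  exact: lt_le_trans b0 _.
exists n; rewrite ler_pdivrMr ?exprn_gt0 // mulrC -ler_pdivrMr //.
rewrite (le_trans nb) // -natrX ler_nat.
by elim: {nb} n => // n ih; rewrite expnS mul2n -addnn -addn1 leq_add // expn_gt0.
Qed.

Lemma le_half_pow (a K b : R) : (forall n : nat, a <= K + b / 2 ^+ n) -> a <= K.
Proof.
move=> H; apply/ler_addgt0Pr => e e0; have [n hn] := half_pow_small b e0.
by rewrite (le_trans (H n)) // lerD2l.
Qed.

Lemma geometric_limit (a : nat -> R) (b : R) :
  (forall n, `|a n.+1 - a n| <= b / 2 ^+ n) ->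
  exists l, forall n, `|l - a n| <= 2 * b / 2 ^+ n.
Proof.
move=> H; have b0 : 0 <= b.
  by have := H 0; rewrite expr0 divr1; apply: le_trans.
pose e n := 2 * b / 2 ^+ n.
have eS n : e n.+1 = e n - b / 2 ^+ n by rewrite /e exprS; field; rewrite expf_neq0.
have e0 n : 0 <= e n by rewrite divr_ge0 ?exprn_ge0 // mulr_ge0.
have lo n k : a n - e n <= a (n + k)%N - e (n + k)%N.
  elim: k => [|k ih]; first by rewrite addn0.
  rewrite (le_trans ih) // addnS eS; have := H (n + k)%N; rewrite ler_norml => /andP[] *; lra.
have hi n k : a (n + k)%N + e (n + k)%N <= a n + e n.
  elim: k => [|k ih]; first by rewrite addn0.
  apply: le_trans ih; rewrite addnS eS; have := H (n + k)%N; rewrite ler_norml => /andP[] *; lra.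
have lohi n k : a n - e n <= a k + e k.
  have := lo n k; have := hi k n; rewrite addnC; have := e0 (n + k)%N => *; lra.
pose S := [set a n - e n | n in [set: nat]].
have SB k : ubound S (a k + e k) by move=> _ [n _ <-].
exists (sup S) => n; rewrite -/(e n) ler_norml.
have l1 : a n - e n <= sup S.
  by apply: ub_le_sup; [exists (a 0 + e 0); exact: SB|exists n].
have l2 : sup S <= a n + e n by apply: ge_sup => //; exists (a 0 - e 0); exists 0.
by apply/andP; split; lra.
Qed.

Lemma geometric_limitC (a : nat -> R[i]) (b : R) :
  (forall n, nrm (a n.+1 - a n) <= b / 2 ^+ n) ->
  exists l, forall n, nrm (l - a n) <= 4 * b / 2 ^+ n.
Proof.
move=> H.
have [n|l1 h1] := @geometric_limit (fun n => cRe (a n)) b.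
  by rewrite -cReB (le_trans (ler_Re_nrm _)).
have [n|l2 h2] := @geometric_limit (fun n => cIm (a n)) b.
  by rewrite -cImB (le_trans (ler_Im_nrm _)).
exists (l1 +i* l2) => n; rewrite (le_trans (ler_nrm_ReIm _)) // cReB cImB /=.
have := h1 n; have := h2 n; set t := b / 2 ^+ n.
by rewrite -!mulrA -/t => *; lra.
Qed.

(** Banach's fixed point theorem for a contraction of ratio [1/2] on a set of
    complex-valued functions, in the supremum norm of weight [om].  It serves
    twice: on functions of a half-line, and on a single complex number. *)
Lemma fixpoint_weighted (T : Type) (om : T -> R) (C : (T -> R[i]) -> Prop)
    (P : (T -> R[i]) -> T -> R[i]) (x0 : T -> R[i]) (B : R) :
  C x0 -> (forall x, C x -> C (P x)) ->
  (forall x y k, C x -> C y -> 0 <= k ->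
     (forall t, nrm (x t - y t) <= k * om t) ->
     forall t, nrm (P x t - P y t) <= k / 2 * om t) ->
  0 <= B -> (forall t, nrm (P x0 t - x0 t) <= B * om t) ->
  (forall (u : nat -> T -> R[i]) x, (forall n, C (u n)) ->
     (forall n t, nrm (x t - u n t) <= 4 * (B * om t) / 2 ^+ n) -> C x) ->
  exists x, [/\ C x, forall t, P x t = x t &
    forall t, nrm (x t - x0 t) <= 4 * B * om t].
Proof.
move=> C0 CP ctr B0 HB closed.
pose u n := iter n P x0.
have Cu n : C (u n) by elim: n => //= n ih; exact: CP.
have step n t : nrm (u n.+1 t - u n t) <= (B * om t) / 2 ^+ n.
  rewrite mulrAC; elim: n t => [|n ih] t; first by rewrite expr0 divr1; exact: HB.
  have k0 : 0 <= B / 2 ^+ n by rewrite divr_ge0 // exprn_ge0.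
  by rewrite exprSr invfM [X in X * om t]mulrA; exact: (ctr _ _ _ (Cu n.+1) (Cu n) k0 ih t).
have lim t : exists l, forall n, nrm (l - u n t) <= 4 * (B * om t) / 2 ^+ n.
  by apply: geometric_limitC => n; exact: step.
have [x hx] := choice lim.
have Cx : C x by apply: (closed u x Cu) => n t; exact: hx.
exists x; split => // t; last first.
  by have := hx t 0; rewrite expr0 divr1 mulrA.
apply/eqP; rewrite -subr_eq0 -nrm_eq0 eq_le nrm_ge0 andbT.
apply: (@le_half_pow _ _ (4 * (B * om t))) => n; rewrite add0r.
have h1 : nrm (P x t - u n.+1 t) <= 4 * B / 2 ^+ n / 2 * om t.
  apply: (ctr x (u n)) => // [|s].
    by rewrite divr_ge0 ?exprn_ge0 // mulr_ge0.
  by rewrite (le_trans (hx s n)) // -!mulrA (mulrC (om s)).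
have h2 := hx t n.+1.
rewrite (le_trans (nrm_split _ _ (u n.+1 t))) // (nrmC _ (x t)).
rewrite (le_trans (lerD h1 h2)) // exprS invfM.
by rewrite le_eqVlt; apply/orP; left; apply/eqP; field; rewrite expf_neq0.
Qed.

End FixedPoint.

Section HalfLineRiccati.
Context {R : realType} (theta : R) (theta_gt0 : 0 < theta).
Local Notation om := (edecay theta).

Lemma lipschitz_contC (f : R -> R[i]) (L : R) : 0 <= L ->
  (forall y z, nrm (f y - f z) <= L * `|y - z|) -> contC f.
Proof.
move=> L0 H.
have cont (g : R -> R) : (forall y z, `|g y - g z| <= L * `|y - z|) -> continuous g.
  move=> Hg y; apply/cvgrPdist_lt => e e0; near=> z.
  rewrite (le_lt_trans (Hg y z)) // (@le_lt_trans _ _ ((L + 1) * `|y - z|)) //.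
    by rewrite ler_wpM2r // lerDl.
  rewrite -ltr_pdivlMl ?ltr_wpDl //; near: z.
  have e1 : 0 < (L + 1)^-1 * e by rewrite mulr_gt0 // invr_gt0 ltr_wpDl.
  exact: (@nbhsx_ballx R R y _ e1).
split; apply: cont => y z.
  by rewrite -cReB (le_trans (ler_Re_nrm _)).
by rewrite -cImB (le_trans (ler_Im_nrm _)).
Unshelve. all: by end_near.
Qed.

(** The integral of [- f] from [y] to infinity.  As the decaying solution of
    [F' = f] it is unique on the half-line, and is picked by choice. *)
Definition tail_integral (f : R -> R[i]) : R -> R[i] :=
  if pselect (exists F, (forall y, dC F y (f y)) /\
    exists2 K, 0 <= K & forall y, 0 <= y -> nrm (F y) <= K * om y)
  is left h then sval (cid h) else fun=> 0.

Lemma tail_integralP (f : R -> R[i]) (B : R) : contC f ->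
  (forall y, 0 <= y -> nrm (f y) <= B * om y) ->
  (forall y, dC (tail_integral f) y (f y)) /\
  (forall y, 0 <= y -> nrm (tail_integral f y) <= 2 * B / theta * om y).
Proof.
move=> cf fB; rewrite /tail_integral; case: pselect => [h|[]]; last first.
  have [F dF FB] := ex_decay_antiderivC theta_gt0 cf fB.
  exists F; split => //; exists (2 * B / theta) => //.
  have := fB 0 (lexx _); rewrite edecay0 mulr1 => /(le_trans (nrm_ge0 _)) B0.
  by rewrite divr_ge0 ?mulr_ge0 // ltW.
case: cid => F /= [dF [K K0 FK]]; split => //.
exact: (decay_boundC theta_gt0 K0 (fun y _ => dF y) fB FK).
Qed.

Lemma tail_integral_dist (f g : R -> R[i]) (B C D : R) : contC f -> contC g ->
  (forall y, 0 <= y -> nrm (f y) <= B * om y) ->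
  (forall y, 0 <= y -> nrm (g y) <= C * om y) ->
  (forall y, 0 <= y -> nrm (f y - g y) <= D * om y) ->
  forall y, 0 <= y ->
    nrm (tail_integral f y - tail_integral g y) <= 2 * D / theta * om y.
Proof.
move=> cf cg fB gC fgD.
have [df bf] := tail_integralP cf fB; have [dg bg] := tail_integralP cg gC.
have B0 := le_trans (nrm_ge0 _) (fB 0 (lexx _)); rewrite edecay0 mulr1 in B0.
have C0 := le_trans (nrm_ge0 _) (gC 0 (lexx _)); rewrite edecay0 mulr1 in C0.
apply: (@decay_boundC _ _ theta_gt0 (fun y => tail_integral f y - tail_integral g y)
   (fun y => f y - g y) D (2 * B / theta + 2 * C / theta)) => //.
- by rewrite addr_ge0 // divr_ge0 ?mulr_ge0 // ltW.
- by move=> y _; apply: dCB.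
- move=> y y0; rewrite (le_trans (nrmB _ _)) // mulrDl lerD //; [exact: bf|exact: bg].
Qed.

Variable (alpha M : R).
Hypotheses (alpha_gt0 : 0 < alpha) (M_ge0 : 0 <= M) (small : 12 * alpha * M <= theta).

(** The weighted bound selects, among all solutions, the one that vanishes at
    infinity. *)
Definition riccati (F0 F1 F2 X : R -> R[i]) : Prop :=
  (forall y : R, 0 <= y ->
     dC X y (alpha%:C * (F0 y + F1 y * X y + F2 y * X y ^+ 2))) /\
  (forall y : R, 0 <= y -> nrm (X y) <= om y).

Definition riccati_data (F0 F1 F2 : R -> R[i]) : Prop :=
  forall y : R, 0 <= y ->
    [/\ nrm (F0 y) <= M * om y, nrm (F1 y) <= M & nrm (F2 y) <= M].

Lemma riccati_rhs_bound (f0 f1 f2 x : R[i]) (w : R) : 0 <= w <= 1 ->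
  nrm f0 <= M * w -> nrm f1 <= M -> nrm f2 <= M -> nrm x <= w ->
  nrm (f0 + f1 * x + f2 * x ^+ 2) <= 3 * M * w.
Proof.
move=> /andP[w0 w1] h0 h1 h2 hx.
have -> : 3 * M * w = M * w + M * w + M * w by ring.
rewrite (le_trans (nrmD _ _)) // lerD ?(le_trans (nrmD _ _)) ?lerD // nrmM ?nrmX.
  by rewrite ler_pM ?nrm_ge0.
rewrite ler_pM ?exprn_ge0 ?nrm_ge0 // (le_trans (y := w ^+ 2)) //.
  by rewrite ler_pXn2r ?nnegrE ?nrm_ge0.
by rewrite expr2 ler_piMl.
Qed.

Lemma riccati_rhs_dist (f0 f1 f2 x g0 g1 g2 z : R[i]) (w k D : R) :
  0 <= w <= 1 -> 0 <= k -> 0 <= D ->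
  nrm g1 <= M -> nrm g2 <= M -> nrm x <= w -> nrm z <= w ->
  nrm (f0 - g0) <= D * w -> nrm (f1 - g1) <= D -> nrm (f2 - g2) <= D ->
  nrm (x - z) <= k * w ->
  nrm (f0 + f1 * x + f2 * x ^+ 2 - (g0 + g1 * z + g2 * z ^+ 2))
    <= (3 * D + 3 * M * k) * w.
Proof.
move=> /andP[w0 w1] k0 D0 hg1 hg2 hx hz e0 e1 e2 ex.
have -> : f0 + f1 * x + f2 * x ^+ 2 - (g0 + g1 * z + g2 * z ^+ 2) =
  (f0 - g0) + ((f1 - g1) * x + (f2 - g2) * x ^+ 2) +
  (g1 * (x - z) + g2 * ((x + z) * (x - z))) by ring.
have x2 : nrm x ^+ 2 <= w.
  rewrite (le_trans (y := w ^+ 2)) //; first by rewrite ler_pXn2r ?nnegrE ?nrm_ge0.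
  by rewrite expr2 ler_piMl.
have xz : nrm (x + z) <= 2 by have := nrmD x z; lra.
have -> : (3 * D + 3 * M * k) * w =
  D * w + (D * w + D * w) + (M * (k * w) + M * (2 * (k * w))) by ring.
rewrite (le_trans (nrmD _ _)) // lerD //; last first.
  rewrite (le_trans (nrmD _ _)) // !nrmM lerD //.
    by rewrite ler_pM ?nrm_ge0.
  by rewrite ler_pM ?nrm_ge0 ?mulr_ge0 ?nrm_ge0 // ler_pM ?nrm_ge0.
rewrite (le_trans (nrmD _ _)) // lerD // (le_trans (nrmD _ _)) // lerD // nrmM ?nrmX.
  by rewrite ler_pM ?nrm_ge0.
by rewrite ler_pM ?exprn_ge0 ?nrm_ge0.
Qed.

Lemma om_itv y : 0 <= y -> 0 <= om y <= 1.
Proof. by move=> y0; rewrite edecay_ge0 edecay_le1. Qed.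

(** Integrating the equation from infinity gains the factor [alpha] in front of
    its right-hand side. *)
Lemma riccati_bound F0 F1 F2 X : riccati_data F0 F1 F2 -> riccati F0 F1 F2 X ->
  forall y : R, 0 <= y -> nrm (X y) <= 6 * M / theta * alpha * om y.
Proof.
move=> HF [dX bX] y y0.
rewrite (_ : 6 * M / theta * alpha = 2 * (alpha * (3 * M)) / theta); last first.
  by field; rewrite gt_eqF.
apply: (@decay_boundC _ _ theta_gt0 X _ (alpha * (3 * M)) 1 ler01 dX) => // z z0; last first.
  by rewrite mul1r; exact: bX.
have [h0 h1 h2] := HF z z0.
rewrite nrmM nrmR (ger0_norm (ltW alpha_gt0)) -mulrA ler_pM2l //.
by apply: riccati_rhs_bound; rewrite ?om_itv ?bX.
Qed.

(** Comparing two problems: if the difference is at most [k * om], the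
    equation improves [k] to [k / 2 + O(D)], so that [k] may be iterated
    down to [O(D)]. *)
Lemma riccati_dep F0 F1 F2 X G0 G1 G2 Z D : 0 <= D ->
  riccati_data F0 F1 F2 -> riccati_data G0 G1 G2 ->
  riccati F0 F1 F2 X -> riccati G0 G1 G2 Z ->
  (forall y, 0 <= y -> [/\ nrm (F0 y - G0 y) <= D * om y,
     nrm (F1 y - G1 y) <= D & nrm (F2 y - G2 y) <= D]) ->
  forall y : R, 0 <= y -> nrm (X y - Z y) <= 12 * D / theta * alpha * om y.
Proof.
move=> D0 HF HG [dX bX] [dZ bZ] HD.
set K := 12 * D / theta * alpha.
have K0 : 0 <= K by rewrite mulr_ge0 ?divr_ge0 ?mulr_ge0 // ltW.
have bXZ y : 0 <= y -> nrm (X y - Z y) <= 2 * om y.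
  by move=> y0; rewrite (le_trans (nrmB _ _)) // mulr_natl mulr2n lerD ?bX ?bZ.
suff H (n : nat) (y : R) : 0 <= y -> nrm (X y - Z y) <= (K + 2 / 2 ^+ n) * om y.
  move=> y y0; apply: (@le_half_pow _ _ _ (2 * om y)) => n.
  by rewrite (le_trans (H n y y0)) // mulrDl lerD2l mulrAC.
elim: n y => [|n ih] y y0.
  by rewrite (le_trans (bXZ y y0)) // ler_wpM2r ?edecay_ge0 // expr0 divr1 lerDr.
set k := K + 2 / 2 ^+ n in ih.
have k0 : 0 <= k by rewrite addr_ge0 // divr_ge0 // exprn_ge0.
have step : nrm (X y - Z y) <= 2 * (alpha * (3 * D + 3 * M * k)) / theta * om y.
  apply: (@decay_boundC _ _ theta_gt0 (fun y => X y - Z y) _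
    (alpha * (3 * D + 3 * M * k)) 2 (ler0n _ 2)
    (fun z hz => dCB (dX z hz) (dZ z hz)) _ bXZ y y0) => // z z0.
  rewrite -mulrBr nrmM nrmR (ger0_norm (ltW alpha_gt0)) -mulrA ler_pM2l //.
  have [h1 h2 h3] := HD z z0; have [_ ? ?] := HG z z0.
  by apply: riccati_rhs_dist; rewrite ?om_itv ?bX ?bZ ?ih.
rewrite (le_trans step) // ler_wpM2r ?edecay_ge0 // ler_pdivrMr //.
have -> : (K + 2 / 2 ^+ n.+1) * theta = K / 2 * theta + k / 2 * theta.
  by rewrite exprS /k; field; rewrite expf_neq0.
have -> : K / 2 * theta = 6 * alpha * D by rewrite /K; field; rewrite gt_eqF.
have := ler_wpM2r k0 small => *; nra.
Qed.

(** Picard iteration from infinity, among the functions that are bounded by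
    [om] and [6 alpha M]-Lipschitz.  The Lipschitz condition survives pointwise
    limits and provides the continuity needed to integrate the right-hand
    side. *)
Lemma riccati_ex F0 F1 F2 : contC F0 -> contC F1 -> contC F2 ->
  riccati_data F0 F1 F2 -> exists X, riccati F0 F1 F2 X.
Proof.
move=> c0 c1 c2 HF.
(* Composing with [p] turns data given on the half-line into functions on [R]. *)
pose p (y : R) := Num.max y 0.
have p0 y : 0 <= p y by rewrite le_max lexx orbT.
have pE y : 0 <= y -> p y = y by move=> y0; rewrite /p; apply/max_idPl.
have plip y z : `|p y - p z| <= `|y - z|.
  have h1 := ler_norm (y - z); have h2 := ler_norm (z - y); rewrite distrC in h2.
  rewrite ler_norml; apply/andP; split; rewrite /p !maxEle;
    by do 2 case: ifPn; rewrite -?ltNge => *; lra.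
have cp : continuous p.
  by move=> y; apply: continuous_max => //; exact: cst_continuous.
pose rhs (x : R -> R[i]) y := F0 (p y) + F1 (p y) * x (p y) + F2 (p y) * x (p y) ^+ 2.
pose L := 6 * alpha * M.
have L0 : 0 <= L by rewrite !mulr_ge0 // ltW.
pose C (x : R -> R[i]) := (forall y, nrm (x y) <= om (p y)) /\
  (forall y z, nrm (x y - x z) <= L * `|y - z|).
have crhs x : C x -> contC (rhs x).
  move=> [_ /(lipschitz_contC L0) cx].
  have cx' := contC_comp cx cp.
  apply: contCD; last apply: contCM.
  - by apply: contCD; [|apply: contCM] => //; apply: contC_comp.
  - exact: contC_comp.
  - by rewrite (_ : (fun y => _) = (fun y => x (p y) * x (p y))) //; apply: contCM.
have pp y : p (p y) = p y by rewrite pE.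
have brhs x y : C x -> 0 <= y -> nrm (rhs x y) <= 3 * M * om y.
  move=> [bx _] y0; rewrite /rhs pE //; have [h0 h1 h2] := HF y y0.
  by apply: riccati_rhs_bound; rewrite ?om_itv // (le_trans (bx y)) // pE.
pose P (x : R -> R[i]) y := alpha%:C * tail_integral (rhs x) (p y).
have a6 : alpha * (2 * (3 * M) / theta) <= 1.
  rewrite mulrA ler_pdivrMr // mul1r; apply: le_trans small.
  have aM : 0 <= alpha * M by rewrite mulr_ge0 // ltW.
  nra.
have CP x : C x -> C (P x).
  move=> Cx; have [d b] := tail_integralP (crhs x Cx) (fun y => brhs x y Cx).
  split => [y|y z].
    rewrite /P nrmM nrmR (ger0_norm (ltW alpha_gt0)).
    rewrite (le_trans (ler_wpM2l (ltW alpha_gt0) (b _ (p0 y)))) //.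
    by rewrite [leLHS]mulrA ger_pMl ?edecay_gt0.
  rewrite /P -mulrBr nrmM nrmR (ger0_norm (ltW alpha_gt0)).
  rewrite /L (_ : 6 * alpha * M = alpha * (2 * (3 * M))); last by ring.
  rewrite -mulrA ler_pM2l //.
  apply: (le_trans (y := 2 * (3 * M) * `|p y - p z|)); last first.
    by rewrite ler_wpM2l ?mulr_ge0.
  have bd u v : 0 <= u -> u <= v ->
      nrm (tail_integral (rhs x) v - tail_integral (rhs x) u) <= 2 * (3 * M) * (v - u).
    move=> u0 uv; apply: (mvt_nrm uv (fun s _ => d s)) => s /andP[us _].
    have s0 := le_trans u0 us.
    by rewrite (le_trans (brhs x s Cx s0)) // ler_piMr ?mulr_ge0 ?edecay_le1.
  have [yz|zy] := leP (p y) (p z).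
    by rewrite nrmC distrC ger0_norm ?subr_ge0 // bd.
  by rewrite ger0_norm ?subr_ge0 ?bd // ltW.
have C0 : C (fun=> 0).
  split => [y|y z]; first by rewrite nrm0 edecay_ge0.
  by rewrite subrr nrm0 mulr_ge0.
have ctr x z k : C x -> C z -> 0 <= k ->
     (forall t, nrm (x t - z t) <= k * om (p t)) ->
     forall t, nrm (P x t - P z t) <= k / 2 * om (p t).
  move=> Cx Cz k0 xz t; rewrite /P -mulrBr nrmM nrmR (ger0_norm (ltW alpha_gt0)).
  have H := tail_integral_dist (crhs x Cx) (crhs z Cz) (fun y => brhs x y Cx)
    (fun y => brhs z y Cz).
  have {H} := H (3 * 0 + 3 * M * k) _ (p t) (p0 t).
  have hd (y : R) : 0 <= y -> nrm (rhs x y - rhs z y) <= (3 * 0 + 3 * M * k) * om y.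
    move=> y0; rewrite /rhs pE //; have [_ h1 h2] := HF y y0.
    have [[bx _] [bz _]] := (Cx, Cz).
    have := bx y; have := bz y; have := xz y; rewrite pE // => ? ? ?.
    by apply: riccati_rhs_dist; rewrite ?om_itv ?subrr ?nrm0 ?mul0r.
  move=> /(_ hd) H; rewrite (le_trans (ler_wpM2l (ltW alpha_gt0) H)) //.
  rewrite [leLHS]mulrA ler_wpM2r ?edecay_ge0 // mulr0 add0r.
  by rewrite [leLHS]mulrA ler_pdivrMr //; have := ler_wpM2r k0 small => *; nra.
have closed (u : nat -> R -> R[i]) x : (forall n, C (u n)) ->
     (forall n t, nrm (x t - u n t) <= 4 * (1 * om (p t)) / 2 ^+ n) -> C x.
  move=> Cu ux; split => [y|y z].
    apply: (@le_half_pow _ _ _ (4 * (1 * om (p y)))) => n.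
    rewrite -(subrK (u n y) (x y)) (le_trans (nrmD _ _)) // addrC lerD ?ux //.
    by have [+ _] := Cu n; apply.
  apply: (@le_half_pow _ _ _ (4 * (1 * om (p y)) + 4 * (1 * om (p z)))) => n.
  have -> : x y - x z = (u n y - u n z) + ((x y - u n y) - (x z - u n z)) by ring.
  rewrite (le_trans (nrmD _ _)) // lerD //; first by have [_ +] := Cu n; apply.
  by rewrite (le_trans (nrmB _ _)) // mulrDl lerD.
have [t|x [Cx Px _]] := fixpoint_weighted C0 CP ctr ler01 _ closed.
  have [+ _] := CP _ C0 => /(_ t); rewrite subr0 mul1r; exact.
have [d b] := tail_integralP (crhs x Cx) (fun y => brhs x y Cx).
have xE (y : R) : 0 <= y -> alpha%:C * tail_integral (rhs x) y = x y.
  by move=> y0; rewrite -[in RHS]Px /P pE.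
exists (fun y => alpha%:C * tail_integral (rhs x) y); split => y y0.
  by apply: (dC_eqf (dCZ _ (d y))) => //; rewrite /rhs pE // xE.
by rewrite xE //; have [+ _] := Cx => /(_ y); rewrite pE.
Qed.

End HalfLineRiccati.
(** * Weak derivatives and travelling waves *)

Section Sobolev.
Context {R : realType}.

Lemma bounded_continuous_Lfun (f : R -> R) (B : R) : continuous f ->
  (forall y, `|f y| <= B) -> f \in Lfun (@lebesgue_measure R) +oo%E.
Proof.
move=> cf fB; apply/andP; split; rewrite inE /=.
  exact: continuous_measurable_fun.
rewrite /finite_norm unlock; case: ifP => // _.
apply: (@le_lt_trans _ _ B%:E); last exact: ltry.
by apply/ess_supP; apply/aeW => y /=; rewrite lee_fin fB.
Qed.

Lemma derive_outside (phi : R -> R) (M y : R) :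
  (forall y, M < `|y| -> phi y = 0) -> M < `|y| -> derive1 phi y = 0.
Proof.
move=> H My; suff /is_derive1E[] : is_derive y 1 phi 0 by [].
have d0 : is_derive y 1 (fun=> 0 : R) 0 by exact: is_derive_cst.
apply: near_eq_is_derive d0.
have cn : {for y, continuous (fun z : R => `|z|)} by exact: norm_continuous.
near=> z; rewrite H //; near: z.
exact: (cvgr_gt _ cn).
Unshelve. all: by end_near.
Qed.

(** The test function vanishes outside some [[-N, N]], where the integration by
    parts has no boundary terms. *)
Lemma C1_weak_derivative (f f' : R -> R) :
  (forall y : R, is_derive y 1 f (f' y)) -> continuous f' -> weak_derivative f f'.
Proof.
move=> df cf' phi [dphi [M phiM]].
have d0 (y : R) : is_derive y 1 phi (derive1 phi y).
  by apply: is_derive_derive1; exact: (dphi 0%N).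
have d1 (y : R) : derivable (derive1 phi) y 1 by exact: (dphi 1%N).
have cphi : continuous phi by move=> y; exact: is_derive_cont (d0 y).
have cphi' : continuous (derive1 phi).
  by move=> y; apply: differentiable_continuous; apply/derivable1_diffP.
have cf : continuous f by move=> y; exact: is_derive_cont (df y).
pose N := `|M| + 1.
have N0 : 0 < N by rewrite ltr_wpDl.
have NM y : y \notin `[-N, N]%R -> M < `|y|.
  rewrite in_itv /= -ler_norml -ltNge; apply: le_lt_trans.
  by rewrite (le_trans (ler_norm M)) // lerDl.
have phiN y : N <= `|y| -> phi y = 0.
  move=> h; apply: phiM; apply: lt_le_trans h.
  by rewrite (le_lt_trans (ler_norm M)) // ltrDl.
have restr (g h : R -> R) : (forall y, y \notin `[-N, N]%R -> h y = 0) ->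
    \int[@lebesgue_measure R]_y (g y * h y) =
    \int[@lebesgue_measure R]_(y in `[-N, N]) (g y * h y).
  move=> h0; rewrite [RHS]Rintegral_mkcond; apply: eq_Rintegral => y _.
  rewrite patchE; case: ifPn => // yN.
  by rewrite h0 ?mulr0 //; apply: contra yN => yN; rewrite inE.
rewrite restr; last by move=> y /NM /(derive_outside phiM).
rewrite restr; last by move=> y /NM /phiM.
have NN : - N < N by rewrite (lt_trans _ N0) // oppr_lt0.
have aN : `|N| = N by rewrite ger0_norm // ltW.
rewrite (@Rintegration_by_parts _ f phi f' (derive1 phi) (- N) N NN) //.
- by rewrite (phiN N) ?aN // (phiN (- N)) ?normrN ?aN // !mulr0 subrr sub0r.
- exact: continuous_subspaceT.
- split => [y _||].
  + by have [] := is_derive1E (df y).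
  + exact: cvg_at_right_filter (cf _).
  + exact: cvg_at_left_filter (cf _).
- by move=> y _; have [] := is_derive1E (df y).
- exact: continuous_subspaceT.
- split => [y _||].
  + exact: (dphi 0%N).
  + exact: cvg_at_right_filter (cphi _).
  + exact: cvg_at_left_filter (cphi _).
Qed.

(** Bounded continuous functions: the classical counterpart of [W^{0,oo}]. *)
Definition BC (f : R -> R[i]) : Prop :=
  contC f /\ exists B, forall y, nrm (f y) <= B.

Lemma BC_cst (c : R[i]) : BC (fun=> c).
Proof. by split; [exact: contC_cst | exists (nrm c)]. Qed.

Lemma BC_real (f : R -> R) (B : R) : continuous f -> (forall y, `|f y| <= B) ->
  BC (fun y => (f y)%:C).
Proof. by move=> cf fB; split; [exact: contC_real | exists B => y; rewrite nrmR]. Qed.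

Lemma BCD f g : BC f -> BC g -> BC (fun y => f y + g y).
Proof.
move=> [cf [B fB]] [cg [C gC]]; split; first exact: contCD.
by exists (B + C) => y; rewrite (le_trans (nrmD _ _)) // lerD.
Qed.

Lemma BCN f : BC f -> BC (fun y => - f y).
Proof. by move=> [cf [B fB]]; split; [exact: contCN | exists B => y; rewrite nrmN]. Qed.

Lemma BCB f g : BC f -> BC g -> BC (fun y => f y - g y).
Proof. by move=> hf hg; apply: BCD => //; exact: BCN. Qed.

Lemma BCM f g : BC f -> BC g -> BC (fun y => f y * g y).
Proof.
move=> [cf [B fB]] [cg [C gC]]; split; first exact: contCM.
by exists (B * C) => y; rewrite nrmM ler_pM ?nrm_ge0.
Qed.

Lemma BC_Winfty0 f : BC f -> WinftyC 0 f.
Proof.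
move=> [[c1 c2] [B fB]]; split; split => //; apply: (@bounded_continuous_Lfun _ B) => // y.
  by rewrite (le_trans (ler_Re_nrm _)).
by rewrite (le_trans (ler_Im_nrm _)).
Qed.

Lemma WinftyC_S k f f' : BC f -> (forall y : R, dC f y (f' y)) -> contC f' ->
  WinftyC k f' -> WinftyC k.+1 f.
Proof.
move=> hf df [c1 c2] [w1 w2]; have [[h1 _] [h2 _]] := BC_Winfty0 hf.
split; (split; first by []).
  exists (fun y => cRe (f' y)); split => //; apply: C1_weak_derivative => // y.
  by have [] := df y.
exists (fun y => cIm (f' y)); split => //; apply: C1_weak_derivative => // y.
by have [] := df y.
Qed.

End Sobolev.

Section Waves.
Context {R : realType} (alpha : R) (c : R[i]).

Definition phase (t x : R) : R[i] :=
  expC ('i%C * alpha%:C * (x%:C - c * t%:C)).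

Lemma waveE (a : R -> R[i]) t x y :
  wave alpha c a t x y = 2 * cRe (a y * phase t x).
Proof.
rewrite /wave -/(phase t x); case: (a y * phase t x) => p q /=.
by rewrite mulr_natl mulr2n.
Qed.

Lemma dC_phase_t t x : dC (phase^~ x) t (- ('i%C * alpha%:C * c) * phase t x).
Proof.
have d : dC (fun s => 'i%C * alpha%:C * (x%:C - c * s%:C)) t (- ('i%C * alpha%:C * c)).
  apply: (dC_eqf (dCZ ('i%C * alpha%:C) (dCB (dC_cst x%:C t)
    (dCZ c (dC_real (is_derive_id t 1)))))) => //.
  by rewrite rmorph1 sub0r; ring.
exact: dC_expC d.
Qed.

Lemma dC_phase_x t x : dC (phase t) x ('i%C * alpha%:C * phase t x).
Proof.
have d : dC (fun s => 'i%C * alpha%:C * (s%:C - c * t%:C)) x ('i%C * alpha%:C).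
  apply: (dC_eqf (dCZ ('i%C * alpha%:C) (dCB (dC_real (is_derive_id x 1))
    (dC_cst (c * t%:C) x)))) => //.
  by rewrite rmorph1 subr0 mulr1.
exact: dC_expC d.
Qed.

Lemma is_derive_2Re (f : R -> R[i]) s l : dC f s l ->
  is_derive s 1 (fun z => 2 * cRe (f z)) (2 * cRe l).
Proof. by move=> [H _]; apply: (is_derive_eqf (is_deriveZ 2 H)). Qed.

Lemma wave_dt (a : R -> R[i]) (t x y : R) :
  is_derive t 1 (fun s => wave alpha c a s x y)
    (2 * cRe (- ('i%C * alpha%:C * c) * a y * phase t x)).
Proof.
apply: (is_derive_eqf (is_derive_2Re (dCZ (a y) (dC_phase_t t x)))) => [s|].
  by rewrite waveE.
by congr (2 * cRe _); ring.
Qed.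

Lemma wave_dx (a : R -> R[i]) (t x y : R) :
  is_derive x 1 (fun s => wave alpha c a t s y)
    (2 * cRe ('i%C * alpha%:C * a y * phase t x)).
Proof.
apply: (is_derive_eqf (is_derive_2Re (dCZ (a y) (dC_phase_x t x)))) => [s|].
  by rewrite waveE.
by congr (2 * cRe _); ring.
Qed.

Lemma wave_dy (a : R -> R[i]) (t x y : R) (l : R[i]) : dC a y l ->
  is_derive y 1 (fun s => wave alpha c a t x s) (2 * cRe (l * phase t x)).
Proof.
move=> da; apply: (is_derive_eqf (is_derive_2Re (dCM da (dC_cst (phase t x) y)))) => [s|].
  by rewrite waveE.
by rewrite mulr0 addr0.
Qed.

Lemma exp_decay_vanishes (f : R -> R) (K k : R) : 0 < k ->
  (forall y, `|f y| <= K * expR (- (k * `|y|))) -> vanishes_at_infty f.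
Proof.
move=> k0 fK; have K0 : 0 <= K.
  have := fK 0; rewrite normr0 mulr0 oppr0 expR0 mulr1; exact: le_trans.
have small (e : R) : 0 < e -> exists z, forall y, z <= `|y| -> `|f y| < e.
  move=> e0; have [|z _ hz] := @edecay_small _ _ k0 (e / (K + 1)) 0.
    by rewrite divr_gt0 // ltr_wpDl.
  exists z => y zy; rewrite (le_lt_trans (fK y)) //.
  rewrite (@le_lt_trans _ _ (K * (e / (K + 1)))) //.
    rewrite ler_wpM2l // (le_trans _ hz) // /edecay ler_expR lerN2.
    by rewrite ler_pM2l.
  by rewrite mulrA ltr_pdivrMr ?ltr_wpDl // mulrC ltr_pM2l // ltrDl.
split; apply/cvgr0Pnorm_lt => e e0; have [z hz] := small e e0.
  near=> y; apply: hz; apply: le_trans (ler_norm _); near: y.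
  by apply: nbhs_pinfty_ge; rewrite num_real.
near=> y; apply: hz; rewrite -normrN; apply: le_trans (ler_norm _).
rewrite lerNr; near: y.
by apply: nbhs_ninfty_le; rewrite num_real.
Unshelve. all: by end_near.
Qed.

(** Differentiating a wave in [t], [X] or [Y] multiplies or differentiates its
    amplitude, so each equation of the system is twice the real part of a mode
    equation times the phase. *)
Lemma mode_linearized_euler (m : R) (U : R -> R) (rho u v : R -> R[i]) :
  (forall t x, vanishes_at_infty (wave alpha c v t x)) ->
  mode_equations m U alpha c rho u v ->
  linearized_euler_solution m U (wave alpha c rho) (wave alpha c u) (wave alpha c v).
Proof.
move=> van [dd e1 e2 e3 _].
have dCf f y : derivable_cplx f y -> dC f y (derive_cplx f y).
  by move=> [h1 h2]; split; apply: is_derive_derive1.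
have Et f t x y : pdt (wave alpha c f) t x y =
    2 * cRe (- ('i%C * alpha%:C * c) * f y * phase t x).
  by have [] := is_derive1E (wave_dt f t x y).
have Ex f t x y : pdX (wave alpha c f) t x y =
    2 * cRe ('i%C * alpha%:C * f y * phase t x).
  by have [] := is_derive1E (wave_dx f t x y).
have Ey f t x y : derivable_cplx f y -> pdY (wave alpha c f) t x y =
    2 * cRe (derive_cplx f y * phase t x).
  by move=> /dCf d; have [] := is_derive1E (wave_dy t x d).
have real (a : R) (z : R[i]) : a * (2 * cRe z) = 2 * cRe (a%:C * z).
  by rewrite cReMr; ring.
have van0 (z E : R[i]) : z = 0 -> 2 * cRe (z * E) = 0.
  by move=> ->; rewrite mul0r /= mulr0.
split => //.
- move=> t x y; have [d1 d2 d3] := dd y.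
  have ex (f : R -> R) (s l : R) : is_derive s 1 f l -> derivable f s 1.
    by move=> /is_derive1E[].
  split; first by split; apply: ex; exact: wave_dt.
  split; first by split; apply: ex; exact: wave_dx.
  by split; apply: ex; apply: wave_dy; exact: dCf.
- move=> t x y; have [d1 d2 d3] := dd y.
  rewrite Et !Ex Ey // real -!mulrDr -!cReD.
  apply: (etrans _ (van0 _ (phase t x) (e1 y))).
  by congr (2 * cRe _); ring.
- move=> t x y.
  rewrite Et !Ex waveE !real -!mulrDr -!cReD.
  apply: (etrans _ (van0 _ (phase t x) (e2 y))).
  by congr (2 * cRe _); ring.
- move=> t x y; have [d1 d2 d3] := dd y.
  rewrite Et !Ex Ey // !real -!mulrDr -!cReD.
  apply: (etrans _ (van0 _ (phase t x) (e3 y))).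
  by congr (2 * cRe _); ring.
Qed.

End Waves.

Definition has_mode {R : realType} (m : R) (U : R -> R) (alpha : R) (c : R[i]) : Prop :=
  exists rho u v : R -> R[i],
  [/\ nontrivial (wave alpha c rho) (wave alpha c u) (wave alpha c v),
      linearized_euler_solution m U (wave alpha c rho) (wave alpha c u) (wave alpha c v),
      [/\ WinftyC 1 rho, WinftyC 1 u & WinftyC 2 v] &
      mode_equations m U alpha c rho u v].

(** * From the Riccati equation to a mode *)

Section Mode.
Context {R : realType}.
Variables (m alpha B Y0 kap : R) (c : R[i]) (U U1 U2 : R -> R) (r : R -> R[i]).
Hypotheses (m_gt0 : 0 < m) (alpha_gt0 : 0 < alpha) (Imc : 0 < cIm c).
Hypotheses (dU : forall y : R, is_derive y 1 U (U1 y))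
  (dU1 : forall y : R, is_derive y 1 U1 (U2 y)) (cU2 : continuous U2).
Hypotheses (bU : forall y, `|U y| <= B) (bU1 : forall y, `|U1 y| <= B)
  (bU2 : forall y, `|U2 y| <= B) (br : forall y, nrm (r y) <= B).
Let w (y : R) : R[i] := (U y)%:C - c.
Hypothesis dr : forall y : R,
  dC r y (alpha%:C * ((w y)^-1 ^+ 2 - (m ^+ 2)%:C - w y ^+ 2 * r y ^+ 2)).
Hypotheses (Y0_ge0 : 0 <= Y0) (kap_gt0 : 0 < kap)
  (decay_right : forall y, Y0 <= y -> cRe (w y ^+ 2 * r y) <= - kap)
  (decay_left : forall y, y <= - Y0 -> kap <= cRe (w y ^+ 2 * r y)).

Let w_ge y : cIm c <= nrm (w y).
Proof.
rewrite (le_trans _ (ler_Im_nrm _)) // cImB /= sub0r normrN.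
by rewrite ler_norm.
Qed.

Let w_neq0 y : w y != 0.
Proof. by rewrite -nrm_gt0 (lt_le_trans Imc). Qed.

Let dw (y : R) : dC w y (U1 y)%:C.
Proof. by apply: (dC_eqf (dCB (dC_real (dU y)) (dC_cst c y))) => //; rewrite subr0. Qed.

Let dwV (y : R) : dC (fun z => (w z)^-1) y (- (U1 y)%:C * (w y)^-1 ^+ 2).
Proof. by rewrite exprVn; exact: dCV. Qed.

Let cU : continuous U. Proof. by move=> y; exact: is_derive_cont (dU y). Qed.
Let cU1 : continuous U1. Proof. by move=> y; exact: is_derive_cont (dU1 y). Qed.
Let BCU1 : BC (fun y => (U1 y)%:C). Proof. exact: BC_real bU1. Qed.
Let BCU2 : BC (fun y => (U2 y)%:C). Proof. exact: BC_real bU2. Qed.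
Let BCw : BC w. Proof. by apply: BCB; [exact: BC_real bU | exact: BC_cst]. Qed.
Let BCr : BC r. Proof. by split; [exact: dC_contC dr | exists B]. Qed.
Let BCwV : BC (fun y => (w y)^-1).
Proof.
split; first exact: dC_contC dwV.
exists (cIm c)^-1 => y; rewrite nrmV lef_pV2 ?posrE //.
by rewrite (lt_le_trans Imc).
Qed.

Let BC_sqr (f : R -> R[i]) : BC f -> BC (fun y => f y ^+ 2).
Proof. by move=> hf; rewrite (_ : (fun y => _) = (fun y => f y * f y)) //; exact: BCM. Qed.

(** The exponent [Q] has derivative [alpha w^2 r], whose real part is bounded
    everywhere, at most [- alpha kap] far on the right and at least
    [alpha kap] far on the left. *)
Lemma pressure_ex : exists2 p : R -> R[i],
  forall y : R, dC p y (alpha%:C * (w y ^+ 2 * r y) * p y) &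
  p 0 = 1 /\ exists K, forall y, nrm (p y) <= K * expR (- (alpha * kap * `|y|)).
Proof.
have BCg : BC (fun y => alpha%:C * (w y ^+ 2 * r y)).
  by apply: BCM (BC_cst _) (BCM (BC_sqr BCw) BCr).
have [[cg _] [A gA]] := (BCg, BCg.2).
have [Q dQ] := ex_antiderivC cg.
pose p y := expC (Q y - Q 0).
have dQ0 (y : R) : dC (fun y => Q y - Q 0) y (alpha%:C * (w y ^+ 2 * r y)).
  by apply: (dC_eqf (dCB (dQ y) (dC_cst (Q 0) y))) => //; rewrite subr0.
exists p; first by move=> y; exact: (dC_expC (dQ0 y)).
split; first by rewrite /p subrr expC0.
pose P y := cRe (Q y - Q 0).
have dP (y : R) : is_derive y 1 P (cRe (alpha%:C * (w y ^+ 2 * r y))) by have [] := dQ0 y.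
have A0 : 0 <= A := le_trans (nrm_ge0 _) (gA 0).
have P0 : P 0 = 0 by rewrite /P subrr.
have ak : 0 < alpha * kap by rewrite mulr_gt0.
have near0 (y : R) : P y <= A * `|y|.
  have dB x : `|cRe (alpha%:C * (w x ^+ 2 * r x))| <= A.
    by rewrite (le_trans (ler_Re_nrm _)).
  have [y0|/ltW y0] := leP 0 y.
    have := mvt_norm y0 (fun x _ => dP x) (fun x _ => dB x).
    by rewrite P0 !subr0 (ger0_norm y0); apply: le_trans (ler_norm _).
  have := mvt_norm y0 (fun x _ => dP x) (fun x _ => dB x).
  by rewrite P0 !sub0r normrN (ler0_norm y0); apply: le_trans (ler_norm _).
have bound (y : R) : P y <= (A + alpha * kap) * Y0 - alpha * kap * `|y|.
  have [yY|Yy] := leP `|y| Y0.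
    apply: (le_trans (near0 y)); have := ler_wpM2l A0 yY; have := ler_wpM2l (ltW ak) yY => *; lra.
  have AY := near0 Y0; have AY' := near0 (- Y0); rewrite normrN in AY'.
  rewrite (ger0_norm Y0_ge0) in AY AY'.
  have [y0|y0] := leP 0 y.
    rewrite (ger0_norm y0) in Yy *.
    have dZ (x : R) := is_deriveD (dP x) (is_deriveZ (alpha * kap) (is_derive_id x 1)).
    have := mvt_nincr (ltW Yy) (fun x _ => dZ x).
    have h (x : R) : Y0 <= x <= y ->
        cRe (alpha%:C * (w x ^+ 2 * r x)) + alpha * kap *: 1 <= 0.
      move=> /andP[hx _]; rewrite cReMr /GRing.scale /= mulr1 -mulrDr.
      by rewrite pmulr_rle0 // -lerBrDr sub0r decay_right.
    move=> /(_ h); rewrite !fctE /= /GRing.scale /= => *; lra.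
  rewrite (ltr0_norm y0) in Yy *.
  have dZ (x : R) := is_deriveB (dP x) (is_deriveZ (alpha * kap) (is_derive_id x 1)).
  have yY : y <= - Y0 by rewrite lerNr ltW.
  have := mvt_ndecr yY (fun x _ => dZ x).
  have h (x : R) : y <= x <= - Y0 ->
      0 <= cRe (alpha%:C * (w x ^+ 2 * r x)) - alpha * kap *: 1.
    move=> /andP[_ hx]; rewrite cReMr /GRing.scale /= mulr1 -mulrBr.
    by rewrite pmulr_rge0 // subr_ge0 decay_left.
  move=> /(_ h); rewrite !fctE /= /GRing.scale /= => *; lra.
exists (expR ((A + alpha * kap) * Y0)) => y.
by rewrite nrm_expC -expRD ler_expR bound.
Qed.

(** With [p = rho / m^2] and [v = i w r p] the mode equations become
    [p' = alpha w^2 r p] together with the Riccati equation for [r].  So the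
    pressure is recovered by a quadrature and the velocity algebraically. *)
Lemma mode_of_riccati : has_mode m U alpha c.
Proof.
have [p dp [p0 [K pK]]] := pressure_ex.
have aC0 : alpha%:C != 0 :> R[i] by rewrite -nrm_eq0 nrmR normr_eq0 gt_eqF.
have mC0 : m%:C != 0 :> R[i] by rewrite -nrm_eq0 nrmR normr_eq0 gt_eqF.
have ak : 0 < alpha * kap by rewrite mulr_gt0.
have K0 : 0 <= K.
  by have := pK 0; rewrite normr0 mulr0 oppr0 expR0 mulr1; apply: le_trans (nrm_ge0 _).
have BCp : BC p.
  split; first exact: dC_contC dp.
  exists K => y; rewrite (le_trans (pK y)) // ler_piMr // expR_le1 oppr_le0.
  by rewrite mulr_ge0 // ltW.
have BCi : BC (fun=> 'i%C : R[i]) := BC_cst _.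
have BCa : BC (fun=> alpha%:C : R[i]) := BC_cst _.
have BCm : BC (fun=> (m ^+ 2)%:C : R[i]) := BC_cst _.
have BCaV : BC (fun=> (alpha%:C)^-1 : R[i]) := BC_cst _.
pose p' y := alpha%:C * (w y ^+ 2 * r y) * p y.
pose r' y := alpha%:C * ((w y)^-1 ^+ 2 - (m ^+ 2)%:C - w y ^+ 2 * r y ^+ 2).
have BCp' : BC p' by apply: BCM (BCM BCa (BCM (BC_sqr BCw) BCr)) BCp.
have BCr' : BC r'.
  by apply: BCM BCa (BCB (BCB (BC_sqr BCwV) BCm) (BCM (BC_sqr BCw) (BC_sqr BCr))).
pose rho y := (m ^+ 2)%:C * p y.
pose h y := r y * (U1 y)%:C * (alpha%:C)^-1 + (w y)^-1.
pose u y := - p y * h y.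
pose v y := 'i%C * (w y * r y) * p y.
pose g y := (U1 y)%:C * r y + alpha%:C * ((w y)^-1 - (m ^+ 2)%:C * w y).
pose v' y := 'i%C * p y * g y.
have drho (y : R) : dC rho y ((m ^+ 2)%:C * p' y) by exact: dCZ (dp y).
have dv (y : R) : dC v y (v' y).
  apply: (dC_eqf (dCM (dCZ 'i%C (dCM (dw y) (dr y))) (dp y))) => //.
  rewrite /v' /g; have := w_neq0 y; move: (w y) => z z0.
  by field.
pose h' y := (r' y * (U1 y)%:C + r y * (U2 y)%:C) * (alpha%:C)^-1 + - (U1 y)%:C * (w y)^-1 ^+ 2.
have dh (y : R) : dC h y (h' y).
  apply: (dC_eqf (dCD (dCM (dCM (dr y) (dC_real (dU1 y))) (dC_cst (alpha%:C)^-1 y)) (dwV y))) => //.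
  by rewrite mulr0 addr0.
pose u' y := - p' y * h y + - p y * h' y.
have du (y : R) : dC u y (u' y) by exact: dCM (dCN (dp y)) (dh y).
pose g' y := (U2 y)%:C * r y + (U1 y)%:C * r' y +
   alpha%:C * (- (U1 y)%:C * (w y)^-1 ^+ 2 - (m ^+ 2)%:C * (U1 y)%:C).
have dg (y : R) : dC g y (g' y).
  exact: (dCD (dCM (dC_real (dU1 y)) (dr y)) (dCZ _ (dCB (dwV y) (dCZ _ (dw y))))).
pose v'' y := 'i%C * p' y * g y + 'i%C * p y * g' y.
have dv' (y : R) : dC v' y (v'' y) by exact: dCM (dCZ 'i%C (dp y)) (dg y).
have BCh : BC h by apply: BCD (BCM (BCM BCr BCU1) BCaV) BCwV.
have BCh' : BC h'.
  apply: BCD (BCM (BCD (BCM BCr' BCU1) (BCM BCr BCU2)) BCaV) _.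
  exact: BCM (BCN BCU1) (BC_sqr BCwV).
have BCg : BC g by apply: BCD (BCM BCU1 BCr) (BCM BCa (BCB BCwV (BCM BCm BCw))).
have BCg' : BC g'.
  apply: BCD (BCD (BCM BCU2 BCr) (BCM BCU1 BCr')) (BCM BCa (BCB _ (BCM BCm BCU1))).
  exact: BCM (BCN BCU1) (BC_sqr BCwV).
have BCwr : BC (fun y => w y * r y) := BCM BCw BCr.
have eqs : mode_equations m U alpha c rho u v.
  have dE f f' (y : R) : (forall y : R, dC f y (f' y)) -> derive_cplx f y = f' y.
    by move=> /(_ y)/dC_cplx[].
  have mV : (m ^- 2)%:C = (m%:C) ^- 2 :> R[i] by rewrite fmorphV rmorphXn.
  have mE : (m ^+ 2)%:C = m%:C ^+ 2 :> R[i] by rewrite rmorphXn.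
  have U1E y : derive1 U y = U1 y by have [] := is_derive1E (dU y).
  split.
  - by move=> y; split; [have [] := dC_cplx (drho y) | have [] := dC_cplx (du y) |
               have [] := dC_cplx (dv y)].
  - move=> y; rewrite (dE _ _ y dv) -/(w y) /rho /u /v' /h /g.
    by move: (w_neq0 y); move: (w y) => z z0; field; rewrite z0 aC0.
  - move=> y; rewrite -/(w y) /rho /u /v /h U1E mV mE.
    move: (w_neq0 y); move: (w y) => z z0.
    by field; rewrite mC0 z0 aC0.
  - move=> y; rewrite (dE _ _ y drho) -/(w y) /v /p' mV mE.
    have i2 : 'i%C * 'i%C = -1 :> R[i] by rewrite -expr2 sqr_i.
    rewrite (_ : 'i%C * alpha%:C * w y * ('i%C * (w y * r y) * p y) =
      ('i%C * 'i%C) * alpha%:C * w y ^+ 2 * r y * p y); last by ring.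
    by rewrite i2; field.
  - have [_ [A hA]] := BCM BCi BCwr.
    apply: (@exp_decay_vanishes _ _ (A * K) _ ak) => y.
    rewrite ger0_norm ?nrm_ge0 // /v nrmM -(mulrA A).
    by rewrite ler_pM ?nrm_ge0.
exists rho, u, v; split => //.
- exists 0, 0, 0; apply/eqP => -[+ _ _]; rewrite waveE /phase /rho p0 !mulr0 subrr mulr0 expC0.
  by rewrite !mulr1 /= => /eqP; rewrite mulf_eq0 pnatr_eq0 /= sqrf_eq0 gt_eqF.
- apply: mode_linearized_euler => // t x.
  have [_ [A hA]] := BCM BCi BCwr.
  apply: (@exp_decay_vanishes _ _ (2 * (A * K * nrm (phase alpha c t x))) _ ak) => y.
  rewrite waveE normrM ger0_norm // -(mulrA 2) ler_pM2l //.
  rewrite (le_trans (ler_Re_nrm _)) // nrmM [leRHS]mulrAC ler_wpM2r ?nrm_ge0 //.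
  by rewrite /v nrmM -(mulrA A) ler_pM ?nrm_ge0.
- split.
  + apply: (WinftyC_S (BCM BCm BCp) drho); first exact: (BCM BCm BCp').1.
    exact: BC_Winfty0 (BCM BCm BCp').
  + have BCu' : BC u' := BCD (BCM (BCN BCp') BCh) (BCM (BCN BCp) BCh').
    exact: (WinftyC_S (BCM (BCN BCp) BCh) du BCu'.1 (BC_Winfty0 BCu')).
  + have BCv'' : BC v'' := BCD (BCM (BCM BCi BCp') BCg) (BCM (BCM BCi BCp) BCg').
    have BCv' : BC v' := BCM (BCM BCi BCp) BCg.
    apply: (WinftyC_S (BCM (BCM BCi BCwr) BCp) dv BCv'.1).
    exact: (WinftyC_S BCv' dv' BCv''.1 (BC_Winfty0 BCv'')).
Qed.

End Mode.
(** * Uniformly bounded and Lipschitz families *)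

Section SquareRoot.
Context {R : realType}.
Implicit Types z : R[i].

Lemma Re_sqrtc_ge0 z : 0 <= cRe (sqrtc z).
Proof. by case: z => a b /=; rewrite sqrtr_ge0. Qed.

Lemma Re_sqrt1D z : nrm z <= 2^-1 -> 2^-1 <= cRe (sqrtc (1 + z)).
Proof.
move=> hz; have := Re_sqrtc_ge0 (1 + z); set s := sqrtc _ => s0.
have : cRe (s ^+ 2) = 1 + cRe z by rewrite sqr_sqrtc cReD.
rewrite expr2 cReM => e.
have := ler_Re_nrm z; rewrite ler_norml => /andP[h _].
have := sqr_ge0 (cIm s) => i0.
rewrite leNgt; apply/negP => neg; nra.
Qed.

(** The difference of the two roots is [(z - z') / (s + s')], and
    [Re (s + s') >= 1]. *)
Lemma sqrt1D_dist z z' : nrm z <= 2^-1 -> nrm z' <= 2^-1 ->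
  nrm (sqrtc (1 + z) - sqrtc (1 + z')) <= nrm (z - z').
Proof.
move=> hz hz'; have h1 := Re_sqrt1D hz; have h2 := Re_sqrt1D hz'.
have e1 := sqr_sqrtc (1 + z); have e2 := sqr_sqrtc (1 + z').
move: (sqrtc (1 + z)) (sqrtc (1 + z')) h1 h2 e1 e2 => s s' h1 h2 e1 e2.
have -> : z - z' = (s + s') * (s - s').
  by rewrite mulrDl !mulrBr (mulrC s' s) addrA subrK -!expr2 e1 e2; ring.
rewrite nrmM ler_peMl ?nrm_ge0 //.
have := ler_Re_nrm (s + s'); rewrite cReD; apply: le_trans.
by rewrite (le_trans _ (ler_norm _)) //; lra.
Qed.

Lemma sqrt1D_near1 z : nrm z <= 2^-1 -> nrm (sqrtc (1 + z) - 1) <= nrm z.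
Proof.
move=> hz; have := @sqrt1D_dist z 0 hz; rewrite nrm0 subr0 addr0 sqrtc1.
by apply; rewrite invr_ge0.
Qed.

End SquareRoot.

Section Families.
Context {R : realType} (dom : R -> R[i] -> Prop).
Implicit Types (f g : R -> R[i] -> R -> R[i]) (om : R -> R).

(** Families with one constant [M] for all [alpha], for the bound as well as for
    the dependence on [c].  They form an algebra, which spares explicit
    constants: the fixed point argument for [c] needs just such uniform
    bounds. *)
Definition BLip om f : Prop := exists2 M, 0 <= M &
  forall alpha c, dom alpha c ->
    (forall y, 0 <= y -> nrm (f alpha c y) <= M * om y) /\
    (forall c', dom alpha c' -> forall y, 0 <= y ->
       nrm (f alpha c y - f alpha c' y) <= M * nrm (c - c') * om y).

Definition UB om f : Prop := exists2 M, 0 <= M &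
  forall alpha c, dom alpha c -> forall y, 0 <= y -> nrm (f alpha c y) <= M * om y.

Definition one : R -> R := fun=> 1.

Variable (om : R -> R).
Hypothesis om_ge0 : forall y, 0 <= om y.

Lemma BLip_UB f : BLip om f -> UB om f.
Proof. by move=> [M M0 H]; exists M => // a c /H[]. Qed.

Lemma BLipD f g : BLip om f -> BLip om g ->
  BLip om (fun alpha c y => f alpha c y + g alpha c y).
Proof.
move=> [M M0 H] [N N0 K]; exists (M + N); first exact: addr_ge0.
move=> a c d; have [h1 h2] := H a c d; have [k1 k2] := K a c d; split => [y y0|c' d' y y0].
  by rewrite (le_trans (nrmD _ _)) // mulrDl lerD ?h1 ?k1.
rewrite opprD addrACA (le_trans (nrmD _ _)) // 2!mulrDl lerD ?h2 ?k2 //.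
Qed.

Lemma BLipN f : BLip om f -> BLip om (fun alpha c y => - f alpha c y).
Proof.
move=> [M M0 H]; exists M => // a c d; have [h1 h2] := H a c d.
split => [y y0|c' d' y y0]; first by rewrite nrmN h1.
by rewrite -opprD nrmN h2.
Qed.

Lemma BLipB f g : BLip om f -> BLip om g ->
  BLip om (fun alpha c y => f alpha c y - g alpha c y).
Proof. by move=> hf hg; apply: BLipD => //; exact: BLipN. Qed.

Lemma BLipM f g : BLip om f -> BLip one g ->
  BLip om (fun alpha c y => f alpha c y * g alpha c y).
Proof.
move=> [M M0 H] [N N0 K]; exists (2 * (M * N)); first by rewrite !mulr_ge0.
move=> a c d; have [h1 h2] := H a c d; have [k1 k2] := K a c d; split => [y y0|c' d' y y0].
  rewrite nrmM (le_trans (y := M * om y * N)) //.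
    by rewrite ler_pM ?nrm_ge0 ?h1 // (le_trans (k1 y y0)) // mulr1.
  have := mulr_ge0 (mulr_ge0 M0 N0) (om_ge0 y) => *; nra.
have -> : f a c y * g a c y - f a c' y * g a c' y =
  (f a c y - f a c' y) * g a c y + f a c' y * (g a c y - g a c' y) by ring.
rewrite (le_trans (nrmD _ _)) // !nrmM.
have -> : 2 * (M * N) * nrm (c - c') * om y =
  M * nrm (c - c') * om y * N + M * om y * (N * nrm (c - c')) by ring.
rewrite lerD // ler_pM ?nrm_ge0 ?h2 //.
- by rewrite (le_trans (k1 y y0)) // mulr1.
- by have [+ _] := H a c' d'; apply.
- by rewrite (le_trans (k2 c' d' y y0)) // mulr1.
Qed.

Lemma BLip_ext f g : BLip om f -> (forall a c y, dom a c -> 0 <= y -> f a c y = g a c y) ->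
  BLip om g.
Proof.
move=> [M M0 H] e; exists M => // a c d; have [h1 h2] := H a c d.
by split => [y y0|c' d' y y0]; rewrite -!e ?h1 ?h2.
Qed.

Lemma BLip_fun (h : R -> R[i]) (M : R) : 0 <= M ->
  (forall y, 0 <= y -> nrm (h y) <= M * om y) -> BLip om (fun=> fun=> h).
Proof.
move=> M0 hM; exists M => // a c _; split => // c' _ y y0.
by rewrite subrr nrm0 !mulr_ge0 ?nrm_ge0.
Qed.

Lemma BLip_scalar (F : R -> R[i]) (M : R) : 0 <= M ->
  (forall alpha c, dom alpha c -> nrm (F alpha) <= M) ->
  BLip one (fun alpha _ _ => F alpha).
Proof.
move=> M0 hM; exists M => // a c d; split => [y y0|c' _ y y0]; first by rewrite mulr1 (hM a c).
by rewrite subrr nrm0 !mulr_ge0 ?nrm_ge0.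
Qed.

Lemma BLip_cst (k : R[i]) : BLip one (fun _ _ _ => k).
Proof. by apply: (@BLip_scalar (fun=> k) (nrm k)) => //; exact: nrm_ge0. Qed.

Lemma BLip_id (b : R) : 0 <= b -> (forall alpha c, dom alpha c -> nrm c <= b) ->
  BLip one (fun _ c _ => c).
Proof.
move=> b0 hb; exists (b + 1); first exact: addr_ge0.
move=> a c d; split => [y _|c' _ y _].
  by rewrite mulr1 (le_trans (hb a c d)) // lerDl.
by rewrite mulr1 ler_peMl ?nrm_ge0 // lerDr.
Qed.

Lemma BLipV f (delta : R) : 0 < delta -> BLip one f ->
  (forall alpha c y, dom alpha c -> 0 <= y -> delta <= nrm (f alpha c y)) ->
  BLip one (fun alpha c y => (f alpha c y)^-1).
Proof.
move=> d0 [M M0 H] hd; exists (delta^-1 + M * delta^-1 ^+ 2).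
  by rewrite addr_ge0 ?mulr_ge0 ?exprn_ge0 // invr_ge0 ltW.
have dV : 0 <= delta^-1 by rewrite invr_ge0 ltW.
have hV a c y : dom a c -> 0 <= y -> nrm (f a c y)^-1 <= delta^-1.
  by move=> d y0; rewrite nrmV lef_pV2 ?posrE ?(lt_le_trans d0) ?hd.
have hN a c y : dom a c -> 0 <= y -> f a c y != 0.
  by move=> d y0; rewrite -nrm_gt0 (lt_le_trans d0) ?hd.
move=> a c d; have [h1 h2] := H a c d; split => [y y0|c' d' y y0].
  by rewrite mulr1 (le_trans (hV a c y d y0)) // lerDl mulr_ge0 // exprn_ge0.
have -> : (f a c y)^-1 - (f a c' y)^-1 =
  - ((f a c y - f a c' y) * ((f a c y)^-1 * (f a c' y)^-1)).
  by field; rewrite !hN.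
rewrite nrmN !nrmM mulr1 (le_trans (y := M * nrm (c - c') * (delta^-1 * delta^-1))) //.
  rewrite ler_pM ?mulr_ge0 ?nrm_ge0 //; first by rewrite (le_trans (h2 c' d' y y0)) // mulr1.
  by rewrite ler_pM ?nrm_ge0 ?hV.
have := mulr_ge0 dV (nrm_ge0 (c - c')); rewrite expr2; nra.
Qed.

Lemma BLip_sqrt f : BLip one f ->
  (forall alpha c y, dom alpha c -> 0 <= y -> nrm (f alpha c y) <= 2^-1) ->
  BLip one (fun alpha c y => sqrtc (1 + f alpha c y)).
Proof.
move=> [M M0 H] hf; exists (2 + M); first by rewrite addr_ge0.
move=> a c d; have [h1 h2] := H a c d; split => [y y0|c' d' y y0].
  rewrite mulr1 -(subrK 1 (sqrtc _)) (le_trans (nrmD _ _)) // nrm1.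
  have := sqrt1D_near1 (hf a c y d y0); have := hf a c y d y0 => *; lra.
rewrite (le_trans (sqrt1D_dist (hf a c y d y0) (hf a c' y d' y0))) //.
by rewrite (le_trans (h2 c' d' y y0)) // !mulr1 ler_wpM2r ?nrm_ge0 // lerDr.
Qed.

Lemma UBD f g : UB om f -> UB om g -> UB om (fun alpha c y => f alpha c y + g alpha c y).
Proof.
move=> [M M0 H] [N N0 K]; exists (M + N); first exact: addr_ge0.
by move=> a c d y y0; rewrite (le_trans (nrmD _ _)) // mulrDl lerD ?H ?K.
Qed.

Lemma UBN f : UB om f -> UB om (fun alpha c y => - f alpha c y).
Proof. by move=> [M M0 H]; exists M => // a c d y y0; rewrite nrmN H. Qed.

Lemma UBB f g : UB om f -> UB om g -> UB om (fun alpha c y => f alpha c y - g alpha c y).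
Proof. by move=> hf hg; apply: UBD => //; exact: UBN. Qed.

Lemma UBM f g : UB om f -> UB one g -> UB om (fun alpha c y => f alpha c y * g alpha c y).
Proof.
move=> [M M0 H] [N N0 K]; exists (M * N); first exact: mulr_ge0.
move=> a c d y y0; rewrite nrmM mulrAC ler_pM ?nrm_ge0 ?H //.
by rewrite (le_trans (K a c d y y0)) // mulr1.
Qed.

End Families.

Section FamiliesOne.
Context {R : realType} (dom : R -> R[i] -> Prop).
Implicit Types (f g : R -> R[i] -> R -> R[i]).

Lemma BLip_one (om : R -> R) (f : R -> R[i] -> R -> R[i]) :
  (forall y, 0 <= y -> 0 <= om y <= 1) -> BLip dom om f -> BLip dom one f.
Proof.
move=> h [M M0 H]; exists M => // a c d; have [h1 h2] := H a c d.
split => [y y0|c' d' y y0]; have /andP[w0 w1] := h y y0.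
  by rewrite (le_trans (h1 y y0)) // ler_wpM2l.
by rewrite (le_trans (h2 c' d' y y0)) // ler_wpM2l // mulr_ge0 ?nrm_ge0.
Qed.

Lemma one_ge0 (y : R) : 0 <= one y. Proof. exact: ler01. Qed.

Lemma BLipM1 f g : BLip dom one f -> BLip dom one g ->
  BLip dom one (fun alpha c y => f alpha c y * g alpha c y).
Proof. by move=> hf hg; exact: (BLipM one_ge0 hf hg). Qed.

Lemma BLip_sqr f : BLip dom one f -> BLip dom one (fun alpha c y => f alpha c y ^+ 2).
Proof. by move=> hf; apply: (BLip_ext (BLipM1 hf hf)) => a c y _ _. Qed.

End FamiliesOne.
(** * Half-line solutions and their matching *)

Section Sheet.
Context {R : realType}.
Implicit Types (m eps : R) (c : R[i]).

Definition winf eps c : R[i] := eps%:C - c.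

(** The defect [m^2 - (1-c)^-2 - (1+c)^-2] vanishes exactly at the roots of the
    vortex-sheet dispersion relation; [eta] is this defect in units that make
    [1 + eta] the square of the normalised decay rate. *)
Definition eta m eps c : R[i] :=
  ((m ^+ 2)%:C - (1 - c) ^- 2 - (1 + c) ^- 2) * (1 + eps%:C * c) ^+ 2.

Definition sheet_root m eps c : R[i] := sqrtc (1 + eta m eps c).

(** The equilibrium of the Riccati equation at [Y = eps * oo] for which the
    pressure decays. *)
Definition rhoi m eps c : R[i] :=
  - (eps%:C * 'i%C * sheet_root m eps c / (1 - c ^+ 2)).

(** The label of a half-line: [Y > 0] for [eps = 1], [Y < 0] for [eps = -1]. *)
Definition side eps : Prop := eps = 1 \/ eps = -1.

Lemma side_sqr eps : side eps -> eps ^+ 2 = 1.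
Proof. by move=> [] ->; rewrite ?sqrrN expr1n. Qed.

Lemma side_sqrC eps : side eps -> eps%:C * eps%:C = 1 :> R[i].
Proof. by move=> /side_sqr; rewrite expr2 -rmorphM /= => ->. Qed.

Lemma sqr_iC : 'i%C * 'i%C = -1 :> R[i].
Proof. by rewrite -expr2 sqr_i. Qed.

Lemma one_sub_sqr_neq0 c : 1 - c != 0 -> 1 + c != 0 -> 1 - c ^+ 2 != 0.
Proof.
by move=> h1 h2; rewrite (_ : 1 - c ^+ 2 = (1 - c) * (1 + c)) ?mulf_neq0 //; ring.
Qed.

Lemma rhoi_sqr m eps c : rhoi m eps c ^+ 2 = - ((1 + eta m eps c) * (eps%:C * eps%:C)) / (1 - c ^+ 2) ^+ 2.
Proof.
rewrite /rhoi -(sqr_sqrtc (1 + eta m eps c)) -/(sheet_root _ _ _).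
set S := sheet_root _ _ _; rewrite -[in RHS]exprVn; set d := _^-1.
transitivity (('i%C * 'i%C) * (eps%:C * eps%:C) * S ^+ 2 * d ^+ 2); first by ring.
by rewrite sqr_iC; ring.
Qed.

Lemma rhoi_equilibrium m eps c : side eps -> 1 - c != 0 -> 1 + c != 0 ->
  winf eps c ^- 2 - (m ^+ 2)%:C - winf eps c ^+ 2 * rhoi m eps c ^+ 2 = 0.
Proof.
move=> he h1 h2; have h3 := one_sub_sqr_neq0 h1 h2.
rewrite rhoi_sqr (side_sqrC he) /eta /winf.
have h4 : c + 1 != 0 by rewrite addrC.
case: he => ->; rewrite ?rmorphN rmorph1.
  by field; rewrite h3 h2 h1.
have h5 : -1 - c != 0 by rewrite -opprD oppr_eq0.
by field; rewrite h3 h2 h1 h5.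
Qed.

Lemma winfE eps c : side eps -> winf eps c = eps%:C * (1 - eps%:C * c).
Proof. by move=> he; rewrite mulrBr mulr1 mulrA side_sqrC ?mul1r. Qed.

Lemma one_sub_sqrE eps c : side eps ->
  1 - c ^+ 2 = (1 - eps%:C * c) * (1 + eps%:C * c).
Proof.
move=> he; transitivity (1 - eps%:C * eps%:C * c ^+ 2); last by ring.
by rewrite side_sqrC ?mul1r.
Qed.

Lemma side1 : side 1. Proof. by left. Qed.
Lemma sideN1 : side (-1). Proof. by right. Qed.

End Sheet.

Section Layer.
Context {R : realType}.
(** Both half-lines are treated at once, as [Y = eps * y] with [y >= 0].  The
    source [w^-2] of the Riccati equation is split as [G' + h], where [G] absorbs
    what is large when [c] is close to the range of [U]; [Gi eps c] is the limit
    of [G c] at [eps * oo].  The pairs [(alpha, c)] are confined to a set [dom] on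
    which [alpha <= K Im c]. *)
Variables (dom : R -> R[i] -> Prop) (m b K theta MU : R) (U U1 U2 : R -> R).
Variables (G h : R[i] -> R -> R[i]) (Gi : R -> R[i] -> R[i]).
Local Notation om := (edecay theta).
Implicit Types (eps alpha : R) (c : R[i]).
Hypotheses (m_gt0 : 0 < m) (theta_gt0 : 0 < theta) (b01 : 0 <= b < 1) (K_gt0 : 0 < K).
Hypotheses (dom_alpha : forall alpha c, dom alpha c -> 0 < alpha <= 1)
  (dom_b : forall alpha c, dom alpha c -> nrm c <= b)
  (dom_im : forall alpha c, dom alpha c -> alpha <= K * cIm c)
  (dom_eta : forall alpha c eps, dom alpha c -> side eps ->
     nrm (eta m eps c) <= (1 - b ^+ 2) / 4).
Hypotheses (dU : forall y : R, is_derive y 1 U (U1 y))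
  (dU1 : forall y : R, is_derive y 1 U1 (U2 y)) (cU2 : continuous U2)
  (MU_ge0 : 0 <= MU)
  (bU : forall y, `|U y| <= MU) (bU1 : forall y, `|U1 y| <= MU) (bU2 : forall y, `|U2 y| <= MU)
  (Uinf : forall eps y, side eps -> 0 <= y -> `|U (eps * y) - eps| <= MU * om y).

Definition wf eps (c : R[i]) (y : R) : R[i] := (U (eps * y))%:C - c.
Definition gf eps (c : R[i]) (y : R) : R[i] := eps%:C * (G c (eps * y) - Gi eps c).

Hypotheses (dG : forall alpha c, dom alpha c ->
     forall y : R, dC (G c) y (((U y)%:C - c) ^- 2 - h c y))
  (ch : forall alpha c, dom alpha c -> contC (h c))
  (Hh : forall eps, side eps ->
     BLip dom om (fun _ c y => h c (eps * y) - winf eps c ^- 2))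
  (HG1 : forall eps, side eps ->
     BLip dom om (fun alpha c y => alpha%:C * (wf eps c y ^+ 2 * gf eps c y)))
  (HG2 : forall eps, side eps ->
     BLip dom om (fun alpha c y => alpha%:C ^+ 2 * (wf eps c y ^+ 2 * gf eps c y ^+ 2))).

(** The function [eps * r (eps * y)] satisfies the same Riccati equation as [r],
    with [U] reflected; these are the coefficients of the equation for [x] when
    it is written as [rhoi + alpha g + x]. *)
Definition F0f eps (alpha : R) (c : R[i]) (y : R) : R[i] :=
  (h c (eps * y) - winf eps c ^- 2)
  - (wf eps c y ^+ 2 - winf eps c ^+ 2) * rhoi m eps c ^+ 2
  - alpha%:C * (wf eps c y ^+ 2 * gf eps c y) * (2 * rhoi m eps c)
  - alpha%:C ^+ 2 * (wf eps c y ^+ 2 * gf eps c y ^+ 2).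
Definition F1f eps (alpha : R) (c : R[i]) (y : R) : R[i] :=
  - (2 * (wf eps c y ^+ 2 * rhoi m eps c) +
     2 * (alpha%:C * (wf eps c y ^+ 2 * gf eps c y))).
Definition F2f eps (alpha : R) (c : R[i]) (y : R) : R[i] := - wf eps c y ^+ 2.

Let om_ge0 y : 0 <= om y := edecay_ge0 theta y.
Let om01 y : 0 <= y -> 0 <= om y <= 1.
Proof. exact: om_itv. Qed.

Lemma dom_Im_gt0 alpha c : dom alpha c -> 0 < cIm c.
Proof.
move=> d; have /andP[a0 _] := dom_alpha d; have := dom_im d.
by move=> /(lt_le_trans a0); rewrite pmulr_rgt0.
Qed.

Lemma nrm_1D_ge alpha c eps : dom alpha c -> side eps -> 1 - b <= nrm (1 + eps%:C * c).
Proof.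
move=> d he; have := nrm_subr_ge 1 (- (eps%:C * c)); rewrite opprK nrmN nrm1 nrmM nrmR.
have -> : `|eps| = 1 by case: he => ->; rewrite ?normrN normr1.
by rewrite mul1r; apply: le_trans; rewrite lerD2l lerN2 (dom_b d).
Qed.

Lemma dom_1B_neq0 alpha c : dom alpha c -> 1 - c != 0.
Proof.
move=> d; have := nrm_1D_ge d sideN1; rewrite rmorphN rmorph1 mulN1r -nrm_gt0.
by apply: lt_le_trans; case/andP: b01; rewrite subr_gt0.
Qed.

Lemma dom_1D_neq0 alpha c : dom alpha c -> 1 + c != 0.
Proof.
move=> d; have := nrm_1D_ge d side1; rewrite rmorph1 mul1r -nrm_gt0.
by apply: lt_le_trans; case/andP: b01; rewrite subr_gt0.
Qed.

Let b0 : 0 <= b. Proof. by case/andP: b01. Qed.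
Let b1 : 0 < 1 - b. Proof. by case/andP: b01; rewrite subr_gt0. Qed.

Lemma dom_eta_half alpha c eps : dom alpha c -> side eps -> nrm (eta m eps c) <= 2^-1.
Proof. by move=> d he; apply: (le_trans (dom_eta d he)); have := sqr_ge0 b => *; lra. Qed.

Lemma BLip_c : BLip dom one (fun _ c _ => c).
Proof. exact: BLip_id b0 dom_b. Qed.

Lemma BLip_1DV eps : side eps -> BLip dom one (fun _ c _ => (1 + eps%:C * c)^-1).
Proof.
move=> he; apply: (BLipV b1); last by move=> a c y d _; exact: (nrm_1D_ge d he).
exact: BLipD (BLip_cst _ _) (BLipM1 (BLip_cst _ _) BLip_c).
Qed.

Lemma BLip_eta eps : side eps -> BLip dom one (fun _ c _ => eta m eps c).
Proof.
move=> he; apply: BLipM1; last first.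
  by apply: BLip_sqr; exact: BLipD (BLip_cst _ _) (BLipM1 (BLip_cst _ _) BLip_c).
have h1 := BLip_sqr (BLip_1DV side1); have h2 := BLip_sqr (BLip_1DV sideN1).
apply: (BLip_ext (BLipB (BLipB (BLip_cst _ (m ^+ 2)%:C) h2) h1)) => a c y _ _.
by rewrite !exprVn rmorphN rmorph1 mulN1r mul1r.
Qed.

Lemma BLip_sheet_root eps : side eps -> BLip dom one (fun _ c _ => sheet_root m eps c).
Proof.
move=> he; apply: (BLip_sqrt (BLip_eta he)) => a c y d _; exact: dom_eta_half d he.
Qed.

Lemma BLip_rhoi eps : side eps -> BLip dom one (fun _ c _ => rhoi m eps c).
Proof.
move=> he; have h1 := BLip_1DV side1; have h2 := BLip_1DV sideN1.
apply: (BLip_ext (BLipM1 (BLipM1 (BLipM1 (BLip_cst _ (- (eps%:C * 'i%C))) (BLip_sheet_root he)) h1) h2)).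
move=> a c y d _; rewrite /rhoi rmorphN rmorph1 mulN1r mul1r.
have n1 := dom_1B_neq0 d; have n2 := dom_1D_neq0 d.
by field; rewrite n1 n2 one_sub_sqr_neq0.
Qed.

Lemma BLip_winf eps : BLip dom one (fun _ c _ => winf eps c).
Proof. exact: (BLipB (BLip_cst _ _) BLip_c). Qed.

Lemma BLip_wf eps : side eps -> BLip dom one (fun _ c y => wf eps c y).
Proof.
move=> he; apply: (BLipB _ BLip_c).
apply: (BLip_fun dom (@one_ge0 R) MU_ge0) => y _.
by rewrite nrmR mulr1.
Qed.

Lemma BLip_wf_sqr eps : side eps ->
  BLip dom om (fun _ c y => wf eps c y ^+ 2 - winf eps c ^+ 2).
Proof.
move=> he.
have hU : BLip dom om (fun _ _ y => (U (eps * y))%:C - eps%:C).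
  apply: (BLip_fun dom om_ge0 MU_ge0) => y y0.
  by rewrite -rmorphB nrmR Uinf.
apply: (BLip_ext (BLipM om_ge0 hU (BLipD (BLip_wf he) (BLip_winf eps)))) => a c y _ _.
by rewrite /wf /winf; ring.
Qed.

Lemma BLip_F0 eps : side eps -> BLip dom om (fun a c y => F0f eps a c y).
Proof.
move=> he; apply: BLipB (HG2 he); apply: BLipB; last first.
  exact: (BLipM om_ge0 (HG1 he) (BLipM1 (BLip_cst dom 2) (BLip_rhoi he))).
apply: BLipB (Hh he) _.
exact: (BLipM om_ge0 (BLip_wf_sqr he) (BLip_sqr (BLip_rhoi he))).
Qed.

Lemma BLip_F1 eps : side eps -> BLip dom one (fun a c y => F1f eps a c y).
Proof.
move=> he; apply: BLipN; apply: BLipD.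
  exact: (BLipM1 (BLip_cst dom 2) (BLipM1 (BLip_sqr (BLip_wf he)) (BLip_rhoi he))).
exact: (BLipM1 (BLip_cst dom 2) (BLip_one om01 (HG1 he))).
Qed.

Lemma BLip_F2 eps : side eps -> BLip dom one (fun a c y => F2f eps a c y).
Proof. by move=> he; apply: BLipN; exact: BLip_sqr (BLip_wf he). Qed.

Lemma cont_scale eps : continuous (fun y : R => eps * y).
Proof. exact: mulrl_continuous. Qed.

Lemma cont_wf eps c : contC (wf eps c).
Proof.
apply: contCB; last exact: contC_cst.
have cU : continuous U by move=> y; exact: is_derive_cont (dU y).
exact: (contC_comp (contC_real cU) (@cont_scale eps)).
Qed.

Lemma cont_gf eps alpha c : dom alpha c -> contC (gf eps c).
Proof.
move=> d; apply: contCM (contC_cst _) (contCB _ (contC_cst _)).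
exact: (contC_comp (dC_contC (dG d)) (@cont_scale eps)).
Qed.

Let contC_sqr (f : R -> R[i]) : contC f -> contC (fun y => f y ^+ 2).
Proof. by move=> hf; rewrite (_ : (fun y => _) = (fun y => f y * f y)) //; exact: contCM. Qed.

Lemma cont_F0 eps alpha c : dom alpha c -> contC (F0f eps alpha c).
Proof.
move=> d; have cw := contC_sqr (cont_wf eps c); have cg := cont_gf eps d.
have ck k : contC (fun=> k : R[i]) := contC_cst k.
apply: contCB; last exact: contCM (ck _) (contCM cw (contC_sqr cg)).
apply: contCB; last exact: contCM (contCM (ck _) (contCM cw cg)) (ck _).
apply: contCB; last exact: contCM (contCB cw (ck _)) (ck _).
exact: contCB (contC_comp (ch d) (@cont_scale eps)) (ck _).
Qed.

Lemma cont_F1 eps alpha c : dom alpha c -> contC (F1f eps alpha c).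
Proof.
move=> d; have cw := contC_sqr (cont_wf eps c); have cg := cont_gf eps d.
have ck k : contC (fun=> k : R[i]) := contC_cst k.
apply: contCN; apply: contCD; first exact: contCM (ck _) (contCM cw (ck _)).
exact: contCM (ck _) (contCM (ck _) (contCM cw cg)).
Qed.

Lemma cont_F2 eps alpha c : contC (F2f eps alpha c).
Proof. exact: contCN (contC_sqr (cont_wf eps c)). Qed.

(** The constants in the existence and comparison results for the Riccati
    equation depend on bounds of its coefficients only, and those are uniform.
    The solution is chosen as one function of all parameters, so that its
    dependence on [c] makes sense. *)
Lemma layer_solutions : exists alpha1 M (x : R -> R -> R[i] -> R -> R[i]),
  [/\ 0 < alpha1, 0 <= M &
   forall eps alpha c, side eps -> dom alpha c -> alpha <= alpha1 ->
   [/\ riccati theta alpha (F0f eps alpha c) (F1f eps alpha c) (F2f eps alpha c)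
         (x eps alpha c),
       forall y, 0 <= y -> nrm (x eps alpha c y) <= M * alpha * om y &
       forall c', dom alpha c' ->
         nrm (x eps alpha c 0 - x eps alpha c' 0) <= M * alpha * nrm (c - c')]].
Proof.
pose Q (N eps : R) : Prop := forall alpha c, dom alpha c ->
    riccati_data theta N (F0f eps alpha c) (F1f eps alpha c) (F2f eps alpha c) /\
    forall c', dom alpha c' -> forall y, 0 <= y ->
     [/\ nrm (F0f eps alpha c y - F0f eps alpha c' y) <= N * nrm (c - c') * om y,
         nrm (F1f eps alpha c y - F1f eps alpha c' y) <= N * nrm (c - c') &
         nrm (F2f eps alpha c y - F2f eps alpha c' y) <= N * nrm (c - c')].
have key eps : side eps -> exists2 N, 0 <= N & forall N', N <= N' -> Q N' eps.
  move=> he; have [N0 p0 H0] := BLip_F0 he; have [N1 p1 H1] := BLip_F1 he.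
  have [N2 p2 H2] := BLip_F2 he.
  exists (N0 + N1 + N2) => [|N NN]; first by rewrite !addr_ge0.
  have [q0 q1 q2] : [/\ N0 <= N, N1 <= N & N2 <= N] by split; lra.
  move=> a c d; have [h0 k0] := H0 a c d; have [h1 k1] := H1 a c d.
  have [h2 k2] := H2 a c d; split => [y y0|c' d' y y0].
    split.
    - by rewrite (le_trans (h0 y y0)) // ler_wpM2r.
    - by rewrite (le_trans (h1 y y0)) // mulr1.
    - by rewrite (le_trans (h2 y y0)) // mulr1.
  split.
  - by rewrite (le_trans (k0 c' d' y y0)) // ler_wpM2r // ler_wpM2r ?nrm_ge0.
  - by rewrite (le_trans (k1 c' d' y y0)) // mulr1 ler_wpM2r ?nrm_ge0.
  - by rewrite (le_trans (k2 c' d' y y0)) // mulr1 ler_wpM2r ?nrm_ge0.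
have [Np p0 Hp] := key 1 side1; have [Nm q0 Hm] := key (-1) sideN1.
pose N := Np + Nm.
have N0 : 0 <= N by rewrite addr_ge0.
have HN eps : side eps -> Q N eps.
  by case=> ->; [apply: Hp; rewrite lerDl|apply: Hm; rewrite lerDr].
pose alpha1 := theta / (12 * (N + 1)).
have a1 : 0 < alpha1 by rewrite divr_gt0 // mulr_gt0 // ltr_wpDl.
have small alpha : 0 < alpha -> alpha <= alpha1 -> 12 * alpha * N <= theta.
  move=> a0; rewrite /alpha1 ler_pdivlMr ?mulr_gt0 ?ltr_wpDl // => h'.
  have := ltW a0 => *; nra.
have [x Hx] : exists x : R -> R -> R[i] -> R -> R[i], forall eps alpha c, side eps ->
    dom alpha c -> alpha <= alpha1 ->
    riccati theta alpha (F0f eps alpha c) (F1f eps alpha c) (F2f eps alpha c) (x eps alpha c).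
  have H eps alpha c : exists X : R -> R[i], side eps -> dom alpha c -> alpha <= alpha1 ->
    riccati theta alpha (F0f eps alpha c) (F1f eps alpha c) (F2f eps alpha c) X.
    have [he|ne] := pselect (side eps); last by exists (fun=> 0).
    have [d|nd] := pselect (dom alpha c); last by exists (fun=> 0).
    have [ha|na] := leP alpha alpha1; last by exists (fun=> 0).
    have /andP[a0 _] := dom_alpha d.
    have [X hX] := riccati_ex theta_gt0 a0 N0 (small _ a0 ha) (cont_F0 eps d)
      (cont_F1 eps d) (cont_F2 eps alpha c) (HN eps he alpha c d).1.
    by exists X.
  exists (fun eps alpha c => sval (cid (H eps alpha c))) => eps alpha c.
  by case: (cid _).
exists alpha1, (12 * N / theta), x; split => //.
  by rewrite divr_ge0 ?mulr_ge0 // ltW.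
move=> eps alpha c he d ha; have /andP[a0 _] := dom_alpha d.
have hx := Hx eps alpha c he d ha; have [HF HL] := HN eps he alpha c d; split => //.
  move=> y y0; have := riccati_bound theta_gt0 a0 HF hx y0.
  move=> /le_trans; apply; rewrite ler_wpM2r // ler_wpM2r ?(ltW a0) //.
  by rewrite ler_wpM2r ?invr_ge0 ?(ltW theta_gt0) //; lra.
move=> c' d'; have hx' := Hx eps alpha c' he d' ha; have [HF' _] := HN eps he alpha c' d'.
have ND : 0 <= N * nrm (c - c') by rewrite mulr_ge0 ?nrm_ge0.
have := riccati_dep theta_gt0 a0 (small _ a0 ha) ND HF HF' hx hx' (HL c' d') (lexx 0).
rewrite edecay0 mulr1; move=> /le_trans; apply.
by rewrite le_eqVlt; apply/orP; left; apply/eqP; field; rewrite gt_eqF.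
Qed.


Section Matching.
Variables (alpha : R) (c : R[i]) (x : R -> R -> R[i]).
Hypotheses (d : dom alpha c)
  (Hx : forall eps, side eps ->
     riccati theta alpha (F0f eps alpha c) (F1f eps alpha c) (F2f eps alpha c) (x eps)).

Definition half_sol eps (y : R) : R[i] := rhoi m eps c + alpha%:C * gf eps c y + x eps y.

Let aP : 0 < alpha. Proof. by have /andP[] := dom_alpha d. Qed.
Let n1 : 1 - c != 0 := dom_1B_neq0 d.
Let n2 : 1 + c != 0 := dom_1D_neq0 d.

Lemma half_sol_riccati eps (y : R) : side eps -> 0 <= y ->
  dC (half_sol eps) y (alpha%:C * ((wf eps c y)^-1 ^+ 2 - (m ^+ 2)%:C
                                   - wf eps c y ^+ 2 * half_sol eps y ^+ 2)).
Proof.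
move=> he y0; have [dX _] := Hx he.
have ds : is_derive y 1 (fun z : R => eps * z) eps.
  by apply: (is_derive_eqf (is_deriveZ eps (is_derive_id y 1))) => //; rewrite /GRing.scale /= mulr1.
have dg : dC (gf eps c) y ((wf eps c y) ^- 2 - h c (eps * y)).
  apply: (dC_eqf (dCZ eps%:C (dCB (dC_compR (dG d (eps * y)) ds) (dC_cst (Gi eps c) y)))) => //.
  by rewrite subr0 mulrA side_sqrC // mul1r.
apply: (dC_eqf (dCD (dCD (dC_cst (rhoi m eps c) y) (dCZ alpha%:C dg)) (dX y y0))) => //.
have eq := rhoi_equilibrium m he n1 n2.
have {}eq : winf eps c ^- 2 = (m ^+ 2)%:C + winf eps c ^+ 2 * rhoi m eps c ^+ 2.
  by apply/eqP; rewrite -subr_eq0 opprD addrA eq.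
rewrite /F0f /F1f /F2f eq exprVn /half_sol.
by ring.
Qed.

Lemma half_sol_limit eps : side eps -> exists2 C, 0 <= C & forall y, 0 <= y ->
  nrm (wf eps c y ^+ 2 * half_sol eps y - winf eps c ^+ 2 * rhoi m eps c) <= C * om y.
Proof.
move=> he; have [_ bx] := Hx he.
have [M M0 HM] := BLip_wf_sqr he; have [N N0 HN] := HG1 he.
have [W W0 HW] := BLip_sqr (BLip_wf he).
exists (M * nrm (rhoi m eps c) + N + W).
  by rewrite !addr_ge0 // mulr_ge0 // nrm_ge0.
move=> y y0.
have -> : wf eps c y ^+ 2 * half_sol eps y - winf eps c ^+ 2 * rhoi m eps c =
  (wf eps c y ^+ 2 - winf eps c ^+ 2) * rhoi m eps c
  + alpha%:C * (wf eps c y ^+ 2 * gf eps c y) + wf eps c y ^+ 2 * x eps y.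
  by rewrite /half_sol; ring.
rewrite (le_trans (nrmD _ _)) // [leRHS]mulrDl lerD //.
  rewrite (le_trans (nrmD _ _)) // [leRHS]mulrDl lerD //.
    by rewrite nrmM [leRHS]mulrAC ler_wpM2r ?nrm_ge0 //; have [+ _] := HM alpha c d; apply.
  by have [+ _] := HN alpha c d; apply.
rewrite nrmM ler_pM ?nrm_ge0 ?bx //.
by have [+ _] := HW alpha c d => /(_ y y0); rewrite mulr1.
Qed.

Lemma half_sol_bounded eps : side eps ->
  exists C, forall y, 0 <= y -> nrm (half_sol eps y) <= C.
Proof.
move=> he; have [_ bx] := Hx he; have [N N0 HN] := HG1 he.
have ic := dom_Im_gt0 d.
have wge y : cIm c <= nrm (wf eps c y).
  by rewrite (le_trans _ (ler_Im_nrm _)) // cImB /= sub0r normrN ler_norm.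
exists (nrm (rhoi m eps c) + N / cIm c ^+ 2 + 1) => y y0.
have /andP[w0 w1] := om01 y0.
rewrite /half_sol (le_trans (nrmD _ _)) // lerD //; last exact: le_trans (bx y y0) w1.
rewrite (le_trans (nrmD _ _)) // lerD //.
have hN : nrm (wf eps c y) ^+ 2 * nrm (alpha%:C * gf eps c y) <= N * om y.
  by rewrite -nrmX -nrmM mulrCA; have [+ _] := HN alpha c d; apply.
rewrite ler_pdivlMr ?exprn_gt0 //; apply: (le_trans (y := N * om y)); last first.
  by rewrite ler_piMr.
apply: le_trans hN; rewrite mulrC ler_wpM2r ?nrm_ge0 //.
by rewrite ler_pXn2r ?nnegrE ?nrm_ge0 // ltW.
Qed.

(** The limit [- kappa] of [w^2 r], where [alpha kappa] is the decay rate of the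
    pressure, satisfies [kappa^2 = 1 - m^2 (eps - c)^2].  The choice of
    [sheet_root] fixes the sign of [Im kappa]; since [Im c > 0] gives
    [Im kappa^2] the same sign, [Re kappa > 0]. *)
Lemma limit_rate_gt0 eps : side eps -> cRe (winf eps c ^+ 2 * rhoi m eps c) < 0.
Proof.
move=> he; have ic := dom_Im_gt0 d; have eq := rhoi_equilibrium m he n1 n2.
set k := winf eps c ^+ 2 * rhoi m eps c.
have w0 : winf eps c != 0.
  rewrite winfE //; case: he => ->; rewrite ?rmorphN rmorph1.
    by rewrite !mul1r.
  by rewrite !mulN1r opprK oppr_eq0.
have k2 : k ^+ 2 = 1 - (m ^+ 2)%:C * winf eps c ^+ 2.
  move/eqP: eq; rewrite subr_eq0 => /eqP eq.
  rewrite /k exprMn (_ : (winf eps c ^+ 2) ^+ 2 * rhoi m eps c ^+ 2 =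
    winf eps c ^+ 2 * (winf eps c ^+ 2 * rhoi m eps c ^+ 2)); last by ring.
  by rewrite -eq; field.
have im2 : cIm (k ^+ 2) = eps * (2 * m ^+ 2 * cIm c * (1 - eps * cRe c)).
  rewrite k2 cImB (_ : cIm 1 = 0) // sub0r cImMr expr2 cImM /winf cReB cImB /=.
  by move: (side_sqr he); rewrite expr2 => he2; ring: he2.
have rc : `|cRe c| < 1.
  by rewrite (le_lt_trans (ler_Re_nrm _)) // (le_lt_trans (dom_b d)) //; case/andP: b01.
have pc : 0 < 1 - eps * cRe c.
  by move: rc; rewrite ltr_norml => /andP[? ?]; case: he => ->; lra.
have im2_gt0 : 0 < eps * cIm (k ^+ 2).
  rewrite im2 mulrA -expr2 side_sqr // mul1r.
  by rewrite mulr_gt0 // mulr_gt0 // mulr_gt0 // exprn_gt0.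
pose q := (1 - eps%:C * c) / (1 + eps%:C * c).
have np : 1 + eps%:C * c != 0.
  by case: he => ->; rewrite ?rmorphN rmorph1 ?mul1r ?mulN1r.
have kE : k = - (eps%:C * 'i%C * (sheet_root m eps c * q)).
  rewrite /k /rhoi winfE // exprMn expr2 side_sqrC // mul1r /q.
  rewrite (one_sub_sqrE c he).
  by field; rewrite np; move: w0; rewrite winfE // mulf_eq0 => /norP[].
have req : 0 < cRe (sheet_root m eps c * q).
  rewrite /q mulrA; set z := 1 + eps%:C * c in np *.
  have zz : nrm z ^+ 2 > 0 by rewrite exprn_gt0 // nrm_gt0.
  have -> : cRe (sheet_root m eps c * (1 - eps%:C * c) / z) =
     cRe (sheet_root m eps c * ((1 - eps%:C * c) * z^*%C)) / nrm z ^+ 2.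
    rewrite nrm_sqr; case: z {np zz} => p s; rewrite mulrA.
    case: (sheet_root m eps c * _) => u v /=.
    by rewrite !mulrN !opprK mulrDl -!mulrA ; congr (_ + _); ring.
  rewrite divr_gt0 //.
  set s := sheet_root m eps c; set y := (1 - eps%:C * c) * z^*%C.
  have ry : cRe y = 1 - nrm c ^+ 2.
    rewrite nrm_sqr /y /z; case: (c) => p t /=.
    by move: (side_sqr he); rewrite expr2 => he2; ring: he2.
  have ny : nrm y <= 2.
    rewrite nrmM (_ : nrm z^*%C = nrm z); last by case: (z) => ? ? /=; rewrite sqrrN.
    rewrite -nrmM /z -(one_sub_sqrE c he).
    rewrite (le_trans (nrmB _ _)) // nrm1 nrmX.
    have : nrm c ^+ 2 <= 1.
      by rewrite expr_le1 ?nrm_ge0 // (le_trans (dom_b d)) //; case/andP: b01 => _ /ltW.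
    by move=> *; lra.
  have hs : nrm (s - 1) <= (1 - b ^+ 2) / 4.
    exact: le_trans (sqrt1D_near1 (dom_eta_half d he)) (dom_eta d he).
  have -> : s * y = y + (s - 1) * y by ring.
  have : cRe ((s - 1) * y) >= - ((1 - b ^+ 2) / 2).
    rewrite lerNl (le_trans (ler_norm _)) // normrN (le_trans (ler_Re_nrm _)) // nrmM.
    rewrite (_ : (1 - b ^+ 2) / 2 = (1 - b ^+ 2) / 4 * 2); last by field.
    by rewrite ler_pM ?nrm_ge0.
  have : nrm c ^+ 2 <= b ^+ 2 by rewrite ler_pXn2r ?nnegrE ?nrm_ge0 ?(dom_b d).
  have : b ^+ 2 < 1 by rewrite expr_lt1 //; case/andP: b01.
  by rewrite cReD ry => *; lra.
have imk : eps * cIm k < 0.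
  have -> : eps * cIm k = - (eps ^+ 2 * cRe (sheet_root m eps c * q)).
    rewrite kE cImN -mulrA cImMr; move: (sheet_root m eps c * q) => z.
    by rewrite cImM /=; ring.
  by rewrite side_sqr // mul1r oppr_lt0.
move: im2_gt0; rewrite expr2 cImM (mulrC (cIm k)) -mulr2n -mulrnAl mulrCA => h2.
by rewrite ltNge; apply/negP => rk; move: h2; rewrite mulrnAl pmulrn_lgt0 // ltNge mulr_ge0_le0 // ltW.
Qed.

(** The matching condition at [Y = 0] is a perturbation of the polynomial form
    of the vortex-sheet dispersion relation, obtained by rationalising the
    difference of the two square roots. *)
Lemma matching_condition :
  4 * c * (2 * (1 + c ^+ 2) - (m ^+ 2)%:C * (1 - c ^+ 2) ^+ 2) =
    alpha%:C * (- 'i%C * (Gi 1 c - Gi (-1) c - (x 1 0 + x (-1) 0) / alpha%:C)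
      * (1 - c ^+ 2) ^+ 3 * (sheet_root m 1 c + sheet_root m (-1) c)) ->
  half_sol 1 0 = - half_sol (-1) 0.
Proof.
set E := Gi 1 c - _ - _; set Sp := sheet_root m 1 c; set Sm := sheet_root m (-1) c.
move=> eq; have n3 := one_sub_sqr_neq0 n1 n2.
have aC : alpha%:C != 0 :> R[i] by rewrite -nrm_eq0 nrmR normr_eq0 gt_eqF.
have SS0 : Sp + Sm != 0.
  rewrite -nrm_gt0; have := Re_sqrt1D (dom_eta_half d side1).
  have := Re_sqrt1D (dom_eta_half d sideN1); have := ler_Re_nrm (Sp + Sm).
  rewrite cReD -/Sp -/Sm /Sp /Sm /sheet_root => h1 h2 h3.
  by apply: lt_le_trans h1; apply: (lt_le_trans _ (ler_norm _)); lra.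
have diff : Sp - Sm = 'i%C * alpha%:C * E * (1 - c ^+ 2).
  apply: (mulIf SS0).
  have -> : (Sp - Sm) * (Sp + Sm) = Sp ^+ 2 - Sm ^+ 2 by ring.
  have -> : Sp ^+ 2 - Sm ^+ 2 = - (4 * c * (2 * (1 + c ^+ 2) - (m ^+ 2)%:C * (1 - c ^+ 2) ^+ 2))
        / (1 - c ^+ 2) ^+ 2.
    rewrite /Sp /Sm /sheet_root !sqr_sqrtc /eta rmorphN rmorph1 mul1r mulN1r.
    by field; rewrite n3 n2 n1.
  by rewrite eq; field.
have rr : rhoi m 1 c + rhoi m (-1) c = alpha%:C * E.
  rewrite /rhoi -/Sp -/Sm rmorphN rmorph1 mul1r.
  transitivity (- ('i%C * (Sp - Sm)) / (1 - c ^+ 2)); first by field.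
  rewrite diff; transitivity (- ('i%C * 'i%C) * alpha%:C * E); last by rewrite sqr_iC; ring.
  by field.
rewrite /half_sol /gf rmorphN rmorph1 !mulr0.
apply/eqP; rewrite -subr_eq0 opprK; apply/eqP.
transitivity ((rhoi m 1 c + rhoi m (-1) c) - alpha%:C * E); last by rewrite rr subrr.
by rewrite /E; field.
Qed.

(** As [half_sol (-1) y] stands for [- r (- y)], the condition says that the two
    pieces of [r] agree at [0], where they are glued. *)
Lemma mode_of_matching : half_sol 1 0 = - half_sol (-1) 0 -> has_mode m U alpha c.
Proof.
move=> match0.
pose r y := if 0 <= y then half_sol 1 y else - half_sol (-1) (- y).
pose w (y : R) : R[i] := (U y)%:C - c.
pose rhs (y : R) (z : R[i]) := alpha%:C * ((w y)^-1 ^+ 2 - (m ^+ 2)%:C - w y ^+ 2 * z ^+ 2).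
have w1 y : wf 1 c y = w y by rewrite /wf mul1r.
have wN y : wf (-1) c (- y) = w y by rewrite /wf mulrNN mul1r.
have dr (y : R) : dC r y (rhs y (r y)).
  have H := @dC_glue_all R (half_sol 1) (fun y => - half_sol (-1) (- y))
    (fun y => rhs y (half_sol 1 y)) (fun y => rhs y (- half_sol (-1) (- y))) _ _ _ _ y.
  apply: (dC_eqf (H _ _ _ _)) => // [|||z z0|].
  - by rewrite oppr0.
  - by rewrite oppr0 match0.
  - by move=> z z0; rewrite /rhs -w1; exact: half_sol_riccati side1 z0.
  - have z0' : 0 <= - z by rewrite oppr_ge0.
    apply: (dC_eqf (dCN (dC_opp (half_sol_riccati sideN1 z0')))) => //.
    by rewrite opprK /rhs -wN sqrrN.
  - by rewrite /r; case: ifP.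
have [Cp HCp] := half_sol_bounded side1; have [Cm HCm] := half_sol_bounded sideN1.
have br y : nrm (r y) <= `|Cp| + `|Cm|.
  rewrite /r; case: ifPn => [y0|]; last rewrite -ltNge => /ltW y0.
    by rewrite (le_trans (HCp y y0)) // (le_trans (ler_norm _)) // lerDl.
  rewrite nrmN (le_trans (HCm (- y) _)) ?oppr_ge0 // (le_trans (ler_norm _)) //.
  by rewrite lerDr.
have tail eps : side eps -> exists2 Y0, 0 <= Y0 & forall y, Y0 <= y ->
    cRe (wf eps c y ^+ 2 * half_sol eps y) <= cRe (winf eps c ^+ 2 * rhoi m eps c) / 2.
  move=> he; have [C C0 HC] := half_sol_limit he; have kn := limit_rate_gt0 he.
  set k := cRe _ in kn; have [|Y0 y0 hY] := @edecay_small _ _ theta_gt0 (- k / (2 * (C + 1))) 0.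
    by rewrite divr_gt0 ?oppr_gt0 // mulr_gt0 // ltr_wpDl.
  exists Y0 => // y Yy; have yy := le_trans y0 Yy.
  have oy : om y <= - k / (2 * (C + 1)).
    by rewrite (le_trans _ hY) // /edecay ler_expR lerN2 ler_pM2l.
  move: oy; rewrite ler_pdivlMr ?mulr_gt0 ?ltr_wpDl // => oy.
  have := le_trans (ler_Re_nrm _) (HC y yy); rewrite cReB -/k ler_norml => /andP[_ h1].
  have := om_ge0 y => *; nra.
have [Yp Yp0 HYp] := tail 1 side1; have [Ym Ym0 HYm] := tail (-1) sideN1.
have kp := limit_rate_gt0 side1; have km := limit_rate_gt0 sideN1.
pose kap := Num.min (- (cRe (winf 1 c ^+ 2 * rhoi m 1 c) / 2))
                    (- (cRe (winf (-1) c ^+ 2 * rhoi m (-1) c) / 2)).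
pose B := MU + (`|Cp| + `|Cm|).
have B1 : MU <= B by rewrite lerDl addr_ge0.
apply: (@mode_of_riccati R m alpha B (Yp + Ym + 1) kap c U U1 U2 r) => //.
- exact: dom_Im_gt0 d.
- by move=> y; rewrite (le_trans (bU y)).
- by move=> y; rewrite (le_trans (bU1 y)).
- by move=> y; rewrite (le_trans (bU2 y)).
- by move=> y; rewrite (le_trans (br y)) // lerDr.
- by rewrite !addr_ge0.
- by rewrite lt_min !oppr_gt0 !pmulr_llt0 ?invr_gt0 // kp km.
- move=> y Yy; have y1 : Yp <= y by apply: le_trans Yy; lra.
  have y0 := le_trans Yp0 y1.
  rewrite /r y0 -/(w y) -w1 (le_trans (HYp y y1)) // lerNr.
  by rewrite ge_min lexx.
- move=> y Yy; have y1 : Ym <= - y by rewrite lerNr (le_trans Yy) //; lra.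
  have yn : y < 0 by apply: le_lt_trans Yy _; lra.
  have -> : r y = - half_sol (-1) (- y) by rewrite /r leNgt yn.
  rewrite -/(w y) -wN mulrN cReN lerNr (le_trans (HYm (- y) y1)) //.
  by rewrite lerNr ge_min lexx orbT.
Qed.

End Matching.


(** Its nonzero roots are those of [(1 - c)^-2 + (1 + c)^-2 = m^2], the dispersion
    relation of a compressible vortex sheet. *)
Definition dispersion (c : R[i]) : R[i] :=
  4 * c * (2 * (1 + c ^+ 2) - (m ^+ 2)%:C * (1 - c ^+ 2) ^+ 2).

Definition correction (x : R -> R -> R[i] -> R -> R[i]) alpha c : R[i] :=
  - 'i%C * (Gi 1 c - Gi (-1) c - (x 1 alpha c 0 + x (-1) alpha c 0) / alpha%:C)
      * (1 - c ^+ 2) ^+ 3 * (sheet_root m 1 c + sheet_root m (-1) c).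

(** All that remains of the differential equations is one scalar equation for
    [c]: for [alpha = 0] it is the dispersion relation of the vortex sheet, and
    the bounds on [correction] make it accessible to a fixed point argument for
    small [alpha].  The last clause describes the half-line solutions, from
    which the limit of [correction] can be computed. *)
Lemma layer_reduction :
  (forall eps, side eps -> BLip dom one (fun _ c _ => Gi eps c)) ->
  exists alpha1 M (x : R -> R -> R[i] -> R -> R[i]),
  [/\ 0 < alpha1, 0 <= M &
   forall alpha c, dom alpha c -> alpha <= alpha1 ->
   [/\ nrm (correction x alpha c) <= M,
       forall c', dom alpha c' ->
         nrm (correction x alpha c - correction x alpha c') <= M * nrm (c - c'),
       dispersion c = alpha%:C * correction x alpha c -> has_mode m U alpha c &
       forall eps, side eps ->
         riccati theta alpha (F0f eps alpha c) (F1f eps alpha c) (F2f eps alpha c)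
           (x eps alpha c) /\
         forall y, 0 <= y -> nrm (x eps alpha c y) <= M * alpha * om y]].
Proof.
move=> HGi; have [alpha1 [M [x [a1 M0 Hx]]]] := layer_solutions.
pose dom1 alpha c := dom alpha c /\ alpha <= alpha1.
have sub f : BLip dom one f -> BLip dom1 one f.
  move=> [N N0 HN]; exists N => // a c [d _]; have [h1 h2] := HN a c d.
  by split => // c' [d' _]; exact: h2.
have Bx eps : side eps -> BLip dom1 one (fun alpha c _ => x eps alpha c 0 / alpha%:C).
  move=> he; exists M => // a c [d ha]; have [_ h1 h2] := Hx eps a c he d ha.
  have /andP[a0 _] := dom_alpha d.
  have aV z : nrm (z / a%:C) = nrm z / a by rewrite nrmM nrmV nrmR gtr0_norm.
  split => [y _|c' [d' _] y _].
    rewrite mulr1 aV ler_pdivrMr //; have := h1 0 (lexx 0).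
    by rewrite edecay0 mulr1.
  rewrite -mulrBl aV mulr1 ler_pdivrMr // (le_trans (h2 c' d')) //.
  by rewrite le_eqVlt mulrAC eqxx.
have Bc := sub _ BLip_c; have B1 := BLip_cst dom1 (1 : R[i]).
have Bd := BLipB B1 (BLip_sqr Bc).
have Bd3 := BLipM1 (BLip_sqr Bd) Bd.
have BS := BLipD (sub _ (BLip_sheet_root side1)) (sub _ (BLip_sheet_root sideN1)).
have BE := BLipB (BLipB (sub _ (HGi 1 side1)) (sub _ (HGi (-1) sideN1)))
  (BLipD (Bx 1 side1) (Bx (-1) sideN1)).
have [N N0 HN] := BLipM1 (BLipM1 (BLipM1 (BLip_cst dom1 (- 'i%C)) BE) Bd3) BS.
exists alpha1, (M + N), x; split => //; first exact: addr_ge0.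
move=> alpha c d ha; have [h1 h2] := HN alpha c (conj d ha).
have /andP[a0 _] := dom_alpha d.
have cE c' : correction x alpha c' = - 'i%C * (Gi 1 c' - Gi (-1) c' -
     (x 1 alpha c' 0 / alpha%:C + x (-1) alpha c' 0 / alpha%:C)) *
     ((1 - c' ^+ 2) ^+ 2 * (1 - c' ^+ 2)) * (sheet_root m 1 c' + sheet_root m (-1) c').
  by rewrite /correction -mulrDl -exprSr.
split.
- by rewrite cE (le_trans (h1 0 (lexx 0))) // mulr1 lerDr.
- move=> c' d'; rewrite !cE (le_trans (h2 c' (conj d' ha) 0 (lexx 0))) // mulr1.
  by rewrite ler_wpM2r ?nrm_ge0 // lerDr.
- have Hr eps (he : side eps) := let: And3 h _ _ := Hx eps alpha c he d ha in h.
  move=> /(matching_condition (x := fun eps => x eps alpha c) d).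
  exact: (mode_of_matching d Hr).
- move=> eps he; have [k1 k2 _] := Hx eps alpha c he d ha; split => // y y0.
  by rewrite (le_trans (k2 y y0)) // ler_wpM2r // ler_wpM2r ?(ltW a0) // lerDl.
Qed.

End Layer.
(** * The scalar equation for the wave speed *)

Section Newton.
Context {R : realType}.

Lemma nrm_nat (n : nat) : nrm (n%:R : R[i]) = n%:R.
Proof. by rewrite -(rmorph_nat (real_complex R)) nrmR normr_nat. Qed.

(** A simplified Newton iteration [c - (F c - N c) / L], with the derivative
    frozen at the constant [L], is a contraction near an approximate root. *)
Lemma newton_root (F N : R[i] -> R[i]) (b L : R[i]) (rad : R) : 0 <= rad -> L != 0 ->
  (forall c c', nrm (c - b) <= rad -> nrm (c' - b) <= rad ->
     nrm (F c - F c' - L * (c - c')) <= nrm L / 4 * nrm (c - c')) ->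
  (forall c c', nrm (c - b) <= rad -> nrm (c' - b) <= rad ->
     nrm (N c - N c') <= nrm L / 4 * nrm (c - c')) ->
  nrm (F b - N b) <= nrm L * rad / 8 ->
  exists2 c, nrm (c - b) <= rad & F c = N c.
Proof.
move=> r0 L0 HF HN Hb; have LP : 0 < nrm L by rewrite nrm_gt0.
pose T c := c - (F c - N c) / L.
have ctr c c' : nrm (c - b) <= rad -> nrm (c' - b) <= rad ->
    nrm (T c - T c') <= nrm (c - c') / 2.
  move=> hc hc'.
  have -> : T c - T c' = - ((F c - F c' - L * (c - c')) - (N c - N c')) / L.
    by rewrite /T; field.
  rewrite nrmM nrmN nrmV ler_pdivrMr // (le_trans (nrmB _ _)) //.
  have := HF c c' hc hc'; have := HN c c' hc hc' => *; lra.
have Tb : nrm (T b - b) <= rad / 8.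
  have -> : T b - b = - (F b - N b) / L by rewrite /T; field.
  by rewrite nrmM nrmN nrmV ler_pdivrMr // mulrAC mulrC mulrCA mulrA mulrC mulrA.
pose C (z : unit -> R[i]) := nrm (z tt - b) <= rad.
have TC c : nrm (c - b) <= rad -> nrm (T c - b) <= rad.
  move=> hc; have bb : nrm (b - b) <= rad by rewrite subrr nrm0.
  have := nrm_split (T c) b (T b); have := ctr c b hc bb => *; lra.
have [||||||z [Cz Pz _]] := @fixpoint_weighted R unit (fun=> 1) C (fun z t => T (z t)) (fun=> b) (rad / 8).
- by rewrite /C subrr nrm0.
- by move=> z; exact: TC.
- move=> x y k Cx Cy k0 hk []; rewrite mulr1; have := hk tt; rewrite mulr1 => hk'.
  by rewrite (le_trans (ctr _ _ Cx Cy)) // ler_wpM2r.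
- by rewrite divr_ge0.
- by move=> _; rewrite mulr1.
- move=> u x Cu hx; apply: (@le_half_pow _ _ _ (4 * (rad / 8 * 1))) => n.
  rewrite (le_trans (nrm_split _ _ (u n tt))) // addrC lerD ?hx //.
  exact: Cu.
exists (z tt); first exact: Cz.
have := Pz tt; rewrite /T => /eqP; rewrite subr_eq -subr_eq0 opprD addNKr oppr_eq0.
by rewrite mulf_eq0 invr_eq0 (negPf L0) orbF subr_eq0 => /eqP.
Qed.

End Newton.

Section Dispersion.
Context {R : realType} (m : R).
Implicit Types c : R[i].

(** The divided difference of [dispersion], so on the diagonal its derivative. *)
Definition dispersion_quot c c' : R[i] :=
  (8 - 4 * (m ^+ 2)%:C) + (8 + 8 * (m ^+ 2)%:C) * (c ^+ 2 + c * c' + c' ^+ 2)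
  - 4 * (m ^+ 2)%:C * (c ^+ 4 + c ^+ 3 * c' + c ^+ 2 * c' ^+ 2 + c * c' ^+ 3 + c' ^+ 4).

Lemma dispersion_quotE c c' :
  dispersion m c - dispersion m c' = dispersion_quot c c' * (c - c').
Proof. by rewrite /dispersion /dispersion_quot; ring. Qed.

Lemma nrm_le1X c n : nrm c <= 1 -> nrm (c ^+ n) <= 1.
Proof. by move=> h; rewrite nrmX exprn_ile1 // nrm_ge0. Qed.

Lemma nrm_prod_dist (a b a' b' : R[i]) (s t : R) : nrm b <= 1 -> nrm a' <= 1 ->
  nrm (a - a') <= s -> nrm (b - b') <= t -> nrm (a * b - a' * b') <= s + t.
Proof.
move=> hb ha hs ht.
have -> : a * b - a' * b' = (a - a') * b + a' * (b - b') by ring.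
rewrite (le_trans (nrmD _ _)) // !nrmM lerD //.
  by rewrite -[s]mulr1 ler_pM ?nrm_ge0.
by rewrite -[t]mul1r ler_pM ?nrm_ge0.
Qed.

Lemma dispersion_quot_dist c c' c0 : nrm c <= 1 -> nrm c' <= 1 -> nrm c0 <= 1 ->
  nrm (dispersion_quot c c' - dispersion_quot c0 c0) <=
    (24 + 64 * m ^+ 2) * (nrm (c - c0) + nrm (c' - c0)).
Proof.
move=> h1 h2 h3; set s := nrm (c - c0); set t := nrm (c' - c0).
have P := nrm_prod_dist; have X := nrm_le1X.
have e2 : nrm (c ^+ 2 - c0 ^+ 2) <= s + s by rewrite !expr2; exact: P.
have f2 : nrm (c' ^+ 2 - c0 ^+ 2) <= t + t by rewrite !expr2; exact: P.
have e3 : nrm (c ^+ 3 - c0 ^+ 3) <= s + (s + s) by rewrite !(exprS _ 2); apply: P => //; exact: X.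
have f3 : nrm (c' ^+ 3 - c0 ^+ 3) <= t + (t + t) by rewrite !(exprS _ 2); apply: P => //; exact: X.
have k1 : nrm (c * c' - c0 * c0) <= s + t by exact: P.
have k2 : nrm (c ^+ 4 - c0 ^+ 4) <= s + (s + (s + s)).
  by rewrite !(exprS _ 3); apply: P => //; exact: X.
have k3 : nrm (c ^+ 3 * c' - c0 ^+ 3 * c0) <= s + (s + s) + t by apply: P => //; exact: X.
have k4 : nrm (c ^+ 2 * c' ^+ 2 - c0 ^+ 2 * c0 ^+ 2) <= s + s + (t + t).
  by apply: P => //; exact: X.
have k5 : nrm (c * c' ^+ 3 - c0 * c0 ^+ 3) <= s + (t + (t + t)) by apply: P => //; exact: X.
have k6 : nrm (c' ^+ 4 - c0 ^+ 4) <= t + (t + (t + t)).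
  by rewrite !(exprS _ 3); apply: P => //; exact: X.
have -> : dispersion_quot c c' - dispersion_quot c0 c0 =
  (8 + 8 * m ^+ 2)%:C * ((c ^+ 2 - c0 ^+ 2) + (c * c' - c0 * c0) + (c' ^+ 2 - c0 ^+ 2))
  - (4 * m ^+ 2)%:C * ((c ^+ 4 - c0 ^+ 4) + (c ^+ 3 * c' - c0 ^+ 3 * c0)
     + (c ^+ 2 * c' ^+ 2 - c0 ^+ 2 * c0 ^+ 2) + (c * c' ^+ 3 - c0 * c0 ^+ 3)
     + (c' ^+ 4 - c0 ^+ 4)).
  by rewrite /dispersion_quot rmorphD !rmorphM /= !rmorph_nat; ring.
have m2 : 0 <= m ^+ 2 := sqr_ge0 m.
have s0 : 0 <= s := nrm_ge0 _; have t0 : 0 <= t := nrm_ge0 _.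
have a0 : 0 <= 8 + 8 * m ^+ 2 by lra.
have b0 : 0 <= 4 * m ^+ 2 by lra.
rewrite (le_trans (nrmB _ _)) // !nrmM !nrmR (ger0_norm a0) (ger0_norm b0).
have -> : (24 + 64 * m ^+ 2) * (s + t) =
  (8 + 8 * m ^+ 2) * (3 * (s + t)) + (4 * m ^+ 2) * (10 * (s + t)) by ring.
rewrite lerD // ler_wpM2l //.
  have := nrmD (c ^+ 2 - c0 ^+ 2 + (c * c' - c0 * c0)) (c' ^+ 2 - c0 ^+ 2).
  have := nrmD (c ^+ 2 - c0 ^+ 2) (c * c' - c0 * c0) => *; lra.
do 4 (rewrite (le_trans (nrmD _ _)) //; rewrite -?lerBrDr).
by lra.
Qed.

Lemma dispersion_quot_root c0 : 2 * (1 + c0 ^+ 2) = (m ^+ 2)%:C * (1 - c0 ^+ 2) ^+ 2 ->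
  dispersion_quot c0 c0 = 16 * c0 ^+ 2 * (1 + (m ^+ 2)%:C * (1 - c0 ^+ 2)).
Proof.
move=> e; transitivity (dispersion_quot c0 c0 - 4 * (2 * (1 + c0 ^+ 2) - (m ^+ 2)%:C * (1 - c0 ^+ 2) ^+ 2)).
  by rewrite e subrr mulr0 subr0.
by rewrite /dispersion_quot; ring.
Qed.

Lemma dispersion_root c0 : 2 * (1 + c0 ^+ 2) = (m ^+ 2)%:C * (1 - c0 ^+ 2) ^+ 2 ->
  dispersion m c0 = 0.
Proof. by move=> e; rewrite /dispersion e subrr mulr0. Qed.

Lemma eta_dispersion eps c : 1 - c != 0 -> 1 + c != 0 ->
  eta m eps c = - (2 * (1 + c ^+ 2) - (m ^+ 2)%:C * (1 - c ^+ 2) ^+ 2)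
     / (1 - c ^+ 2) ^+ 2 * (1 + eps%:C * c) ^+ 2.
Proof.
move=> n1 n2; rewrite /eta; have n3 := one_sub_sqr_neq0 n1 n2.
by field; rewrite n1 n2 n3.
Qed.

(** By [eta_dispersion], [eta] is a multiple of the vortex-sheet relation, which
    vanishes at [c0]. *)
Lemma eta_near (b : R) c c0 eps : 0 <= b < 1 -> nrm c <= b -> nrm c0 <= b -> side eps ->
  2 * (1 + c0 ^+ 2) = (m ^+ 2)%:C * (1 - c0 ^+ 2) ^+ 2 ->
  nrm (eta m eps c) <= (16 + 32 * m ^+ 2) / (1 - b) ^+ 4 * nrm (c - c0).
Proof.
move=> /andP[b0 b1] hc hc0 he e0; have p1 : 0 < 1 - b by rewrite subr_gt0.
have lo (s : R) : `|s| = 1 -> 1 - b <= nrm (1 + s%:C * c).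
  move=> s1; have := nrm_subr_ge 1 (- (s%:C * c)); rewrite opprK nrmN nrm1 nrmM nrmR s1 mul1r.
  by apply: le_trans; rewrite lerD2l lerN2.
have l1 : 1 - b <= nrm (1 + c) by have := lo 1; rewrite normr1 rmorph1 mul1r; exact.
have l2 : 1 - b <= nrm (1 - c).
  by have := lo (-1); rewrite normrN normr1 rmorphN rmorph1 mulN1r; exact.
have n1 : 1 - c != 0 by rewrite -nrm_gt0 (lt_le_trans p1).
have n2 : 1 + c != 0 by rewrite -nrm_gt0 (lt_le_trans p1).
have hc1 := le_trans hc (ltW b1); have hc01 := le_trans hc0 (ltW b1).
have l3 : (1 - b) ^+ 4 <= nrm ((1 - c ^+ 2) ^+ 2).
  rewrite (_ : 1 - c ^+ 2 = (1 - c) * (1 + c)); last by ring.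
  have p2 : (1 - b) ^+ 2 <= nrm (1 - c) * nrm (1 + c) by rewrite expr2 ler_pM // ltW.
  rewrite -[X in _ ^+ X <= _]/(2 * 2)%N exprM nrmX nrmM.
  by rewrite ler_pXn2r ?nnegrE ?mulr_ge0 ?nrm_ge0 // ltW.
have u1 : nrm ((1 + eps%:C * c) ^+ 2) <= 4.
  rewrite nrmX (_ : 4 = 2 ^+ 2 :> R) ?ler_pXn2r ?nnegrE ?nrm_ge0 //; last by rewrite expr2 -natrM.
  rewrite (le_trans (nrmD _ _)) // nrm1 nrmM nrmR.
  have -> : `|eps| = 1 by case: he => ->; rewrite ?normrN normr1.
  by lra.
have e1 : 2 * (1 + c ^+ 2) - (m ^+ 2)%:C * (1 - c ^+ 2) ^+ 2 =
   (c - c0) * (c + c0) * (2 + (m ^+ 2)%:C * (2 - c ^+ 2 - c0 ^+ 2)).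
  transitivity (2 * (1 + c ^+ 2) - (m ^+ 2)%:C * (1 - c ^+ 2) ^+ 2 -
     (2 * (1 + c0 ^+ 2) - (m ^+ 2)%:C * (1 - c0 ^+ 2) ^+ 2)); last by ring.
  by rewrite e0 subrr subr0.
have k1 : nrm (2 + (m ^+ 2)%:C * (2 - c ^+ 2 - c0 ^+ 2)) <= 2 + 4 * m ^+ 2.
  rewrite (le_trans (nrmD _ _)) // nrm_nat lerD2l nrmM nrmR ger0_norm ?sqr_ge0 // mulrC ler_wpM2r ?sqr_ge0 //.
  have := nrmB (2 - c ^+ 2) (c0 ^+ 2); have := nrmB 2 (c ^+ 2).
  rewrite nrm_nat; have := nrm_le1X 2 hc1; have := nrm_le1X 2 hc01 => *; lra.
have k2 : nrm (c + c0) <= 2 by have := nrmD c c0 => *; lra.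
rewrite eta_dispersion // e1.
move: l3 u1 k1; set D := (1 - c ^+ 2) ^+ 2; set Q := (1 + _) ^+ 2.
set k := 2 + _.
clearbody D Q k => l3 u1 k1; rewrite !nrmM nrmN !nrmM nrmV.
have m2 := sqr_ge0 m; have d0 := nrm_ge0 (c - c0).
have -> : (16 + 32 * m ^+ 2) / (1 - b) ^+ 4 * nrm (c - c0) =
  nrm (c - c0) * 2 * (2 + 4 * m ^+ 2) / (1 - b) ^+ 4 * 4 by field; rewrite gt_eqF.
have D0 : 0 < nrm D by rewrite (lt_le_trans _ l3) // exprn_gt0.
have q1 : nrm (c - c0) * nrm (c + c0) <= nrm (c - c0) * 2 by rewrite ler_wpM2l.
have q2 : nrm (c - c0) * nrm (c + c0) * nrm k <= nrm (c - c0) * 2 * (2 + 4 * m ^+ 2).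
  by rewrite ler_pM // ?mulr_ge0 ?nrm_ge0.
have q3 : (nrm D)^-1 <= ((1 - b) ^+ 4)^-1 by rewrite lef_pV2 ?posrE ?exprn_gt0.
rewrite ler_pM // ?nrm_ge0 //; last by rewrite ler_pM // ?invr_ge0 ?nrm_ge0 // !mulr_ge0 ?nrm_ge0.
by rewrite !mulr_ge0 ?invr_ge0 ?nrm_ge0.
Qed.

End Dispersion.
(** * Subsonic sheets: m < sqrt 2 *)

Section ShearProfile.
Context {R : realType}.

Lemma shear_profile_bounds (U : R -> R) : shear_profile U ->
  exists theta MU : R, [/\ 0 < theta, 0 <= MU,
    (forall y : R, is_derive y 1 U (derive1 U y)) /\
    (forall y : R, is_derive y 1 (derive1 U) (derive1n 2 U y)) /\
    continuous (derive1n 2 U),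
    (forall y, `|U y| <= MU) /\ (forall y, `|derive1 U y| <= MU) /\
    (forall y, `|derive1n 2 U y| <= MU) &
    forall eps y, side eps -> 0 <= y -> `|U (eps * y) - eps| <= MU * edecay theta y].
Proof.
move=> [[dU cU] [theta [t0 _ _ _ Hk]]].
have d0 (y : R) : is_derive y 1 U (derive1 U y) by apply: is_derive_derive1; exact: (dU 0%N).
have d1 (y : R) : is_derive y 1 (derive1 U) (derive1n 2 U y).
  by apply: is_derive_derive1; exact: (dU 1%N).
have shift (a : R) k y : (0 < k)%N -> derive1n k (fun x => U x + a) y = derive1n k U y.
  case: k => // k _; rewrite /derive1n !iterSr; congr (iter k _ _ y).
  apply/funext => x.
  have H := is_deriveD (d0 x) (is_derive_cst a x 1).
  by have [_ ->] := is_derive1E H; rewrite addr0.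
have bnd k : (k <= 2)%N -> exists2 B, 0 <= B &
   (forall y, 0 <= y -> `|derive1n k (fun x => U x - 1) y| <= B * edecay theta y) /\
   (forall y, y <= 0 -> `|derive1n k (fun x => U x + 1) y| <= B * edecay theta (- y)).
  move=> hk; have [[B1 H1] [B2 H2]] := Hk k hk.
  exists (`|B1| + `|B2|); first by rewrite addr_ge0.
  split=> y y0.
    have h : `|expR (theta * y) * derive1n k (fun x => U x - 1) y| <= B1 by apply: H1; exists y.
    move: h; rewrite normrM (ger0_norm (expR_ge0 _)) -ler_pdivlMl ?expR_gt0 // -expRN mulrC => h.
    rewrite (le_trans h) // ler_wpM2r ?edecay_ge0 // (le_trans (ler_norm B1)) // lerDl.
    exact: normr_ge0.
  have h : `|expR (- theta * y) * derive1n k (fun x => U x + 1) y| <= B2 by apply: H2; exists y.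
  move: h; rewrite normrM (ger0_norm (expR_ge0 _)) -ler_pdivlMl ?expR_gt0 // -expRN mulrC => h.
  rewrite (le_trans h) // mulNr -mulrN ler_wpM2r ?edecay_ge0 //.
  by rewrite (le_trans (ler_norm B2)) // lerDr; exact: normr_ge0.
have [B0 p0 [h0 k0]] := bnd 0%N isT; have [B1 p1 [h1 k1]] := bnd 1%N isT.
have [B2 p2 [h2 k2]] := bnd 2%N isT.
have le1 B (f : R -> R) y : 0 <= B -> 0 <= y -> `|f y| <= B * edecay theta y -> `|f y| <= B.
  by move=> b0 y0 h; rewrite (le_trans h) // ler_piMr // edecay_le1.
have le2 B (f : R -> R) y : 0 <= B -> y <= 0 -> `|f y| <= B * edecay theta (- y) -> `|f y| <= B.
  by move=> b0 y0 h; rewrite (le_trans h) // ler_piMr // edecay_le1 // oppr_ge0.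
exists theta, (B0 + B1 + B2 + 1); split => //; first by rewrite !addr_ge0.
- split=> [y|]; last split=> y.
  + have [y0|/ltW y0] := leP 0 y.
      have := le1 _ _ _ p0 y0 (h0 y y0); rewrite /derive1n /= => h.
      have := ler_normD (U y - 1) 1; rewrite subrK normr1 => *; lra.
    have := le2 _ _ _ p0 y0 (k0 y y0); rewrite /derive1n /= => h.
    have := ler_normB (U y + 1) 1; rewrite addrK normr1 => *; lra.
  + have [y0|/ltW y0] := leP 0 y.
      have := le1 _ _ _ p1 y0 (h1 y y0); rewrite shift // /derive1n /= => *; lra.
    have := le2 _ _ _ p1 y0 (k1 y y0); rewrite shift // /derive1n /= => *; lra.
  + have [y0|/ltW y0] := leP 0 y.
      have := le1 _ _ _ p2 y0 (h2 y y0); rewrite shift // => *; lra.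
    have := le2 _ _ _ p2 y0 (k2 y y0); rewrite shift // => *; lra.
- move=> eps y he y0; apply: (le_trans (y := B0 * edecay theta y)); last first.
    by rewrite ler_wpM2r ?edecay_ge0 //; lra.
  case: he => ->; first by rewrite mul1r; exact: (h0 y y0).
  rewrite mulN1r opprK -[in leRHS](opprK y); apply: (k0 (- y)).
  by rewrite oppr_le0.
Qed.

End ShearProfile.

Section Subsonic.
Context {R : realType} (m : R) (m_gt0 : 0 < m) (m_lt : m < Num.sqrt 2).

Lemma sigma_facts : [/\ 0 < sigma m, sigma m < 1 &
  2 * (1 - sigma m ^+ 2) = m ^+ 2 * (1 + sigma m ^+ 2) ^+ 2].
Proof.
have m2 : m ^+ 2 < 2.
  by rewrite -[ltRHS]sqr_sqrtr // ltr_pXn2r ?nnegrE ?sqrtr_ge0 ?ltW.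
have m20 : 0 < m ^+ 2 by rewrite exprn_gt0.
set q := Num.sqrt (4 * m ^+ 2 + 1).
have q2 : q ^+ 2 = 4 * m ^+ 2 + 1 by rewrite sqr_sqrtr //; lra.
have q0 : 0 <= q := sqrtr_ge0 _.
have ql : m ^+ 2 + 1 < q.
  rewrite -(@ltr_pXn2r _ 2) ?nnegrE ?q2 //; last by lra.
  by move: m2 m20; move: (m ^+ 2) => s *; nra.
have qu : q < 2 * m ^+ 2 + 1.
  rewrite -(@ltr_pXn2r _ 2) ?nnegrE ?q2 //; last by lra.
  by move: m2 m20; move: (m ^+ 2) => s *; nra.
pose s := (q - (m ^+ 2 + 1)) / m ^+ 2.
have s0 : 0 < s by rewrite divr_gt0 // subr_gt0.
have s1 : s < 1 by rewrite ltr_pdivrMr // mul1r; lra.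
have ss : sigma m ^+ 2 = s by rewrite sqr_sqrtr // ltW.
have sg : 0 < sigma m by rewrite sqrtr_gt0.
split => //.
  by rewrite -(@ltr_pXn2r _ 2) ?nnegrE ?ss ?expr1n // ltW.
rewrite ss; have e : m ^+ 2 * (1 + s) = q - 1 by rewrite /s; field; rewrite gt_eqF.
apply: (mulfI (lt0r_neq0 m20)).
transitivity ((m ^+ 2 * (1 + s)) ^+ 2); last by ring.
rewrite e sqrrB q2 expr1n mulr1.
have -> : m ^+ 2 * (2 * (1 - s)) = 2 * (2 * m ^+ 2 - m ^+ 2 * (1 + s)) by ring.
by rewrite e; ring.
Qed.

(** The root [i sigma] is at a positive distance from the range of [U], so
    [(U - c)^-2] is regular and the splitting is used with [G = 0].  It is a
    simple root, around which the Newton iteration works on a ball of radius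
    [C alpha]. *)
Lemma subsonic_modes (U : R -> R) : shear_profile U ->
  exists alpha0 C : R, [/\ 0 < alpha0, 0 <= C & forall alpha, 0 < alpha < alpha0 ->
    exists c, [/\ has_mode m U alpha c, nrm (c - 'i%C * (sigma m)%:C) <= C * alpha &
                  0 < cIm c]].
Proof.
move=> /shear_profile_bounds [theta [MU [t0 MU0 [dU [dU1 cU2]] [bU [bU1 bU2]] Uinf]]].
have [s0 s1 se] := sigma_facts.
set sg := sigma m in s0 s1 se *.
set c0 : R[i] := 'i%C * sg%:C.
have c0sq : c0 ^+ 2 = - (sg ^+ 2)%:C by rewrite exprMn sqr_i mulN1r -rmorphXn.
have c0E : 2 * (1 + c0 ^+ 2) = (m ^+ 2)%:C * (1 - c0 ^+ 2) ^+ 2.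
  rewrite c0sq opprK; move: (sg ^+ 2) (m ^+ 2) se => S mm se'.
  transitivity ((2 * (1 - S))%:C); first by rewrite rmorphM rmorphB rmorph1 rmorph_nat.
  by rewrite se' expr2 !rmorphM rmorphD rmorph1; ring.
have nc0 : nrm c0 = sg by rewrite nrmM nrmi mul1r nrmR gtr0_norm.
have ic0 : cIm c0 = sg by rewrite cImM /=; ring.
pose b := (1 + sg) / 2.
have b01 : 0 <= b < 1 by apply/andP; rewrite /b; split; lra.
have /andP[b0 b1] := b01.
have sb : sg <= b by rewrite /b; lra.
pose Ce := (16 + 32 * m ^+ 2) / (1 - b) ^+ 4.
have Ce0 : 0 <= Ce.
  apply: divr_ge0; first by have := sqr_ge0 m; lra.
  by rewrite exprn_ge0 // subr_ge0 ltW.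
have b2 : 0 < 1 - b ^+ 2 by rewrite subr_gt0 expr_lt1.
pose delta := Num.min ((1 - sg) / 2) (Num.min (sg / 2) ((1 - b ^+ 2) / 4 / (Ce + 1))).
have delta0 : 0 < delta.
  rewrite !lt_min; apply/and3P; split; [by lra|by lra|].
  by rewrite divr_gt0 ?ltr_wpDl // divr_gt0.
have [l1 l2 l3] : [/\ delta <= (1 - sg) / 2, delta <= sg / 2 & Ce * delta <= (1 - b ^+ 2) / 4].
  split; [by rewrite ge_min lexx | by rewrite !ge_min lexx orbT |].
  apply: (le_trans (y := (Ce + 1) * delta)); first by rewrite ler_wpM2r ?ltW //; lra.
  by rewrite -ler_pdivlMl ?ltr_wpDl // mulrC !ge_min lexx !orbT.
pose dom (alpha : R) (c : R[i]) := 0 < alpha <= 1 /\ nrm (c - c0) <= delta.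
have dom_alpha alpha c : dom alpha c -> 0 < alpha <= 1 by case.
have dom_b alpha c : dom alpha c -> nrm c <= b.
  move=> [_ hc]; have := nrmD (c - c0) c0; rewrite subrK nc0 => h.
  by rewrite /b; lra.
have dom_Im alpha c : dom alpha c -> sg / 2 <= cIm c.
  move=> [_ hc]; have := le_trans (ler_Im_nrm _) hc; rewrite cImB ic0 ler_norml => /andP[h _].
  by lra.
have dom_im alpha c : dom alpha c -> alpha <= 2 / sg * cIm c.
  move=> d; have /andP[_ a1] := dom_alpha _ _ d; apply: (le_trans a1).
  have := dom_Im _ _ d; rewrite mulrAC ler_pdivlMr // mul1r => h; lra.
have dom_eta alpha c eps : dom alpha c -> side eps ->
    nrm (eta m eps c) <= (1 - b ^+ 2) / 4.
  move=> d he; have [_ hc] := d; apply: le_trans l3.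
  apply: (le_trans (eta_near b01 (dom_b _ _ d) _ he c0E)); first by rewrite nc0.
  by rewrite ler_wpM2l.
pose h (c : R[i]) (y : R) := ((U y)%:C - c) ^- 2.
have wN (c : R[i]) (y : R) : 0 < cIm c -> (U y)%:C - c != 0.
  move=> ic; rewrite -nrm_gt0; apply: lt_le_trans (ler_Im_nrm _).
  by rewrite cImB /= sub0r normrN normr_gt0 gt_eqF.
have Imp alpha c : dom alpha c -> 0 < cIm c.
  by move=> /dom_Im; apply: lt_le_trans; rewrite divr_gt0.
have hE c : h c = fun y => ((U y)%:C - c)^-1 * ((U y)%:C - c)^-1.
  by apply/funext => y; rewrite /h -exprVn.
have Hdw (c : R[i]) (y : R) : dC (fun y => (U y)%:C - c) y (derive1 U y)%:C.
  by apply: (dC_eqf (dCB (dC_real (dU y)) (dC_cst c y))) => //; rewrite subr0.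
have ch alpha c : dom alpha c -> contC (h c).
  move=> d; have k : contC (fun y => ((U y)%:C - c)^-1).
    by apply: (dC_contC (fun y => dCV (wN c y (Imp _ _ d)) (Hdw c y))).
  by rewrite hE; exact: contCM.
have dG alpha (c : R[i]) : dom alpha c -> forall y : R,
    dC (fun=> 0) y (((U y)%:C - c) ^- 2 - h c y).
  by move=> _ y; rewrite subrr; exact: dC_cst.
have Bw eps : side eps -> BLip dom one (fun _ c y => (wf U eps c y)^-1).
  move=> he; apply: (BLipV (delta := sg / 2)); first by rewrite divr_gt0.
    exact: BLip_wf b01 dom_b MU0 bU eps he.
  move=> a c y d _; apply: (le_trans (dom_Im _ _ d)).
  rewrite (le_trans _ (ler_Im_nrm _)) // cImB /= sub0r normrN; exact: ler_norm.
have BwI eps : side eps -> BLip dom one (fun _ c y => (winf eps c)^-1).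
  move=> he; apply: (BLipV (delta := sg / 2)); first by rewrite divr_gt0.
    exact: (BLip_winf b01 dom_b eps).
  move=> a c y d _; apply: (le_trans (dom_Im _ _ d)).
  rewrite (le_trans _ (ler_Im_nrm _)) // cImB /= sub0r normrN; exact: ler_norm.
have Hh eps : side eps -> BLip dom (edecay theta)
    (fun _ c y => h c (eps * y) - winf eps c ^- 2).
  move=> he.
  have B1 := BLip_wf_sqr b01 dom_b MU0 bU Uinf he.
  have B2 := BLipM1 (BLip_sqr (Bw _ he)) (BLip_sqr (BwI _ he)).
  apply: (BLip_ext (BLipN (BLipM (edecay_ge0 theta) B1 B2))) => a c y d _.
  have n1 := wN c (eps * y) (Imp _ _ d).
  have n2 : winf eps c != 0.
    rewrite -nrm_gt0; apply: lt_le_trans (ler_Im_nrm _).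
    by rewrite cImB /= sub0r normrN normr_gt0 gt_eqF // (Imp _ _ d).
  by rewrite /h /wf; field; rewrite n1 n2.
have B0 (f : R -> R[i] -> R -> R[i]) : (forall a c y, f a c y = 0) -> BLip dom (edecay theta) f.
  move=> f0; apply: (BLip_ext (f := fun _ _ _ => 0)) => [|a c y _ _]; last by rewrite f0.
  apply: (BLip_fun dom (edecay_ge0 theta) (lexx 0)) => y _.
  by rewrite nrm0 mul0r.
have HG1 eps : side eps -> BLip dom (edecay theta) (fun alpha c y => alpha%:C *
    (wf U eps c y ^+ 2 * gf (fun _ _ => 0) (fun _ _ => 0) eps c y)).
  by move=> _; apply: B0 => a c y; rewrite /gf subrr !mulr0.
have HG2 eps : side eps -> BLip dom (edecay theta) (fun alpha c y => alpha%:C ^+ 2 *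
    (wf U eps c y ^+ 2 * gf (fun _ _ => 0) (fun _ _ => 0) eps c y ^+ 2)).
  by move=> _; apply: B0 => a c y; rewrite /gf subrr mulr0 expr0n !mulr0.
have [alpha1 [M [x [a1 M0 HN]]]] := @layer_reduction R dom m b (2 / sg) theta MU U
  (derive1 U) (derive1n 2 U) (fun _ _ => 0) h (fun _ _ => 0) m_gt0 t0 b01
  (divr_gt0 (ltr0n _ 2) s0) dom_alpha dom_b dom_im dom_eta dU dU1 cU2 MU0 bU bU1 bU2
  Uinf dG ch Hh
  HG1 HG2 (fun eps he => BLip_cst dom 0).
pose L := dispersion_quot m c0 c0.
have LE : L = - (16 * sg ^+ 2 * (1 + m ^+ 2 * (1 + sg ^+ 2)))%:C.
  rewrite /L dispersion_quot_root // c0sq opprK.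
  by rewrite !(rmorphM, rmorphD, rmorphXn, rmorph1, rmorph_nat) /=; ring.
have L0 : L != 0.
  rewrite LE oppr_eq0 -nrm_eq0 nrmR normr_eq0 gt_eqF // mulr_gt0 ?mulr_gt0 ?exprn_gt0 //.
  by rewrite addr_gt0 // mulr_gt0 ?exprn_gt0 // addr_gt0 // exprn_gt0.
have LP : 0 < nrm L by rewrite nrm_gt0.
pose C1 := 24 + 64 * m ^+ 2.
have C10 : 0 < C1 by rewrite /C1; have := sqr_ge0 m; lra.
pose rad1 := Num.min delta (nrm L / (8 * C1)).
have rad10 : 0 < rad1 by rewrite lt_min delta0 divr_gt0 // mulr_gt0.
pose C := 8 * M / nrm L.
have C0 : 0 <= C by rewrite divr_ge0 ?mulr_ge0 // ltW.
pose alpha0 := Num.min (Num.min 1 alpha1) (Num.min (rad1 / (C + 1)) (nrm L / (4 * (M + 1)))).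
have a00 : 0 < alpha0.
  rewrite !lt_min ltr01 a1 /=.
  by apply/andP; split; rewrite divr_gt0 ?mulr_gt0 ?ltr_wpDl.
exists alpha0, C; split => // alpha /andP[ap]; rewrite !lt_min.
move=> /andP[/andP[/ltW h1 /ltW h2] /andP[/ltW h3 /ltW h4]].
move: h3 h4; rewrite ler_pdivlMr ?ltr_wpDl // ler_pdivlMr ?mulr_gt0 ?ltr_wpDl // => h3 h4.
have rad : C * alpha <= rad1 by have := ltW ap; nra.
have aM : alpha * M <= nrm L / 4 by have := ltW ap; nra.
have inD c : nrm (c - c0) <= C * alpha -> dom alpha c.
  move=> hc; split; first by rewrite ap.
  by rewrite (le_trans hc) // (le_trans rad) // ge_min lexx.
have radL : C1 * (C * alpha + C * alpha) <= nrm L / 4.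
  have : C * alpha <= nrm L / (8 * C1) by rewrite (le_trans rad) // ge_min lexx orbT.
  by rewrite ler_pdivlMr ?mulr_gt0 // => hl; lra.
have n1 c : dom alpha c -> nrm c <= 1 by move=> /dom_b hb; lra.
have in0 : nrm (c0 - c0) <= C * alpha by rewrite subrr nrm0 mulr_ge0 // ltW.
have [|c c'|c c'||c hc Fc] := @newton_root R (dispersion m)
   (fun c => alpha%:C * correction m (fun _ _ => 0) x alpha c) c0 L (C * alpha) _ L0.
- by rewrite mulr_ge0 // ltW.
- move=> hc hc'; rewrite dispersion_quotE -mulrBl nrmM ler_wpM2r ?nrm_ge0 //.
  apply: (le_trans (dispersion_quot_dist _ _ _ _)).
  + exact: n1 (inD _ hc).
  + exact: n1 (inD _ hc').
  + exact: n1 (inD _ in0).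
  + by apply: le_trans radL; rewrite -/C1 ler_wpM2l ?(ltW C10) // lerD.
- move=> hc hc'; rewrite -mulrBr nrmM nrmR (gtr0_norm ap).
  have [_ /(_ c' (inD _ hc')) hL _ _] := HN alpha c (inD _ hc) h2.
  by rewrite (le_trans (ler_wpM2l (ltW ap) hL)) // mulrA ler_wpM2r ?nrm_ge0.
- rewrite dispersion_root // sub0r nrmN nrmM nrmR (gtr0_norm ap).
  have [hL _ _ _] := HN alpha c0 (inD _ in0) h2.
  rewrite (le_trans (ler_wpM2l (ltW ap) hL)) // /C.
  by rewrite le_eqVlt; apply/orP; left; apply/eqP; field; rewrite gt_eqF.
exists c; split => //; last exact: Imp (inD _ hc).
by have [_ _ + _] := HN alpha c (inD _ hc) h2; apply.
Qed.

End Subsonic.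
(** * The hyperbolic tangent and the logarithm *)

Section HyperbolicTangent.
Context {R : realType}.
Implicit Types y : R.

Lemma cosh_gt0 y : 0 < expR y + expR (- y).
Proof. by rewrite addr_gt0 ?expR_gt0. Qed.

Lemma is_derive_tanh y : is_derive y 1 (@tanh R) (1 - tanh y ^+ 2).
Proof.
have e1 := is_derive_expR y.
have e2 : is_derive y 1 (fun x : R => expR (- x)) (- expR (- y)).
  apply: (is_derive_eqf (is_derive1_comp (is_derive_expR (- y)) (is_deriveNid y 1))) => //.
  by rewrite mulrN1.
have n0 : expR y + expR (- y) != 0 by rewrite gt_eqF ?cosh_gt0.
have dv := @is_deriveV _ (fun x => expR x + expR (- x)) y _ 1 n0 (is_deriveD e1 e2).
apply: (is_derive_eqf (is_deriveM (is_deriveB e1 e2) dv)) => //.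
by rewrite /tanh !fctE /GRing.scale /=; field.
Qed.

Lemma tanhN y : tanh (- y) = - tanh y.
Proof. by rewrite /tanh opprK -mulNr opprB (addrC (expR y)). Qed.

Lemma tanh_side eps y : side eps -> tanh (eps * y) = eps * tanh y.
Proof. by case=> ->; rewrite ?mul1r // !mulN1r tanhN. Qed.

Lemma tanh0 : tanh 0 = 0 :> R.
Proof. by rewrite /tanh oppr0 subrr mul0r. Qed.

Lemma one_sub_tanhE y : 1 - tanh y = 2 * expR (- y) / (expR y + expR (- y)).
Proof. by rewrite /tanh; field; rewrite gt_eqF ?cosh_gt0. Qed.

Lemma tanh_lt1 y : tanh y < 1.
Proof. by rewrite -subr_gt0 one_sub_tanhE divr_gt0 ?cosh_gt0 // mulr_gt0 ?expR_gt0. Qed.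

Lemma tanh_gtN1 y : -1 < tanh y.
Proof. by rewrite -[ltRHS]opprK -tanhN ltrN2 tanh_lt1. Qed.

Lemma tanh_norm y : `|tanh y| <= 1.
Proof. by rewrite ler_norml !ltW ?tanh_lt1 ?tanh_gtN1. Qed.

Lemma tanh_ge0 y : 0 <= y -> 0 <= tanh y.
Proof.
by move=> y0; rewrite divr_ge0 ?(ltW (cosh_gt0 y)) // subr_ge0 ler_expR; lra.
Qed.

Lemma tanh_tail y : 0 <= y -> 0 <= 1 - tanh y <= 2 * edecay 2 y.
Proof.
move=> y0; rewrite subr_ge0 ltW ?tanh_lt1 //= one_sub_tanhE -mulrA ler_pM2l //.
rewrite ler_pdivrMr ?cosh_gt0 // /edecay.
have -> : expR (- (2 * y)) = expR (- y) * expR (- y) by rewrite -expRD; congr expR; ring.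
rewrite mulrDr -mulrA [expR (- y) * expR y]mulrC expRxMexpNx_1 mulr1 lerDl.
by rewrite !mulr_ge0 ?expR_ge0.
Qed.

Definition dtanh y : R := 1 - tanh y ^+ 2.
Definition ddtanh y : R := -2 * tanh y * dtanh y.

Lemma is_derive_dtanh y : is_derive y 1 dtanh (ddtanh y).
Proof.
have d := is_derive_tanh y; rewrite /ddtanh /dtanh.
apply: (is_derive_eqf (is_deriveB (is_derive_cst (1 : R) y 1) (is_deriveM d d))) => //.
by rewrite ?fctE /GRing.scale /=; ring.
Qed.

Lemma tanh_regular : [/\
  forall y, is_derive y 1 (@tanh R) (dtanh y),
  forall y, is_derive y 1 dtanh (ddtanh y),
  continuous ddtanh &
  [/\ forall y, `|tanh y| <= 2, forall y, `|dtanh y| <= 2,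
      forall y, `|ddtanh y| <= 2 &
      forall eps y, side eps -> 0 <= y -> `|tanh (eps * y) - eps| <= 2 * edecay 2 y]].
Proof.
have t2 y : 0 <= dtanh y <= 1.
  rewrite /dtanh; move: (tanh_norm y); move: (tanh y) => t.
  rewrite ler_norml => /andP[h1 h2]; have := sqr_ge0 t => h3.
  by apply/andP; split; nra.
split.
- exact: is_derive_tanh.
- exact: is_derive_dtanh.
- move=> y; exact: (@is_derive_cont R ddtanh y _
    (is_deriveM (is_deriveZ (-2) (is_derive_tanh y)) (is_derive_dtanh y))).
split.
- by move=> y; rewrite (le_trans (tanh_norm y)) //; lra.
- move=> y; move: (t2 y); move: (dtanh y) => s /andP[h1 h2].
  by rewrite ger0_norm //; lra.
- move=> y; move: (t2 y) (tanh_norm y); rewrite /ddtanh.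
  move: (dtanh y) (tanh y) => s t /andP[h1 h2] ht.
  rewrite !normrM normrN (ger0_norm h1) (ger0_norm (ler0n _ 2)) -[leRHS]mulr1 -mulrA.
  by rewrite ler_pM2l // mulr_ile1.
- move=> eps y he y0; rewrite tanh_side // -{2}[eps]mulr1 -mulrBr normrM.
  have -> : `|eps| = 1 by case: he => ->; rewrite ?normrN normr1.
  by rewrite mul1r distrC; have /andP[h1 h2] := tanh_tail y0; rewrite ger0_norm.
Qed.

End HyperbolicTangent.

Section Logarithm.
Context {R : realType}.

(** The branch of the logarithm on the open lower half-plane with imaginary
    part in [(-pi, 0)].  It is applied to [U - c] with [Im c > 0]. *)
Definition lg (z : R[i]) : R[i] :=
  (2^-1 * ln (cRe z ^+ 2 + cIm z ^+ 2)) +i* (atan (cRe z / - cIm z) - pi / 2).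

Lemma dC_lg (f : R -> R[i]) (y : R) (a : R[i]) : cIm (f y) < 0 -> dC f y a ->
  dC (fun x => lg (f x)) y (a / f y).
Proof.
move=> im [f1 f2].
have n2 : 0 < cRe (f y) ^+ 2 + cIm (f y) ^+ 2.
  by rewrite addrC ltr_wpDr ?sqr_ge0 // exprn_even_gt0 //= lt_eqF.
have i0 : cIm (f y) != 0 by rewrite lt_eqF.
have dn : is_derive y 1 (fun x => cRe (f x) ^+ 2 + cIm (f x) ^+ 2)
   (2 * (cRe (f y) * cRe a + cIm (f y) * cIm a)).
  apply: (is_derive_eqf (is_deriveD (is_deriveM f1 f1) (is_deriveM f2 f2))) => //.
  by rewrite ?fctE /GRing.scale /=; ring.
have ni : - cIm (f y) != 0 by rewrite oppr_eq0.
have dq : is_derive y 1 (fun x => cRe (f x) / - cIm (f x)) _ := is_deriveM f1 (@is_deriveV _ (fun x => - cIm (f x)) y _ 1 ni (is_deriveN f2)).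
split.
  have dl := @is_derive1_comp R (@ln R) (fun x => cRe (f x) ^+ 2 + cIm (f x) ^+ 2) y _ _
    (is_derive1_ln n2) dn.
  apply: (is_derive_eqf (is_deriveZ 2^-1 dl)) => //.
  rewrite cReM cReV cImV /GRing.scale /=; move: n2.
  move: (cRe (f y)) (cIm (f y)) (cRe a) (cIm a) => p q s t n2.
  by field; rewrite gt_eqF.
have da := @is_derive1_comp R atan (fun x => cRe (f x) / - cIm (f x)) y _ _
  (is_derive1_atan _) dq.
apply: (is_derive_eqf (is_deriveB da (is_derive_cst (pi / 2) y 1))) => //.
rewrite cImM cReV cImV /GRing.scale /= subr0; move: n2 i0.
move: (cRe (f y)) (cIm (f y)) (cRe a) (cIm a) => p q s t n2 i0.
by field; rewrite i0 (gt_eqF n2).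
Qed.

Lemma ln_dist (a b d : R) : 0 < d -> d <= a -> d <= b -> `|ln a - ln b| <= `|a - b| / d.
Proof.
move=> d0 da db; have a0 := lt_le_trans d0 da; have b0 := lt_le_trans d0 db.
have key (u v : R) : 0 < u -> 0 < v -> d <= v -> ln u - ln v <= `|u - v| / d.
  move=> u0 v0 dv; rewrite -ln_div ?posrE //.
  have -> : u / v = 1 + (u - v) / v by field; rewrite gt_eqF.
  have h1 : -1 < (u - v) / v.
    by rewrite mulrBl divff ?gt_eqF // ltrBrDr addNr divr_gt0.
  rewrite (le_trans (le_ln1Dx h1)) // (le_trans (ler_norm _)) // normrM normfV (gtr0_norm v0).
  by rewrite ler_wpM2l // lef_pV2.
rewrite ler_norml; apply/andP; split; last exact: key.
by rewrite lerNl opprB distrC; exact: key.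
Qed.

Lemma nrm_lg (z : R[i]) : cIm z < 0 -> nrm (lg z) <= nrm z + (nrm z)^-1 + pi.
Proof.
move=> im; have z0 : 0 < nrm z.
  by rewrite (lt_le_trans _ (ler_Im_nrm z)) // normr_gt0 lt_eqF.
rewrite (le_trans (ler_nrm_ReIm _)) // lerD //=.
  have -> : ln (cRe z ^+ 2 + cIm z ^+ 2) = 2 * ln (nrm z).
    by rewrite -nrm_sqr expr2 lnM ?posrE //; ring.
  rewrite mulrA mulVf // mul1r.
  have h1 := ln_sublinear z0.
  have zV : 0 < (nrm z)^-1 by rewrite invr_gt0.
  have h2 := ln_sublinear zV; rewrite lnV ?posrE // in h2.
  by rewrite ler_norml; apply/andP; split; lra.
have h1 := atan_ltpi2 (cRe z / - cIm z); have h2 := atan_gtNpi2 (cRe z / - cIm z).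
by rewrite ler_norml; apply/andP; split; have := @pi_gt0 R => *; lra.
Qed.

(** Mean value inequality along the segment, which must avoid the branch point
    at distance [d]. *)
Lemma lg_dist (z z' : R[i]) (d : R) : 0 < d ->
  (forall s : R, 0 <= s <= 1 ->
     cIm (z' + s%:C * (z - z')) < 0 /\ d <= nrm (z' + s%:C * (z - z'))) ->
  nrm (lg z - lg z') <= 2 / d * nrm (z - z').
Proof.
move=> d0 H.
pose f (s : R) := z' + s%:C * (z - z').
have df (s : R) : dC f s (z - z').
  apply: (dC_eqf (dCD (dC_cst z' s) (dCM (dC_real (is_derive_id s 1)) (dC_cst (z - z') s)))) => //.
  by rewrite rmorph1 mulr0 addr0 add0r mul1r.
have := @mvt_nrm R (fun s => lg (f s)) (fun s => (z - z') / f s) 0 1 (nrm (z - z') / d) ler01.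
have -> : f 1 = z by rewrite /f rmorph1 mul1r addrC subrK.
have -> : f 0 = z' by rewrite /f rmorph0 mul0r addr0.
rewrite subr0 mulr1 mulrA mulrAC; apply => s hs; have [h1 h2] := H s hs.
  exact: dC_lg.
by rewrite nrmM nrmV ler_wpM2l ?nrm_ge0 // lef_pV2 ?posrE // (lt_le_trans d0).
Qed.

Lemma lg_dist_Im (z z' : R[i]) (d : R) : 0 < d -> cIm z <= - d -> cIm z' <= - d ->
  nrm (lg z - lg z') <= 2 / d * nrm (z - z').
Proof.
move=> d0 h1 h2; apply: lg_dist => // s /andP[s0 s1].
have im : cIm (z' + s%:C * (z - z')) <= - d.
  by rewrite cImD cImMr cImB; nra.
split; first by apply: le_lt_trans im _; rewrite oppr_lt0.
by rewrite (le_trans _ (ler_Im_nrm _)) // -normrN (le_trans _ (ler_norm _)) // lerNr.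
Qed.

Lemma atan_compl (t : R) : 0 < t -> 0 <= pi / 2 - atan t <= t^-1.
Proof.
move=> t0; rewrite subr_ge0 ltW ?atan_ltpi2 //= lerBlDr.
apply/ler_addgt0Pr => e e0.
have /cvgrPdist_lt /(_ e e0) H := @cvgy_atan R.
near (pinfty_nbhs R) => s.
have ts : t <= s by near: s; apply: nbhs_pinfty_ge; rewrite num_real.
have hs : `|pi / 2 - atan s| < e by near: s.
have d (x : R) : 0 < x -> is_derive x 1 (fun x => atan x + x^-1) ((1 + x ^+ 2)^-1 - (x ^+ 2)^-1).
  move=> x0; have n0 : x != 0 by rewrite gt_eqF.
  apply: (is_derive_eqf (is_deriveD (is_derive1_atan x) (@is_deriveV _ (fun x => x) x _ 1 n0 (is_derive_id x 1)))) => //.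
  by rewrite /GRing.scale /= mulr1.
have P (x : R) : t <= x <= s -> 0 < x by move=> /andP[h _]; exact: lt_le_trans h.
have := mvt_nincr ts (fun x h => d x (P x h)).
have neg (x : R) : t <= x <= s -> (1 + x ^+ 2)^-1 - (x ^+ 2)^-1 <= 0.
  move=> /P x0; rewrite subr_le0 lef_pV2 ?posrE ?exprn_gt0 ?ltr_wpDl ?exprn_gt0 //.
  by rewrite lerDr.
move=> /(_ neg) /= h.
have sV : 0 < s^-1 by rewrite invr_gt0 (lt_le_trans t0).
by move: hs; rewrite ltr_norml => /andP[h1 h2]; lra.
Unshelve. all: by end_near.
Qed.

End Logarithm.
(** * The critical layer of the tanh profile *)

Section CriticalLayer.
Context {R : realType}.
Implicit Types (c : R[i]) (alpha eps y z : R).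

Definition Acoef c : R[i] := (1 - c ^+ 2)^-1.
Definition Bcoef c : R[i] := 2 * c * (1 - c ^+ 2)^-1 ^+ 2.

(** In the variable [z = tanh Y], for which [dY = dz / (1 - z^2)], the partial
    fraction expansion of [1 / ((z - c)^2 (1 - z^2))] at [z = c] is integrated
    explicitly: [Gz] carries the whole singularity of [(tanh Y - c)^-2] at the
    critical layer, and [htanh] is the smooth remainder. *)
Definition Gz c z : R[i] := Bcoef c * lg (z%:C - c) - Acoef c / (z%:C - c).
Definition Gtanh c y : R[i] := Gz c (tanh y).
Definition Glim eps c : R[i] := Gz c eps.
Definition htanh c y : R[i] :=
  2^-1 * ((1 - c)^-1 ^+ 2 * (1 + (tanh y)%:C) + (1 + c)^-1 ^+ 2 * (1 - (tanh y)%:C)).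

Lemma Im_sub_lt0 c z : 0 < cIm c -> cIm (z%:C - c) < 0.
Proof. by move=> ic; rewrite cImB /= sub0r oppr_lt0. Qed.

Lemma sub_neq0 c z : 0 < cIm c -> z%:C - c != 0.
Proof.
move=> ic; rewrite -nrm_gt0; apply: lt_le_trans (ler_Im_nrm _).
by rewrite normr_gt0 lt_eqF // Im_sub_lt0.
Qed.

Lemma Im_le_nrm_sub c z : cIm c <= nrm (z%:C - c).
Proof. by rewrite (le_trans _ (ler_Im_nrm _)) // cImB /= sub0r normrN ler_norm. Qed.

Lemma dC_Gz c (f : R -> R) (x a : R) : 0 < cIm c -> is_derive x 1 f a ->
  dC (fun s => Gz c (f s)) x
     (a%:C * (Acoef c / ((f x)%:C - c) ^+ 2 + Bcoef c / ((f x)%:C - c))).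
Proof.
move=> ic df; have dw := dCB (dC_real df) (dC_cst c x).
have w0 := sub_neq0 (f x) ic.
apply: (dC_eqf (dCB (dCZ (Bcoef c) (dC_lg (Im_sub_lt0 (f x) ic) dw))
  (dCZ (Acoef c) (dCV w0 dw)))) => //.
by field.
Qed.

Lemma dC_Gtanh c y : 0 < cIm c -> 1 - c != 0 -> 1 + c != 0 ->
  dC (Gtanh c) y (((tanh y)%:C - c) ^- 2 - htanh c y).
Proof.
move=> ic n1 n2; apply: (dC_eqf (dC_Gz ic (is_derive_tanh y))) => //.
have w0 := sub_neq0 (tanh y) ic; have n3 := one_sub_sqr_neq0 n1 n2.
rewrite /htanh /Acoef /Bcoef rmorphB rmorph1 rmorphXn.
by field; rewrite n1 n2 n3 w0.
Qed.

Lemma cont_htanh c : contC (htanh c).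
Proof.
have ct : contC (fun y => (tanh y)%:C : R[i]).
  by apply: contC_real => y; exact: is_derive_cont (is_derive_tanh y).
apply: contCM (contC_cst _) (contCD (contCM (contC_cst _) _) (contCM (contC_cst _) _)).
  exact: contCD (contC_cst _) ct.
exact: contCB (contC_cst _) ct.
Qed.

Variables (dom : R -> R[i] -> Prop) (b K : R).
Hypotheses (b01 : 0 <= b < 1) (K_gt0 : 0 < K).
Hypotheses (dom_alpha : forall alpha c, dom alpha c -> 0 < alpha <= 1)
  (dom_b : forall alpha c, dom alpha c -> nrm c <= b)
  (dom_im : forall alpha c, dom alpha c -> alpha <= K * cIm c).

Let b0 : 0 <= b. Proof. by case/andP: b01. Qed.
Let b1 : 0 < 1 - b. Proof. by case/andP: b01; rewrite subr_gt0. Qed.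
Let Imp alpha c : dom alpha c -> 0 < cIm c := @dom_Im_gt0 _ _ _ K_gt0 dom_alpha dom_im alpha c.

Lemma BLip_AB : BLip dom one (fun _ c _ => Acoef c) /\ BLip dom one (fun _ c _ => Bcoef c).
Proof.
have H1 := BLip_1DV b01 dom_b side1; have H2 := BLip_1DV b01 dom_b sideN1.
have HA : BLip dom one (fun _ c _ => Acoef c).
  apply: (BLip_ext (BLipM1 H1 H2)) => a c y d _.
  rewrite /Acoef rmorphN rmorph1 mul1r mulN1r.
  have n1 := dom_1B_neq0 b01 dom_b d; have n2 := dom_1D_neq0 b01 dom_b d.
  by field; rewrite n1 n2 one_sub_sqr_neq0.
split => //.
exact: (BLipM1 (BLipM1 (BLip_cst dom 2) (BLip_id b0 dom_b)) (BLip_sqr HA)).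
Qed.

(** Functions of [z = eps * tanh Y] are studied on the segment from [0] to [eps];
    this parametrisation by [y >= 0] lets them be families in the sense of
    [BLip]. *)
Definition seg eps y : R := eps * Num.min y 1.

Lemma segE eps y : y <= 1 -> seg eps y = eps * y.
Proof. by move=> y1; rewrite /seg; move/min_idPl : y1 => ->. Qed.

Lemma seg_le1 eps y : side eps -> 0 <= y -> `|seg eps y| <= 1.
Proof.
move=> he y0; rewrite /seg normrM (_ : `|eps| = 1); last first.
  by case: he => ->; rewrite ?normrN normr1.
by rewrite mul1r ger0_norm ?ge_min ?lexx ?orbT // le_min y0 ler01.
Qed.

Definition ws eps c y : R[i] := (seg eps y)%:C - c.
Definition gs eps c y : R[i] := Gz c (seg eps y) - Gz c eps.

Lemma nrm_ws_le eps alpha c y : side eps -> dom alpha c -> 0 <= y -> nrm (ws eps c y) <= 2.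
Proof.
move=> he d y0; rewrite (le_trans (nrmB _ _)) // nrmR.
by have := seg_le1 he y0; have := dom_b d; case/andP: b01 => *; lra.
Qed.

(** Since [Im c] may be as small as [alpha / K], an inverse power of [z - c] is
    bounded only after multiplication by [alpha]. *)
Lemma nrm_ws_ge eps alpha c y : dom alpha c -> alpha <= K * nrm (ws eps c y).
Proof.
by move=> d; rewrite (le_trans (dom_im d)) // ler_pM2l // Im_le_nrm_sub.
Qed.

Lemma ws_gt0 eps alpha c y : dom alpha c -> 0 < nrm (ws eps c y).
Proof. by move=> d; rewrite (lt_le_trans (Imp d)) // Im_le_nrm_sub. Qed.

Lemma BLip_ws eps : side eps -> BLip dom one (fun _ c y => ws eps c y).
Proof.
move=> he; apply: (BLipB _ (BLip_id b0 dom_b)).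
by apply: (@BLip_fun R dom one (@one_ge0 R) (fun y => (seg eps y)%:C) 1 ler01) => y y0; rewrite nrmR mulr1 seg_le1.
Qed.

Lemma UB_alpha_ws eps : UB dom one (fun alpha c y => alpha%:C / ws eps c y).
Proof.
exists K; first exact: ltW.
move=> a c d y y0; have /andP[a0 _] := dom_alpha d.
by rewrite nrmM nrmV nrmR gtr0_norm // mulr1 ler_pdivrMr ?(ws_gt0 _ _ d) // nrm_ws_ge.
Qed.

Lemma BLip_alpha2_ws eps : BLip dom one (fun alpha c y => alpha%:C ^+ 2 / ws eps c y).
Proof.
exists (K + K ^+ 2); first by rewrite addr_ge0 ?sqr_ge0 // ltW.
move=> a c d; have /andP[a0 a1] := dom_alpha d; have K0 := ltW K_gt0.
have h1 c' (d' : dom a c') y : a / nrm (ws eps c' y) <= K.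
  by rewrite ler_pdivrMr ?(ws_gt0 _ _ d') // nrm_ws_ge.
split => [y y0|c' d' y y0].
  rewrite nrmM nrmV nrmX nrmR gtr0_norm // mulr1 expr2 -mulrA.
  apply: (le_trans (y := 1 * K)); last by rewrite mul1r lerDl sqr_ge0.
  by rewrite ler_pM ?h1 ?(ltW a0) // divr_ge0 ?nrm_ge0 // ltW.
have w1 : ws eps c y != 0 by rewrite -nrm_gt0 (ws_gt0 _ _ d).
have w2 : ws eps c' y != 0 by rewrite -nrm_gt0 (ws_gt0 _ _ d').
have -> : a%:C ^+ 2 / ws eps c y - a%:C ^+ 2 / ws eps c' y =
   (a%:C / ws eps c y) * (a%:C / ws eps c' y) * (c - c').
  have -> : c - c' = ws eps c' y - ws eps c y by rewrite /ws; ring.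
  by field; rewrite w1 w2.
rewrite mulr1 2!nrmM ler_wpM2r ?nrm_ge0 // !nrmM !nrmV nrmR gtr0_norm //.
apply: (le_trans (y := K * K)); last by rewrite -expr2 lerDr.
by rewrite ler_pM ?h1 // divr_ge0 ?nrm_ge0 // ltW.
Qed.

Lemma BLip_alpha_lg eps : side eps ->
  BLip dom one (fun alpha c y => alpha%:C * lg (ws eps c y)).
Proof.
move=> he; have p0 := @pi_gt0 R; have K0 := ltW K_gt0.
exists (2 + K + pi + 2 * K); first by lra.
move=> a c d; have /andP[a0 a1] := dom_alpha d.
have im c' (d' : dom a c') y : cIm (ws eps c' y) <= - (a / K).
  by rewrite cImB /= sub0r lerN2 ler_pdivrMr // mulrC dom_im.
split => [y y0|c' d' y y0].
  rewrite nrmM nrmR gtr0_norm // mulr1.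
  have im0 : cIm (ws eps c y) < 0 by exact: Im_sub_lt0 (Imp d).
  have h := nrm_lg im0; have h2 := nrm_ws_le he d y0.
  have h3 : a * (nrm (ws eps c y))^-1 <= K.
    by rewrite ler_pdivrMr ?(ws_gt0 _ _ d) // nrm_ws_ge.
  apply: (le_trans (ler_wpM2l (ltW a0) h)); rewrite 2!mulrDr.
  have h4 : a * nrm (ws eps c y) <= 1 * 2 by rewrite ler_pM ?nrm_ge0 // ltW.
  have h5 : a * pi <= 1 * pi by rewrite ler_wpM2r // ltW.
  by apply: (le_trans (lerD (lerD h4 h3) h5)); lra.
rewrite -mulrBr nrmM nrmR gtr0_norm // mulr1.
have aK : 0 < a / K by rewrite divr_gt0.
have h := lg_dist_Im aK (im c d y) (im c' d' y).
apply: (le_trans (ler_wpM2l (ltW a0) h)).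
have -> : nrm (ws eps c y - ws eps c' y) = nrm (c - c').
  by rewrite nrmC /ws; congr nrm; ring.
rewrite mulrA ler_wpM2r ?nrm_ge0 //.
have -> : a * (2 / (a / K)) = 2 * K by field; rewrite !gt_eqF.
by lra.
Qed.

Lemma UB_ws_lg eps : side eps -> UB dom one (fun alpha c y => ws eps c y * lg (ws eps c y)).
Proof.
move=> he; have p0 := @pi_gt0 R; exists (5 + 2 * pi); first by lra.
move=> a c d y y0; have w0 := ws_gt0 eps y d.
have im0 : cIm (ws eps c y) < 0 by exact: Im_sub_lt0 (Imp d).
have h := nrm_lg im0; have h2 := nrm_ws_le he d y0.
rewrite nrmM mulr1 (le_trans (ler_wpM2l (ltW w0) h)) // 2!mulrDr divff ?gt_eqF //.
have h4 : nrm (ws eps c y) * nrm (ws eps c y) <= 2 * 2 by rewrite ler_pM ?nrm_ge0.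
have h5 : nrm (ws eps c y) * pi <= 2 * pi by rewrite ler_wpM2r // ltW.
by lra.
Qed.

Lemma nrm_end_ge eps alpha c : side eps -> dom alpha c -> 1 - b <= nrm (eps%:C - c).
Proof.
move=> he d; have := nrm_subr_ge eps%:C c; rewrite nrmR.
have -> : `|eps| = 1 by case: he => ->; rewrite ?normrN normr1.
by apply: le_trans; rewrite lerD2l lerN2 (dom_b d).
Qed.

Lemma BLip_lg_end eps : side eps -> BLip dom one (fun _ c _ => lg (eps%:C - c)).
Proof.
move=> he; have p0 := @pi_gt0 R; have bV : 0 < (1 - b)^-1 by rewrite invr_gt0.
exists (2 + (1 - b)^-1 + pi + 2 / (1 - b)); first by lra.
move=> a c d; split => [y _|c' d' y _].
  have im0 : cIm (eps%:C - c) < 0 by exact: Im_sub_lt0 (Imp d).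
  rewrite mulr1 (le_trans (nrm_lg im0)) //.
  have h1 : (nrm (eps%:C - c))^-1 <= (1 - b)^-1.
    by rewrite lef_pV2 ?posrE ?(nrm_end_ge he d) // (lt_le_trans b1) // (nrm_end_ge he d).
  have h2 : nrm (eps%:C - c) <= 2.
    rewrite (le_trans (nrmB _ _)) // nrmR.
    have -> : `|eps| = 1 by case: he => ->; rewrite ?normrN normr1.
    by have := dom_b d; case/andP: b01 => *; lra.
  by lra.
have -> : nrm (c - c') = nrm (eps%:C - c - (eps%:C - c')) by rewrite nrmC; congr nrm; ring.
rewrite mulr1 (le_trans (lg_dist b1 _)) //; last first.
  by rewrite ler_wpM2r ?nrm_ge0 //; lra.
move=> s /andP[s0 s1].
have -> : eps%:C - c' + s%:C * (eps%:C - c - (eps%:C - c')) = eps%:C - (c' + s%:C * (c - c')) by ring.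
have i1 := Imp d; have i2 := Imp d'.
split; first by rewrite cImB /= sub0r oppr_lt0 cImD cImMr cImB; nra.
have := nrm_subr_ge eps%:C (c' + s%:C * (c - c')); rewrite nrmR.
have -> : `|eps| = 1 by case: he => ->; rewrite ?normrN normr1.
apply: le_trans; rewrite lerD2l lerN2.
have -> : c' + s%:C * (c - c') = (1 - s)%:C * c' + s%:C * c.
  by rewrite rmorphB rmorph1; ring.
rewrite (le_trans (nrmD _ _)) // !nrmM !nrmR (ger0_norm s0) ger0_norm ?subr_ge0 //.
have t0 : 0 <= 1 - s by rewrite subr_ge0.
have := ler_wpM2l t0 (dom_b d'); have := ler_wpM2l s0 (dom_b d); case/andP: b01 => *; lra.
Qed.

Lemma BLip_Glim eps : side eps -> BLip dom one (fun _ c _ => Glim eps c).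
Proof.
move=> he; have [HA HB] := BLip_AB.
apply: (BLipB (BLipM1 HB (BLip_lg_end he)) (BLipM1 HA _)).
apply: (BLipV b1); last by move=> a c y d _; exact: nrm_end_ge he d.
exact: (BLipB (BLip_cst dom eps%:C) (BLip_id b0 dom_b)).
Qed.

Let BLip_alpha : BLip dom one (fun alpha _ _ => alpha%:C).
Proof.
apply: (@BLip_scalar _ dom (fun a => a%:C) 1 ler01) => a c d.
by have /andP[a0 a1] := dom_alpha d; rewrite nrmR gtr0_norm.
Qed.

Lemma BLip_alpha_wg eps : side eps ->
  BLip dom one (fun alpha c y => alpha%:C * (ws eps c y * gs eps c y)).
Proof.
move=> he; have [HA HB] := BLip_AB; have Hw := BLip_ws he.
have H := BLipB (BLipB (BLipM1 (BLipM1 HB Hw) (BLip_alpha_lg he)) (BLipM1 BLip_alpha HA))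
  (BLipM1 (BLipM1 BLip_alpha Hw) (BLip_Glim he)).
apply: (BLip_ext H) => a c y d y0.
have w1 : ws eps c y != 0 by rewrite -nrm_gt0 (ws_gt0 _ _ d).
by rewrite /gs /Glim [Gz c (seg _ _)]/Gz -/(ws eps c y); field.
Qed.

Lemma UB_wg eps : side eps -> UB dom one (fun alpha c y => ws eps c y * gs eps c y).
Proof.
move=> he; have [HA HB] := BLip_AB; have Hw := BLip_UB (BLip_ws he).
have [M M0 H] := UBB (UBB (UBM (BLip_UB HB) (UB_ws_lg he)) (BLip_UB HA))
  (UBM Hw (BLip_UB (BLip_Glim he))).
exists M => // a c d y y0; apply: le_trans (H a c d y y0).
have w1 : ws eps c y != 0 by rewrite -nrm_gt0 (ws_gt0 _ _ d).
rewrite le_eqVlt; apply/orP; left; apply/eqP; congr nrm.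
by rewrite /gs /Glim [Gz c (seg _ _)]/Gz -/(ws eps c y); field.
Qed.

Lemma UB_alpha_g eps : side eps -> UB dom one (fun alpha c y => alpha%:C * gs eps c y).
Proof.
move=> he; have [M M0 H] := UBM (UB_wg he) (UB_alpha_ws eps).
exists M => // a c d y y0; apply: le_trans (H a c d y y0).
have w1 : ws eps c y != 0 by rewrite -nrm_gt0 (ws_gt0 _ _ d).
rewrite le_eqVlt; apply/orP; left; apply/eqP; congr nrm.
by field.
Qed.

Lemma BLip_alpha2_g eps : side eps ->
  BLip dom one (fun alpha c y => alpha%:C ^+ 2 * gs eps c y).
Proof.
move=> he; have [HA HB] := BLip_AB.
have H := BLipB (BLipB (BLipM1 (BLipM1 HB BLip_alpha) (BLip_alpha_lg he))
    (BLipM1 HA (BLip_alpha2_ws eps)))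
  (BLipM1 (BLip_sqr BLip_alpha) (BLip_Glim he)).
apply: (BLip_ext H) => a c y d y0.
have w1 : ws eps c y != 0 by rewrite -nrm_gt0 (ws_gt0 _ _ d).
by rewrite /gs /Glim [Gz c (seg _ _)]/Gz -/(ws eps c y); field.
Qed.

(** [qs] is the derivative of [(z - c)^2 (Gz c z - Gz c eps)] in [z]. *)
Definition qs eps c y : R[i] :=
  2 * (ws eps c y * gs eps c y) + Acoef c + Bcoef c * ws eps c y.

Lemma BLip_alpha_qs eps : side eps -> BLip dom one (fun alpha c y => alpha%:C * qs eps c y).
Proof.
move=> he; have [HA HB] := BLip_AB.
have H := BLipD (BLipD (BLipM1 (BLip_cst dom 2) (BLip_alpha_wg he)) (BLipM1 BLip_alpha HA))
  (BLipM1 (BLipM1 BLip_alpha HB) (BLip_ws he)).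
by apply: (BLip_ext H) => a c y d y0; rewrite /qs; ring.
Qed.

Lemma UB_qs eps : side eps -> UB dom one (fun alpha c y => qs eps c y).
Proof.
move=> he; have [HA HB] := BLip_AB.
exact: (UBD (UBD (UBM (BLip_UB (BLip_cst dom 2)) (UB_wg he)) (BLip_UB HA))
  (UBM (BLip_UB HB) (BLip_UB (BLip_ws he)))).
Qed.

Definition phis eps c z : R[i] := ((eps * z)%:C - c) ^+ 2 * (Gz c (eps * z) - Gz c eps).

Lemma dC_phis eps alpha c z : side eps -> dom alpha c -> z <= 1 ->
  dC (phis eps c) z (eps%:C * qs eps c z).
Proof.
move=> he d z1; have ic := Imp d.
have ds : is_derive z 1 (fun s : R => eps * s) eps.
  by apply: (is_derive_eqf (is_deriveZ eps (is_derive_id z 1))) => //; rewrite /GRing.scale /= mulr1.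
have dw := dCB (dC_real ds) (dC_cst c z).
have dg := dCB (dC_Gz ic ds) (dC_cst (Gz c eps) z).
apply: (dC_eqf (dCM (dCM dw dw) dg)) => //.
move: (sub_neq0 (eps * z) ic); rewrite /qs /gs /ws segE //.
by move: ((eps * z)%:C - c) (Gz c (eps * z)) => w g w0; field.
Qed.

Local Notation om := (edecay 2).

Lemma tanh_01 y : 0 <= y -> 0 <= tanh y <= 1.
Proof. by move=> y0; rewrite tanh_ge0 // ltW // tanh_lt1. Qed.

Lemma phisE eps c y : side eps -> 0 <= y ->
  phis eps c (tanh y) = wf (@tanh R) eps c y ^+ 2 * (Gz c (seg eps (tanh y)) - Gz c eps).
Proof.
by move=> he y0; rewrite /phis /wf tanh_side // segE //; case/andP: (tanh_01 y0).
Qed.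

Lemma gfE eps c y : side eps -> 0 <= y -> gf Gtanh Glim eps c y = eps%:C * gs eps c (tanh y).
Proof.
move=> he y0; rewrite /gf /Gtanh /Glim /gs tanh_side // segE //.
by case/andP: (tanh_01 y0).
Qed.

Lemma phis_end eps c : phis eps c 1 = 0.
Proof. by rewrite /phis mulr1 subrr mulr0. Qed.

(** As a function of [z], [w^2 g] vanishes at [z = eps] and has the bounded
    derivative [qs]; the distance [1 - tanh y] to the end point decays like
    [om]. *)
Lemma UB_phi eps : side eps ->
  UB dom om (fun alpha c y => wf (@tanh R) eps c y ^+ 2 * gs eps c (tanh y)).
Proof.
move=> he; have [M M0 H] := UB_qs he.
exists (4 * M); first by rewrite mulr_ge0.
move=> a c d y y0; have /andP[t0 t1] := tanh_01 y0.
rewrite -phisE //.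
have -> : phis eps c (tanh y) = - (phis eps c 1 - phis eps c (tanh y)).
  by rewrite phis_end sub0r opprK.
rewrite nrmN.
have := mvt_nrm t1 (fun s hs => dC_phis he d (proj2 (andP hs))) (B := M).
have bd s : tanh y <= s <= 1 -> nrm (eps%:C * qs eps c s) <= M.
  move=> /andP[s0 s1]; rewrite nrmM nrmR.
  have -> : `|eps| = 1 by case: he => ->; rewrite ?normrN normr1.
  by rewrite mul1r (le_trans (H a c d s (le_trans t0 s0))) // mulr1.
move=> /(_ bd) /le_trans; apply; have /andP[_ h] := tanh_tail y0.
have -> : 4 * M * om y = 2 * M * (2 * om y) by ring.
by rewrite ler_wpM2l // mulr_ge0.
Qed.

Lemma BLip_alpha_phi eps : side eps ->
  BLip dom om (fun alpha c y => alpha%:C * (wf (@tanh R) eps c y ^+ 2 * gs eps c (tanh y))).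
Proof.
move=> he; have [M M0 H] := BLip_alpha_qs he; have [N N0 HN] := UB_phi he.
exists (4 * M + N); first by rewrite addr_ge0 // mulr_ge0.
move=> a c d; have /andP[a0 a1] := dom_alpha d; split => [y y0|c' d' y y0].
  rewrite nrmM nrmR gtr0_norm // (le_trans (y := 1 * (N * om y))) //.
    by rewrite ler_pM ?nrm_ge0 ?(HN a c d y y0) ?(ltW a0).
  by rewrite mul1r ler_wpM2r ?edecay_ge0 // lerDr mulr_ge0.
have /andP[t0 t1] := tanh_01 y0.
rewrite -!phisE //.
have df s (hs : tanh y <= s <= 1) := dCB (dCZ a%:C (dC_phis he d (proj2 (andP hs))))
  (dCZ a%:C (dC_phis he d' (proj2 (andP hs)))).
have := mvt_nrm t1 df (B := M * nrm (c - c')).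
rewrite !phis_end !mulr0 subrr sub0r nrmN.
have bd s : tanh y <= s <= 1 ->
    nrm (a%:C * (eps%:C * qs eps c s) - a%:C * (eps%:C * qs eps c' s)) <= M * nrm (c - c').
  move=> /andP[s0 s1]; rewrite mulrCA [a%:C * (_ * qs eps c' _)]mulrCA -mulrBr nrmM nrmR.
  have -> : `|eps| = 1 by case: he => ->; rewrite ?normrN normr1.
  have [_ h] := H a c d.
  by rewrite mul1r (le_trans (h c' d' s (le_trans t0 s0))) // mulr1.
move=> /(_ bd) /le_trans; apply; have /andP[_ h] := tanh_tail y0.
have h1 : M * nrm (c - c') * (1 - tanh y) <= M * nrm (c - c') * (2 * om y).
  by rewrite ler_wpM2l // mulr_ge0 ?nrm_ge0.
have h2 : 0 <= N * nrm (c - c') * om y by rewrite !mulr_ge0 ?nrm_ge0 ?edecay_ge0.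
by lra.
Qed.

Lemma BLip_HG1 eps : side eps -> BLip dom om
  (fun alpha c y => alpha%:C * (wf (@tanh R) eps c y ^+ 2 * gf Gtanh Glim eps c y)).
Proof.
move=> he; have H := BLipM (edecay_ge0 2) (BLip_alpha_phi he) (BLip_cst dom eps%:C).
by apply: (BLip_ext H) => a c y d y0; rewrite gfE //; ring.
Qed.

Lemma UB_HG1 eps : side eps -> UB dom om
  (fun alpha c y => wf (@tanh R) eps c y ^+ 2 * gf Gtanh Glim eps c y).
Proof.
move=> he; have [M M0 H] := UBM (UB_phi he) (BLip_UB (BLip_cst dom eps%:C)).
exists M => // a c d y y0; apply: le_trans (H a c d y y0).
by rewrite gfE // mulrCA mulrC.
Qed.

Lemma UB_HG2 eps : side eps -> UB dom om
  (fun alpha c y => alpha%:C * (wf (@tanh R) eps c y ^+ 2 * gf Gtanh Glim eps c y ^+ 2)).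
Proof.
move=> he; have [M M0 H] := UB_phi he; have [N N0 HN] := UB_alpha_g he.
exists (M * N); first exact: mulr_ge0.
move=> a c d y y0; rewrite gfE // exprMn [eps%:C ^+ 2]expr2 side_sqrC // mul1r.
have -> : a%:C * (wf (@tanh R) eps c y ^+ 2 * gs eps c (tanh y) ^+ 2) =
  (wf (@tanh R) eps c y ^+ 2 * gs eps c (tanh y)) * (a%:C * gs eps c (tanh y)) by ring.
have h1 := H a c d y y0; have h2 := HN a c d (tanh y) (tanh_ge0 y0).
rewrite mulr1 in h2; rewrite (nrmM (_ * gs _ _ _)) [leRHS]mulrAC; apply: ler_pM => //; exact: nrm_ge0.
Qed.

(** The product [alpha^2 w^2 g^2] is estimated as [(w^2 g) * (alpha^2 g)]: the
    first factor is bounded with Lipschitz constant [1 / alpha], the second one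
    is of size [alpha] with a bounded Lipschitz constant. *)
Lemma BLip_HG2 eps : side eps -> BLip dom om
  (fun alpha c y => alpha%:C ^+ 2 * (wf (@tanh R) eps c y ^+ 2 * gf Gtanh Glim eps c y ^+ 2)).
Proof.
move=> he; have [M M0 HM] := BLip_alpha_phi he; have [N N0 HN] := UB_phi he.
have [P P0 HP] := UB_alpha_g he; have [Q Q0 HQ] := BLip_alpha2_g he.
exists (M * P + N * Q); first by rewrite addr_ge0 // mulr_ge0.
pose f c y := wf (@tanh R) eps c y ^+ 2 * gs eps c (tanh y).
pose g c y := gs eps c (tanh y).
have E a c y : 0 <= y ->
    a%:C ^+ 2 * (wf (@tanh R) eps c y ^+ 2 * gf Gtanh Glim eps c y ^+ 2) =
    (a%:C * f c y) * (a%:C * g c y).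
  by move=> y0; rewrite gfE // exprMn [eps%:C ^+ 2]expr2 side_sqrC // mul1r /f /g; ring.
move=> a c d; split => [y y0|c' d' y y0]; rewrite !E //.
  have [h1 _] := HM a c d; have h2 := HP a c d (tanh y) (tanh_ge0 y0).
  rewrite nrmM (le_trans (y := M * om y * P)) //.
    by rewrite ler_pM ?nrm_ge0 ?h1 // (le_trans h2) // mulr1.
  by rewrite mulrAC ler_wpM2r ?edecay_ge0 // lerDl mulr_ge0.
have -> : a%:C * f c y * (a%:C * g c y) - a%:C * f c' y * (a%:C * g c' y) =
  (a%:C * f c y - a%:C * f c' y) * (a%:C * g c y)
  + f c' y * (a%:C ^+ 2 * g c y - a%:C ^+ 2 * g c' y) by ring.
have -> : (M * P + N * Q) * nrm (c - c') * om y =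
  (M * nrm (c - c') * om y) * P + (N * om y) * (Q * nrm (c - c')) by ring.
have [_ h1] := HM a c d; have h2 := HP a c d (tanh y) (tanh_ge0 y0).
have [_ h3] := HQ a c d; have h4 := HN a c' d' y y0.
rewrite (le_trans (nrmD _ _)) // lerD //.
  rewrite nrmM ler_pM ?nrm_ge0 //; first exact: h1.
  by rewrite (le_trans h2) // mulr1.
rewrite (nrmM (f c' y)) ler_pM ?nrm_ge0 //.
by rewrite (le_trans (h3 c' d' _ (tanh_ge0 y0))) // mulr1.
Qed.

Lemma htanh_sub eps c y : side eps -> 1 - c != 0 -> 1 + c != 0 ->
  htanh c (eps * y) - winf eps c ^- 2 =
    (2^-1 * ((1 - c)^-1 ^+ 2 - (1 + c)^-1 ^+ 2)) * ((tanh (eps * y))%:C - eps%:C).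
Proof.
move=> he n1 n2; rewrite /htanh /winf.
have n4 : -1 - c != 0 by rewrite -opprD oppr_eq0.
by case: he => ->; rewrite ?rmorphN rmorph1; field; rewrite ?n1 ?n2 ?n4.
Qed.

Lemma BLip_Hh eps : side eps -> BLip dom om
  (fun _ c y => htanh c (eps * y) - winf eps c ^- 2).
Proof.
move=> he; have H1 := BLip_1DV b01 dom_b side1; have H2 := BLip_1DV b01 dom_b sideN1.
have [_ _ _ [_ _ _ tail]] := @tanh_regular R.
have Ht : BLip dom om (fun _ _ y => (tanh (eps * y))%:C - eps%:C).
  apply: (BLip_fun dom (edecay_ge0 2) (ler0n R 2)) => y y0.
  by rewrite -rmorphB nrmR tail.
have H := BLipM (edecay_ge0 2) Ht (BLipM1 (BLip_cst dom 2^-1) (BLipB (BLip_sqr H2) (BLip_sqr H1))).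
apply: (BLip_ext H) => a c y d y0.
rewrite htanh_sub ?(dom_1B_neq0 b01 dom_b d) ?(dom_1D_neq0 b01 dom_b d) //.
by rewrite rmorphN rmorph1 mul1r mulN1r mulrC.
Qed.

End CriticalLayer.
(** * Expansion of the scalar equation at a real root *)

Section Near.
Context {R : realType} (dom : R -> R[i] -> Prop) (c0 : R[i]).
Implicit Types (f g : R -> R[i] -> R[i]) (k l : R[i]).
Hypotheses (dom_alpha : forall alpha c, dom alpha c -> 0 < alpha <= 1)
  (dom_c0 : forall alpha c, dom alpha c -> nrm (c - c0) <= 1).

(** [f = l + O(alpha + |c - c0|)]; like [BLip], this is stable under the field
    operations. *)
Definition approx f l : Prop := exists2 M, 0 <= M & forall alpha c, dom alpha c ->
  nrm (f alpha c - l) <= M * (alpha + nrm (c - c0)).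

Let e_ge0 alpha c : dom alpha c -> 0 <= alpha + nrm (c - c0).
Proof. by move=> /dom_alpha/andP[/ltW a0 _]; rewrite addr_ge0 ?nrm_ge0. Qed.

Let e_le2 alpha c : dom alpha c -> alpha + nrm (c - c0) <= 2.
Proof. by move=> d; have /andP[_ ?] := dom_alpha d; have := dom_c0 d => *; lra. Qed.

Lemma approx_cst l : approx (fun _ _ => l) l.
Proof. by exists 0 => // a c d; rewrite subrr nrm0 mul0r. Qed.

Lemma approx_c (M : R) f l : 0 <= M ->
  (forall alpha c, dom alpha c -> nrm (f alpha c - l) <= M * nrm (c - c0)) -> approx f l.
Proof.
move=> M0 H; exists M => // a c d; rewrite (le_trans (H a c d)) // ler_wpM2l // lerDr.
by have /andP[/ltW] := dom_alpha d.
Qed.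

Lemma approx_id : approx (fun _ c => c) c0.
Proof. by apply: (approx_c ler01) => a c d; rewrite mul1r. Qed.

Lemma approx_D f g k l : approx f k -> approx g l -> approx (fun a c => f a c + g a c) (k + l).
Proof.
move=> [M M0 H] [N N0 K]; exists (M + N); first exact: addr_ge0.
move=> a c d; rewrite opprD addrACA (le_trans (nrmD _ _)) // mulrDl lerD ?H ?K //.
Qed.

Lemma approx_N f k : approx f k -> approx (fun a c => - f a c) (- k).
Proof.
by move=> [M M0 H]; exists M => // a c d; rewrite -opprD nrmN H.
Qed.

Lemma approx_B f g k l : approx f k -> approx g l -> approx (fun a c => f a c - g a c) (k - l).
Proof. by move=> hf hg; apply: approx_D => //; exact: approx_N. Qed.

Lemma approx_M f g k l : approx f k -> approx g l -> approx (fun a c => f a c * g a c) (k * l).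
Proof.
move=> [M M0 H] [N N0 K]; exists (M * (N * 2 + nrm l) + nrm k * N).
  by rewrite addr_ge0 ?mulr_ge0 ?addr_ge0 ?mulr_ge0 ?nrm_ge0.
move=> a c d; have e0 := e_ge0 d; have e2 := e_le2 d.
have -> : f a c * g a c - k * l = (f a c - k) * g a c + k * (g a c - l) by ring.
rewrite (le_trans (nrmD _ _)) // !nrmM mulrDl lerD //; last first.
  by rewrite -mulrA ler_wpM2l ?nrm_ge0 ?K.
rewrite mulrAC ler_pM ?nrm_ge0 ?H // -(subrK l (g a c)) (le_trans (nrmD _ _)) //.
by rewrite lerD2r (le_trans (K a c d)) // ler_wpM2l.
Qed.

Lemma approx_V f l (delta : R) : 0 < delta -> l != 0 ->
  (forall alpha c, dom alpha c -> delta <= nrm (f alpha c)) ->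
  approx f l -> approx (fun a c => (f a c)^-1) l^-1.
Proof.
move=> d0 l0 hd [M M0 H]; exists (M / (delta * nrm l)).
  by rewrite divr_ge0 // mulr_ge0 ?nrm_ge0 // ltW.
have lp : 0 < nrm l by rewrite nrm_gt0.
move=> a c d; have fp := lt_le_trans d0 (hd a c d).
have f0 : f a c != 0 by rewrite -nrm_gt0.
have -> : (f a c)^-1 - l^-1 = - (f a c - l) / (f a c * l) by field; rewrite f0 l0.
rewrite nrmM nrmN nrmV nrmM mulrAC ler_pM ?invr_ge0 ?mulr_ge0 ?nrm_ge0 ?H //.
by rewrite lef_pV2 ?posrE ?mulr_gt0 // ler_pM2r // hd.
Qed.

Lemma approx_X f l n : approx f l -> approx (fun a c => f a c ^+ n) (l ^+ n).
Proof.
move=> hf; elim: n => [|n ih]; first exact: approx_cst.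
have [M M0 H] := approx_M hf ih; exists M => // a c d; rewrite !exprS; exact: H.
Qed.

End Near.

Section TanhReduction.
Context {R : realType} (m c0 K : R).
Hypotheses (m_gt0 : 0 < m) (c0_01 : 0 <= c0 < 1) (K_gt0 : 0 < K)
  (root : 2 * (1 + c0 ^+ 2) = m ^+ 2 * (1 - c0 ^+ 2) ^+ 2).

(** The value of [correction] for the tanh profile at [alpha = 0], [c = c0]. *)
Definition limit_correction : R[i] :=
  (2 * (1 - c0 ^+ 2))%:C * ((2 * pi * c0) +i* (4 + 2 * c0 * ln ((1 + c0) / (1 - c0)))).

Let p0 : 0 <= c0. Proof. by case/andP: c0_01. Qed.
Let p1 : c0 < 1. Proof. by case/andP: c0_01. Qed.
Let b := (1 + c0) / 2.
Let b01 : 0 <= b < 1. Proof. by apply/andP; rewrite /b; split; have := p0; have := p1 => *; lra. Qed.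
Let b1 : 0 < 1 - b. Proof. by case/andP: b01; rewrite subr_gt0. Qed.
Let rootC : 2 * (1 + c0%:C ^+ 2) = (m ^+ 2)%:C * (1 - c0%:C ^+ 2) ^+ 2 :> R[i].
Proof.
have -> : c0%:C ^+ 2 = (c0 ^+ 2)%:C :> R[i] by rewrite rmorphXn.
move: (c0 ^+ 2) (m ^+ 2) root => S mm root'.
transitivity ((2 * (1 + S))%:C); first by rewrite rmorphM rmorph_nat [X in _ = _ * X]rmorphD rmorph1.
by rewrite root' expr2 !rmorphM rmorphB rmorph1; ring.
Qed.
Let Ce := (16 + 32 * m ^+ 2) / (1 - b) ^+ 4.
Let Ce0 : 0 <= Ce.
Proof.
apply: divr_ge0; first by have := sqr_ge0 m => *; lra.
by rewrite exprn_ge0 // ltW.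
Qed.
Let b2 : 0 < 1 - b ^+ 2.
Proof. by case/andP: b01 => ? ?; rewrite subr_gt0 expr_lt1. Qed.

Definition dist_max : R := Num.min ((1 - c0) / 2) ((1 - b ^+ 2) / 4 / (Ce + 1)).

Lemma dist_max_gt0 : 0 < dist_max.
Proof.
rewrite lt_min; apply/andP; split; first by have := p1 => *; lra.
by rewrite divr_gt0 ?ltr_wpDl // divr_gt0.
Qed.

Definition tanh_dom (alpha : R) (c : R[i]) : Prop :=
  [/\ 0 < alpha <= 1, nrm (c - c0%:C) <= dist_max & alpha <= K * cIm c].
Local Notation dom := tanh_dom.
Local Notation om := (edecay 2).

Let dom_alpha alpha c : dom alpha c -> 0 < alpha <= 1. Proof. by case. Qed.
Let dom_im alpha c : dom alpha c -> alpha <= K * cIm c. Proof. by case. Qed.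
Let nc0 : nrm (c0%:C : R[i]) = c0. Proof. by rewrite nrmR ger0_norm. Qed.
Let dom_dist alpha c : dom alpha c -> nrm (c - c0%:C) <= (1 - c0) / 2.
Proof. by case=> _ h _; rewrite (le_trans h) // ge_min lexx. Qed.
Let dom_b alpha c : dom alpha c -> nrm c <= b.
Proof.
move=> /dom_dist h; have := nrmD (c - c0%:C) c0%:C; rewrite subrK nc0 => hh.
by rewrite /b; lra.
Qed.
Let c0b : nrm (c0%:C : R[i]) <= b. Proof. by rewrite nc0 /b; have := p1 => *; lra. Qed.
Let dom_near alpha c eps : dom alpha c -> side eps ->
  nrm (eta m eps c) <= Ce * nrm (c - c0%:C).
Proof. by move=> d he; exact: eta_near b01 (dom_b d) c0b he rootC. Qed.
Let dom_eta alpha c eps : dom alpha c -> side eps -> nrm (eta m eps c) <= (1 - b ^+ 2) / 4.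
Proof.
move=> d he; rewrite (le_trans (dom_near d he)) //; case: d => _ h _.
apply: (le_trans (ler_wpM2l Ce0 h)).
apply: (le_trans (y := (Ce + 1) * dist_max)).
  by rewrite ler_wpM2r ?(ltW dist_max_gt0) // lerDl.
by rewrite -ler_pdivlMl ?ltr_wpDl // mulrC ge_min lexx orbT.
Qed.
Let dom1 alpha c : dom alpha c -> nrm (c - c0%:C) <= 1.
Proof. by move=> /dom_dist h; have := p0 => *; lra. Qed.
Let Imp alpha c : dom alpha c -> 0 < cIm c := @dom_Im_gt0 _ _ _ K_gt0 dom_alpha dom_im alpha c.
Let n1 alpha c (d : dom alpha c) : 1 - c != 0 := dom_1B_neq0 b01 dom_b d.
Let n2 alpha c (d : dom alpha c) : 1 + c != 0 := dom_1D_neq0 b01 dom_b d.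
Local Notation nearly := (approx dom c0%:C).

Let q1 : 1 - c0%:C != 0 :> R[i].
Proof. by rewrite -(rmorph1 (real_complex R)) -rmorphB -nrm_gt0 nrmR normr_gt0 subr_eq0 gt_eqF. Qed.
Let q2 : 1 + c0%:C != 0 :> R[i].
Proof.
by rewrite -(rmorph1 (real_complex R)) -rmorphD -nrm_gt0 nrmR normr_gt0 gt_eqF // ltr_wpDr.
Qed.

Let lo1 alpha c : dom alpha c -> 1 - b <= nrm (1 - c).
Proof. by move=> d; have := nrm_1D_ge dom_b d sideN1; rewrite rmorphN rmorph1 mulN1r. Qed.
Let lo2 alpha c : dom alpha c -> 1 - b <= nrm (1 + c).
Proof. by move=> d; have := nrm_1D_ge dom_b d side1; rewrite rmorph1 mul1r. Qed.

Lemma approx_1BV : nearly (fun _ c => (1 - c)^-1) (1 - c0%:C)^-1.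
Proof.
apply: (approx_V b1 q1) => [a c d|]; first exact: lo1 d.
exact: (approx_B (approx_cst dom c0%:C 1) (approx_id c0%:C dom_alpha)).
Qed.

Lemma approx_1DV : nearly (fun _ c => (1 + c)^-1) (1 + c0%:C)^-1.
Proof.
apply: (approx_V b1 q2) => [a c d|]; first exact: lo2 d.
exact: (approx_D (approx_cst dom c0%:C 1) (approx_id c0%:C dom_alpha)).
Qed.

Lemma approx_sheet eps : side eps -> nearly (fun _ c => sheet_root m eps c) 1.
Proof.
move=> he; apply: (approx_c dom_alpha Ce0) => a c d.
rewrite (le_trans _ (dom_near d he)) //; apply: sqrt1D_near1.
by rewrite (le_trans (dom_eta d he)) //; have := sqr_ge0 b => *; lra.
Qed.

Lemma approx_A : nearly (fun _ c => Acoef c) (Acoef c0%:C).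
Proof.
have [M M0 H] := approx_M dom_alpha dom1 approx_1BV approx_1DV; exists M => // a c d.
apply: le_trans (H a c d); rewrite le_eqVlt; apply/orP; left; apply/eqP; congr nrm.
rewrite /Acoef; have h1 := n1 d; have h2 := n2 d.
by field; rewrite h1 h2 q1 q2 !one_sub_sqr_neq0.
Qed.

Lemma approx_rhoi2 eps : side eps -> nearly (fun _ c => rhoi m eps c ^+ 2) (- Acoef c0%:C ^+ 2).
Proof.
move=> he; have hA := approx_X dom_alpha dom1 2 approx_A.
have hS := approx_X dom_alpha dom1 2 (approx_sheet he).
have [M M0 H] := approx_N (approx_M dom_alpha dom1 hS hA); exists M => // a c d.
apply: le_trans (H a c d); rewrite le_eqVlt; apply/orP; left; apply/eqP; congr nrm.
rewrite rhoi_sqr side_sqrC // /sheet_root sqr_sqrtc /Acoef -exprVn.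
by ring.
Qed.

(** The branches of the logarithm at the two ends differ by [i * pi] in the
    limit: the path from [-1 - c] to [1 - c] passes below the origin. *)
Lemma approx_lg_jump : nearly (fun _ c => lg (1 - c) - lg (-1 - c))
  (ln ((1 - c0) / (1 + c0)) +i* pi).
Proof.
apply: (approx_c dom_alpha (M := 4 / (1 - b))); first by rewrite divr_ge0 // ltW.
move=> a c d; have ic := Imp d; have hd := dom_dist d.
have ri := ler_Re_nrm (c - c0%:C); have ii := ler_Im_nrm (c - c0%:C).
rewrite cReB /= in ri; rewrite cImB /= subr0 in ii.
set e := nrm (c - c0%:C) in hd ri ii *.
have e0 : 0 <= e := nrm_ge0 _.
have {}ii : cIm c <= e by move: ii; rewrite gtr0_norm.
have r1 : 1 - b <= 1 - cRe c.
  by rewrite lerD2l lerN2 (le_trans (ler_norm _)) // (le_trans (ler_Re_nrm _)) // (dom_b d).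
have r2 : 1 - b <= 1 + cRe c.
  rewrite lerD2l lerNl (le_trans (ler_norm _)) // normrN (le_trans (ler_Re_nrm _)) //.
  exact: dom_b d.
have s1 : 1 - b <= 1 - c0 by rewrite /b; have := p1 => *; lra.
have s2 : 1 - b <= 1 + c0 by rewrite /b; have := p0 => *; lra.
have lgE (z : R[i]) : z != 0 -> cRe (lg z) = ln (nrm z).
  by rewrite -nrm_gt0 => np; rewrite /= -nrm_sqr expr2 lnM ?posrE //; field.
have e1 : cRe (lg (1 - c)) = ln (nrm (1 - c)) := lgE _ (n1 d).
have e2 : cRe (lg (-1 - c)) = ln (nrm (1 + c)).
  by rewrite -(nrmN (1 + c)) opprD lgE // -opprD oppr_eq0 (n2 d).
have d1 : `|ln (nrm (1 - c)) - ln (1 - c0)| <= e / (1 - b).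
  rewrite (le_trans (ln_dist b1 (lo1 d) s1)) // ler_pM2r ?invr_gt0 //.
  have -> : 1 - c0 = nrm ((1 - c0%:C) : R[i]).
    rewrite -(rmorph1 (real_complex R)) -rmorphB nrmR ger0_norm // subr_ge0 ltW //.
  have h1 := nrm_subr_ge (1 - c) (1 - c0%:C); have h2 := nrm_subr_ge (1 - c0%:C) (1 - c).
  have h3 : 1 - c - (1 - c0%:C) = - (c - c0%:C) by ring.
  have h4 : 1 - c0%:C - (1 - c) = c - c0%:C by ring.
  by rewrite h3 nrmN in h1; rewrite h4 in h2; rewrite ler_norml; apply/andP; split; rewrite -/e in h1 h2 *; lra.
have d2 : `|ln (nrm (1 + c)) - ln (1 + c0)| <= e / (1 - b).
  rewrite (le_trans (ln_dist b1 (lo2 d) s2)) // ler_pM2r ?invr_gt0 //.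
  have -> : 1 + c0 = nrm ((1 + c0%:C) : R[i]).
    rewrite -(rmorph1 (real_complex R)) -rmorphD nrmR ger0_norm // addr_ge0 //.
  have h1 := nrm_subr_ge (1 + c) (1 + c0%:C); have h2 := nrm_subr_ge (1 + c0%:C) (1 + c).
  have h3 : 1 + c - (1 + c0%:C) = c - c0%:C by ring.
  have h4 : 1 + c0%:C - (1 + c) = - (c - c0%:C) by ring.
  by rewrite h3 in h1; rewrite h4 nrmN in h2; rewrite ler_norml; apply/andP; split; rewrite -/e in h1 h2 *; lra.
have t1 : 0 < (1 - cRe c) / cIm c by rewrite divr_gt0 // (lt_le_trans b1).
have t2 : 0 < (1 + cRe c) / cIm c by rewrite divr_gt0 // (lt_le_trans b1).
have i1 : cIm (lg (1 - c)) = atan ((1 - cRe c) / cIm c) - pi / 2.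
  by rewrite /lg /= cReB cImB /= sub0r opprK.
have i2 : cIm (lg (-1 - c)) = - atan ((1 + cRe c) / cIm c) - pi / 2.
  rewrite /lg /= cReB cImB /= oppr0 sub0r opprK -atanN; congr (atan _ - _).
  by field; rewrite gt_eqF.
have u1 := atan_compl t1; have u2 := atan_compl t2.
have v1 : ((1 - cRe c) / cIm c)^-1 <= e / (1 - b).
  rewrite invf_div ler_pM ?invr_ge0 ?(ltW ic) ?(le_trans (ltW b1)) //.
  by rewrite lef_pV2 ?posrE // (lt_le_trans b1).
have v2 : ((1 + cRe c) / cIm c)^-1 <= e / (1 - b).
  rewrite invf_div ler_pM ?invr_ge0 ?(ltW ic) ?(le_trans (ltW b1)) //.
  by rewrite lef_pV2 ?posrE // (lt_le_trans b1).
rewrite (le_trans (ler_nrm_ReIm _)) // !cReB !cImB e1 e2 i1 i2 /=.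
rewrite ln_div ?posrE ?subr_gt0 // ?ltr_wpDr //.
have -> : 4 / (1 - b) * e = 2 * (e / (1 - b)) + 2 * (e / (1 - b)) by ring.
move: d1 d2 u1 u2 v1 v2; move: (e / (1 - b)) => t.
move: (ln (nrm (1 - c))) (ln (1 - c0)) (ln (nrm (1 + c))) (ln (1 + c0)) => A1 A2 A3 A4.
move: (atan ((1 - cRe c) / cIm c)) (atan ((1 + cRe c) / cIm c)) => B1 B2.
move: ((1 - cRe c) / cIm c)^-1 ((1 + cRe c) / cIm c)^-1 => B3 B4.
rewrite !ler_norml => /andP[? ?] /andP[? ?] /andP[? ?] /andP[? ?] ? ?.
by apply: lerD; rewrite ler_norml; apply/andP; split; lra.
Qed.

Lemma approx_Glim_jump : nearly (fun _ c => Glim 1 c - Glim (-1) c)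
  (Bcoef c0%:C * (ln ((1 - c0) / (1 + c0)) +i* pi) - 2 * Acoef c0%:C ^+ 2).
Proof.
have hA2 := approx_X dom_alpha dom1 2 approx_A.
have hc := approx_id c0%:C dom_alpha.
have hB := approx_M dom_alpha dom1 (approx_M dom_alpha dom1 (approx_cst dom c0%:C 2) hc) hA2.
have [M M0 H] := approx_B (approx_M dom_alpha dom1 hB approx_lg_jump) (approx_M dom_alpha dom1 (approx_cst dom c0%:C 2) hA2).
exists M => // a c d; apply: le_trans (H a c d).
rewrite le_eqVlt; apply/orP; left; apply/eqP; congr nrm.
have h1 := n1 d; have h2 := n2 d; have h3 := one_sub_sqr_neq0 h1 h2.
have h4 : -1 - c != 0 by rewrite -opprD oppr_eq0.
rewrite /Glim /Gz rmorphN rmorph1 -/(Bcoef c) -/(Bcoef c0%:C); congr (_ - _).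
have -> : Acoef c / (1 - c) = Acoef c ^+ 2 * (1 + c) by rewrite /Acoef; field; rewrite h1 h3.
have -> : Acoef c / (-1 - c) = - (Acoef c ^+ 2 * (1 - c)).
  by rewrite /Acoef; field; rewrite h4 h3.
by ring.
Qed.

Definition F0rem eps (alpha : R) (c : R[i]) y : R[i] :=
  wf (@tanh R) eps c y ^+ 2 * gf Gtanh Glim eps c y * (2 * rhoi m eps c)
  + alpha%:C * (wf (@tanh R) eps c y ^+ 2 * gf Gtanh Glim eps c y ^+ 2).

Local Notation F0 := (F0f m (@tanh R) Gtanh htanh Glim).
Local Notation F1 := (F1f m (@tanh R) Gtanh Glim).
Local Notation F2 := (F2f (@tanh R)).

(** In the sum of the two forcing terms the smooth remainders [htanh] cancel. *)
Lemma F0_sum (alpha : R) (c : R[i]) y : dom alpha c ->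
  F0 1 alpha c y + F0 (-1) alpha c y
  = (dtanh y)%:C * (rhoi m 1 c ^+ 2 + rhoi m (-1) c ^+ 2)
    - (1 - tanh y)%:C * (2 * c * (rhoi m 1 c ^+ 2 - rhoi m (-1) c ^+ 2))
    - alpha%:C * (F0rem 1 alpha c y + F0rem (-1) alpha c y).
Proof.
move=> d; rewrite /F0rem /F0f !htanh_sub ?(n1 d) ?(n2 d) //; [|exact: sideN1|exact: side1].
move: (gf _ _ 1 c y) (gf _ _ (-1) c y) (rhoi m 1 c) (rhoi m (-1) c) => g1 g2 r1 r2.
rewrite /wf /winf mul1r mulN1r tanhN /dtanh !rmorphB !rmorphN rmorphXn rmorph1.
by ring.
Qed.

Let BLip_wt eps : side eps -> BLip dom one (fun _ c y => wf (@tanh R) eps c y).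
Proof. by have [_ _ _ [t _ _ _]] := @tanh_regular R; exact: BLip_wf b01 dom_b (ler0n R 2) t eps. Qed.

Let BLip_rho eps : side eps -> BLip dom one (fun _ c _ => rhoi m eps c).
Proof. exact: BLip_rhoi b01 dom_b dom_eta eps. Qed.

Lemma UB_F0rem eps : side eps -> UB dom om (fun alpha c y => F0rem eps alpha c y).
Proof.
move=> he; apply: UBD; last exact: UB_HG2 b01 K_gt0 dom_alpha dom_b dom_im eps he.
apply: (UBM (UB_HG1 b01 K_gt0 dom_alpha dom_b dom_im he)).
exact: (UBM (BLip_UB (BLip_cst dom 2)) (BLip_UB (BLip_rho he))).
Qed.

Lemma UB_F1 eps : side eps -> UB dom one (fun alpha c y => F1 eps alpha c y).
Proof.
move=> he; apply: UBN; apply: UBD.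
  apply: (UBM (BLip_UB (BLip_cst dom 2))).
  exact: (UBM (BLip_UB (BLip_sqr (BLip_wt he))) (BLip_UB (BLip_rho he))).
apply: (UBM (BLip_UB (BLip_cst dom 2))).
apply: (BLip_UB (BLip_one (om := om) _ (BLip_HG1 b01 K_gt0 dom_alpha dom_b dom_im he))).
by move=> y y0; exact: om_itv.
Qed.

Lemma UB_F2 eps : side eps -> UB dom one (fun alpha c y => F2 eps alpha c y).
Proof. by move=> he; exact: (UBN (BLip_UB (BLip_sqr (BLip_wt he)))). Qed.

(** First-order expansion of the half-line solutions.  Up to errors of relative
    size [alpha + |c - c0|] the forcing is [- 2 Acoef^2 (1 - tanh^2)], whose
    integral is elementary. *)
Lemma half_line_sum (B : R) : 0 <= B -> exists2 M, 0 <= M &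
  forall alpha c (X1 X2 : R -> R[i]), dom alpha c ->
    riccati 2 alpha (F0 1 alpha c) (F1 1 alpha c) (F2 1 alpha c) X1 ->
    riccati 2 alpha (F0 (-1) alpha c) (F1 (-1) alpha c) (F2 (-1) alpha c) X2 ->
    (forall y, 0 <= y -> nrm (X1 y) <= B * alpha * om y) ->
    (forall y, 0 <= y -> nrm (X2 y) <= B * alpha * om y) ->
    nrm ((X1 0 + X2 0) / alpha%:C - 2 * Acoef c0%:C ^+ 2)
      <= M * (alpha + nrm (c - c0%:C)).
Proof.
move=> B0; set k := - Acoef c0%:C ^+ 2 + - Acoef c0%:C ^+ 2.
have [Ma Ma0 Ha] := approx_D (approx_rhoi2 side1) (approx_rhoi2 sideN1).
have [Mb Mb0 Hb] := approx_M dom_alpha dom1 (approx_M dom_alpha dom1 (approx_cst dom c0%:C 2) (approx_id c0%:C dom_alpha))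
  (approx_B (approx_rhoi2 side1) (approx_rhoi2 sideN1)).
have [Mr Mr0 Hr] := UBD (UB_F0rem side1) (UB_F0rem sideN1).
have [M1 M10 H1] := UB_F1 side1; have [M1' M10' H1'] := UB_F1 sideN1.
have [M2 M20 H2] := UB_F2 side1; have [M2' M20' H2'] := UB_F2 sideN1.
pose MD := 4 * Ma + 2 * Mb + Mr + (M1 * B + M2 * B) + (M1' * B + M2' * B).
have MD0 : 0 <= MD by rewrite !addr_ge0 // !mulr_ge0.
exists MD => // alpha c X1 X2 d [dX1 bX1] [dX2 bX2] sX1 sX2.
have /andP[a0 a1] := dom_alpha d.
set e := alpha + nrm (c - c0%:C).
have ae : alpha <= e by rewrite lerDl nrm_ge0.
have e0 : 0 <= e := le_trans (ltW a0) ae.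
pose S y := X1 y + X2 y - alpha%:C * k * ((tanh y)%:C - 1).
pose D y := (F0 1 alpha c y + F0 (-1) alpha c y - (dtanh y)%:C * k)
  + (F1 1 alpha c y * X1 y + F2 1 alpha c y * X1 y ^+ 2)
  + (F1 (-1) alpha c y * X2 y + F2 (-1) alpha c y * X2 y ^+ 2).
have dS (y : R) : 0 <= y -> dC S y (alpha%:C * D y).
  move=> y0; apply: (dC_eqf (dCB (dCD (dX1 y y0) (dX2 y y0)) (dCZ (alpha%:C * k)
    (dCB (dC_real (is_derive_tanh y)) (dC_cst 1 y))))) => //.
  by rewrite /D /dtanh; ring.
have bT (F1v F2v X : R[i]) (N1 N2 w : R) : 0 <= w <= 1 -> 0 <= N1 -> 0 <= N2 ->
    nrm F1v <= N1 -> nrm F2v <= N2 -> nrm X <= w -> nrm X <= B * alpha * w ->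
    nrm (F1v * X + F2v * X ^+ 2) <= (N1 * B + N2 * B) * (alpha * w).
  move=> /andP[w0 w1] N10 N20 h1 h2 h3 h4; rewrite (le_trans (nrmD _ _)) // mulrDl lerD //.
    by rewrite nrmM -mulrA mulrA -(mulrA N1) ler_pM ?nrm_ge0 // mulrA.
  rewrite nrmM -mulrA ler_pM ?nrm_ge0 // expr2 nrmM.
  apply: (le_trans (y := B * alpha * w * 1)); last by rewrite mulr1 mulrA.
  by rewrite ler_pM ?nrm_ge0 // (le_trans h3).
have bD y : 0 <= y -> nrm (D y) <= MD * e * om y.
  move=> y0; have w01 := om_itv (ltr0n R 2) y0; have /andP[w0 w1] := w01.
  have /andP[t0 t1] := tanh_tail y0.
  have ao : alpha * om y <= e * om y by rewrite ler_wpM2r.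
  have unw (M x : R) : x <= M * one y -> x <= M by rewrite /one mulr1.
  have h1 := bT _ _ _ _ _ _ w01 M10 M20 (unw _ _ (H1 alpha c d y y0)) (unw _ _ (H2 alpha c d y y0))
    (bX1 y y0) (sX1 y y0).
  have h2 := bT _ _ _ _ _ _ w01 M10' M20' (unw _ _ (H1' alpha c d y y0)) (unw _ _ (H2' alpha c d y y0))
    (bX2 y y0) (sX2 y y0).
  have h3 : nrm (F0 1 alpha c y + F0 (-1) alpha c y - (dtanh y)%:C * k)
      <= (4 * Ma + 2 * Mb + Mr) * e * om y.
    rewrite F0_sum //.
    have -> : forall p q r s : R[i], p * q - r - s - p * k = p * (q - k) - r - s by move=> *; ring.
    rewrite (le_trans (nrmB _ _)) //.
    have -> : (4 * Ma + 2 * Mb + Mr) * e * om y =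
      (4 * om y) * (Ma * e) + (2 * om y) * (Mb * e) + e * (Mr * om y) by ring.
    rewrite lerD //; last first.
      rewrite nrmM nrmR gtr0_norm // ler_pM ?nrm_ge0 ?(ltW a0) //.
      exact: Hr.
    rewrite (le_trans (nrmB _ _)) // lerD //.
      rewrite nrmM nrmR ler_pM ?nrm_ge0 //; last exact: Ha.
      have tn := tanh_norm y; rewrite ler_norml in tn; case/andP: tn => tn1 tn2.
      rewrite /dtanh ger0_norm; last by nra.
      by nra.
    rewrite nrmM nrmR ler_pM ?nrm_ge0 ?ger0_norm //.
    have := Hb alpha c d; rewrite subrr mulr0 subr0; exact.
  rewrite (le_trans (nrmD _ _)) // /MD.
  have -> : (4 * Ma + 2 * Mb + Mr + (M1 * B + M2 * B) + (M1' * B + M2' * B)) * e * om y =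
    (4 * Ma + 2 * Mb + Mr) * e * om y + (M1 * B + M2 * B) * (e * om y)
    + (M1' * B + M2' * B) * (e * om y) by ring.
  apply: lerD.
    apply: le_trans (nrmD _ _) _; apply: lerD => //.
    by rewrite (le_trans h1) // ler_wpM2l // addr_ge0 // mulr_ge0.
  by rewrite (le_trans h2) // ler_wpM2l // addr_ge0 // mulr_ge0.
have K0 : 0 <= 2 + 2 * nrm k by rewrite addr_ge0 // mulr_ge0 ?nrm_ge0.
have bS y : 0 <= y -> nrm (S y) <= (2 + 2 * nrm k) * om y.
  move=> y0; have /andP[t0 t1] := tanh_tail y0.
  rewrite (le_trans (nrmB _ _)) // mulrDl lerD //.
    by rewrite (le_trans (nrmD _ _)) // mulr_natl mulr2n lerD ?bX1 ?bX2.
  rewrite !nrmM nrmR gtr0_norm // -(rmorph1 (real_complex R)) -rmorphB nrmR distrC ger0_norm //.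
  have -> : 2 * nrm k * om y = 1 * nrm k * (2 * om y) by ring.
  by rewrite ler_pM ?mulr_ge0 ?nrm_ge0 ?(ltW a0) // ler_pM ?nrm_ge0 ?(ltW a0).
have aD y : 0 <= y -> nrm (alpha%:C * D y) <= alpha * (MD * e) * om y.
  by move=> y0; rewrite nrmM nrmR gtr0_norm // -mulrA ler_pM2l // bD.
have := decay_boundC (ltr0n R 2) K0 dS aD bS (lexx 0).
rewrite edecay0 mulr1 /S tanh0 rmorph0 sub0r.
have aC : alpha%:C != 0 :> R[i] by rewrite -nrm_eq0 nrmR normr_eq0 gt_eqF.
have -> : X1 0 + X2 0 - alpha%:C * k * -1 =
   alpha%:C * ((X1 0 + X2 0) / alpha%:C - 2 * Acoef c0%:C ^+ 2) by rewrite /k; field.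
rewrite nrmM nrmR gtr0_norm //.
have -> : 2 * (alpha * (MD * e)) / 2 = alpha * (MD * e) by field.
by rewrite ler_pM2l.
Qed.

(** The limit of [correction] collects the jump of [Glim] and the contribution
    [2 Acoef^2] of the two half-line solutions.  The imaginary part [pi] of the
    jump of the logarithm, which is the effect of the critical layer, gives its
    real part. *)
Lemma tanh_reduction : exists delta alpha1 M (N : R -> R[i] -> R[i]),
  [/\ 0 < delta, 0 < alpha1, 0 <= M &
  forall alpha c, 0 < alpha <= alpha1 -> nrm (c - c0%:C) <= delta -> alpha <= K * cIm c ->
  [/\ nrm (N alpha c - limit_correction) <= M * (alpha + nrm (c - c0%:C)),
      forall c', nrm (c' - c0%:C) <= delta -> alpha <= K * cIm c' ->
        nrm (N alpha c - N alpha c') <= M * nrm (c - c'),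
      dispersion m c = alpha%:C * N alpha c -> has_mode m (@tanh R) alpha c &
      nrm c <= 1 /\ 0 < cIm c]].
Proof.
have [dU dU1 cU2 [bU bU1 bU2 Uinf]] := @tanh_regular R.
have [|alpha1 [B [x [a1 B0 Hx]]]] := @layer_reduction R dom m b K 2 2 (@tanh R) (@dtanh R) (@ddtanh R)
  Gtanh htanh Glim m_gt0 (ltr0n R 2) b01 K_gt0 dom_alpha dom_b dom_im dom_eta dU dU1 cU2
  (ler0n R 2) bU bU1 bU2 Uinf
  (fun alpha c d y => dC_Gtanh y (Imp d) (n1 d) (n2 d)) (fun _ c _ => cont_htanh c)
  (BLip_Hh b01 dom_b)
  (BLip_HG1 b01 K_gt0 dom_alpha dom_b dom_im) (BLip_HG2 b01 K_gt0 dom_alpha dom_b dom_im).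
  exact: (BLip_Glim b01 K_gt0 dom_alpha dom_b dom_im).
have [Ms Ms0 Hs] := half_line_sum B0.
pose dom' alpha c := dom alpha c /\ alpha <= alpha1.
have dom'_alpha alpha c : dom' alpha c -> 0 < alpha <= 1 by case=> /dom_alpha.
have dom'1 alpha c : dom' alpha c -> nrm (c - c0%:C) <= 1 by case=> /dom1.
have sub f l : nearly f l -> approx dom' c0%:C f l.
  by move=> [M M0 H]; exists M => // a c [d _]; exact: H.
have NRx : approx dom' c0%:C (fun alpha c => (x 1 alpha c 0 + x (-1) alpha c 0) / alpha%:C)
    (2 * Acoef c0%:C ^+ 2).
  exists Ms => // a c [d ha]; have [_ _ _ H] := Hx a c d ha.
  have [r1 s1] := H 1 side1; have [r2 s2] := H (-1) sideN1.
  exact: Hs d r1 r2 s1 s2.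
have hi := approx_cst dom' c0%:C (- 'i%C); have h1 := approx_cst dom' c0%:C 1.
have hq := approx_X dom'_alpha dom'1 3 (approx_B h1 (approx_X dom'_alpha dom'1 2 (approx_id c0%:C dom'_alpha))).
have hS := approx_D (sub _ _ (approx_sheet side1)) (sub _ _ (approx_sheet sideN1)).
have [M M0 HM] := approx_M dom'_alpha dom'1 (approx_M dom'_alpha dom'1
  (approx_M dom'_alpha dom'1 hi (approx_B (sub _ _ approx_Glim_jump) NRx)) hq) hS.
exists dist_max, (Num.min 1 alpha1), (M + B), (correction m Glim x); split.
- exact: dist_max_gt0.
- by rewrite lt_min ltr01.
- exact: addr_ge0.
move=> alpha c /andP[a0]; rewrite le_min => /andP[ha1 ha] hc hK.
have d : dom alpha c by split => //; rewrite a0.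
have [k1 k2 k3 _] := Hx alpha c d ha; split => //.
- have e0 : 0 <= alpha + nrm (c - c0%:C) by rewrite addr_ge0 ?nrm_ge0 // ltW.
  apply: (le_trans (y := M * (alpha + nrm (c - c0%:C)))); last by rewrite ler_wpM2r // lerDl.
  apply: le_trans (HM alpha c (conj d ha)).
  rewrite le_eqVlt; apply/orP; left; apply/eqP; congr (nrm (_ - _)).
  have n3 := one_sub_sqr_neq0 q1 q2.
  rewrite /limit_correction /Acoef /Bcoef.
  set L := ln ((1 + c0) / (1 - c0)).
  have -> : ln ((1 - c0) / (1 + c0)) = - L.
    rewrite /L -lnV ?posrE ?divr_gt0 ?subr_gt0 ?ltr_wpDr ?invf_div //.
  have -> : (- L +i* pi) = 'i%C * pi%:C - L%:C.
    by apply: complex_ext; rewrite /=; ring.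
  have -> : (2 * pi * c0) +i* (4 + 2 * c0 * L) =
     2 * pi%:C * c0%:C + 'i%C * (4 + 2 * c0%:C * L%:C).
    by apply: complex_ext; rewrite /=; ring.
  have -> : (2 * (1 - c0 ^+ 2))%:C = 2 * (1 - c0%:C ^+ 2) :> R[i].
    by apply: complex_ext; rewrite /=; ring.
  set i := 'i%C; have i2 : i ^+ 2 = -1 := sqr_i R.
  transitivity (2 * (1 - c0%:C ^+ 2) * (- i ^+ 2 * (2 * pi%:C * c0%:C) + i * (4 + 2 * c0%:C * L%:C))).
    by rewrite i2 opprK mul1r.
  by field.
- move=> c' hc' hK'; have d' : dom alpha c' by split => //; rewrite a0.
  by rewrite (le_trans (k2 c' d')) // ler_wpM2r ?nrm_ge0 // lerDr.
- split; last exact: Imp d.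
  by rewrite (le_trans (dom_b d)) //; case/andP: b01 => _ /ltW.
Qed.

End TanhReduction.
(** * Supersonic and sonic sheets: m >= sqrt 2 *)

Section Angle.
Context {R : realType}.

(** The angle [pi / 6] is determined by its triple being [pi / 2]. *)
Lemma cos_sin_pi6 : cos (pi / 6 : R) = Num.sqrt 3 / 2 /\ sin (pi / 6 : R) = 2^-1.
Proof.
set t : R := pi / 6; have t3 : t + (t + t) = pi / 2 by rewrite /t; field.
have cube (x y : R) : 0 < x -> x ^+ 2 + y ^+ 2 = 1 ->
    y * (x * x - y * y) + x * (y * x + x * y) = 1 ->
    x * (x * x - y * y) - y * (y * x + x * y) = 0 -> x = Num.sqrt 3 / 2 /\ y = 2^-1.
  move=> x0 e1 e2 e3.
  have xy : x ^+ 2 = 3 * y ^+ 2.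
    by apply: (mulfI (lt0r_neq0 x0)); rewrite -[LHS]subr0 -[X in _ - X]e3; ring.
  have y2 : y = 2^-1.
    have y4 : 4 * y ^+ 2 = 1 by rewrite -[RHS]e1 xy; ring.
    transitivity (y * (4 * y ^+ 2)); first by rewrite y4 mulr1.
    transitivity ((y * (x * x - y * y) + x * (y * x + x * y)) / 2); last by rewrite e2 mul1r.
    transitivity ((3 * x ^+ 2 * y - y ^+ 3) / 2); last by field.
    by rewrite xy; field.
  split => //; have -> : x = Num.sqrt (x ^+ 2) by rewrite sqrtr_sqr gtr0_norm.
  have -> : x ^+ 2 = 3 * 2^-1 ^+ 2 by rewrite xy y2.
  by rewrite sqrtrM // sqrtr_sqr gtr0_norm.
apply: cube.
- by rewrite cos_gt0_pihalf //; have := pi_gt0 R; rewrite /t => *; apply/andP; split; lra.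
- exact: cos2Dsin2.
- by have := sin_pihalf R; rewrite -t3 !sinD cosD.
- by have := cos_pihalf R; rewrite -t3 !cosD sinD.
Qed.

Lemma expC_i (t : R) : expC (t%:C * 'i%C) = cos t +i* sin t.
Proof.
by rewrite /expC /=; rewrite !mulr0 mul0r subr0 mulr1 addr0 expR0 rmorph1 mul1r.
Qed.

Lemma expC_pi6 : expC ((pi / 6)%:C * 'i%C) = (Num.sqrt 3 / 2) +i* 2^-1 :> R[i].
Proof. by rewrite expC_i; have [-> ->] := cos_sin_pi6. Qed.

Lemma expC_pi6_cube : expC ((pi / 6)%:C * 'i%C) ^+ 3 = 'i%C :> R[i].
Proof.
rewrite expC_pi6; have := sqr_sqrtr (ler0n R 3); move: (Num.sqrt 3) => s; rewrite expr2 => e.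
apply: complex_ext; rewrite /=.
  transitivity (s * (s * s - 3) / 8); first by field.
  by rewrite e subrr mulr0 mul0r.
transitivity ((3 * (s * s) - 1) / 8); first by field.
by rewrite e; field.
Qed.

Lemma cube_root_third (alpha : R) : 0 < alpha ->
  0 < (alpha / 3) `^ 3^-1 /\ alpha = 3 * ((alpha / 3) `^ 3^-1) ^+ 3.
Proof.
move=> a0; split; first by rewrite powR_gt0 // divr_gt0.
rewrite -powR_mulrn ?powR_ge0 // -powRrM mulVf ?pnatr_eq0 // powRr1 ?divr_ge0 ?ltW //.
by field.
Qed.

End Angle.

Section Supersonic.
Context {R : realType} (m : R) (m_gt0 : 0 < m) (m_gt : Num.sqrt 2 < m).
Local Notation q := (Num.sqrt (4 * m ^+ 2 + 1)).

Lemma cstar_facts : [/\ 0 < cstar m, cstar m < 1,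
  2 * (1 + cstar m ^+ 2) = m ^+ 2 * (1 - cstar m ^+ 2) ^+ 2 &
  1 + m ^+ 2 * (1 - cstar m ^+ 2) = q].
Proof.
have m2 : 2 < m ^+ 2.
  by rewrite -[ltLHS]sqr_sqrtr // ltr_pXn2r ?nnegrE ?sqrtr_ge0 ?ltW.
have m20 : 0 < m ^+ 2 by rewrite exprn_gt0.
have q2 : q ^+ 2 = 4 * m ^+ 2 + 1 by rewrite sqr_sqrtr //; lra.
have q0 : 0 <= q := sqrtr_ge0 _.
have ql : q < m ^+ 2 + 1.
  rewrite -(@ltr_pXn2r _ 2) ?nnegrE ?q2 //; last by lra.
  by move: m2 m20; move: (m ^+ 2) => s *; nra.
have qu : 1 < q.
  rewrite -(@ltr_pXn2r _ 2) ?nnegrE ?q2 //.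
  by move: m2 m20; move: (m ^+ 2) => s *; nra.
pose s := (m ^+ 2 + 1 - q) / m ^+ 2.
have s0 : 0 < s by rewrite divr_gt0 // subr_gt0.
have s1 : s < 1 by rewrite ltr_pdivrMr // mul1r; lra.
have ss : cstar m ^+ 2 = s by rewrite sqr_sqrtr // ltW.
have sg : 0 < cstar m by rewrite sqrtr_gt0.
have e : m ^+ 2 * (1 - s) = q - 1 by rewrite /s; field; rewrite gt_eqF.
split => //.
- by rewrite -(@ltr_pXn2r _ 2) ?nnegrE ?ss ?expr1n // ltW.
- rewrite ss; apply: (mulfI (lt0r_neq0 m20)).
  transitivity ((m ^+ 2 * (1 - s)) ^+ 2); last by ring.
  rewrite e sqrrB q2 expr1n mulr1.
  transitivity (4 * m ^+ 2 - 2 * (m ^+ 2 * (1 - s))); first by ring.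
  by rewrite e; ring.
- by rewrite ss e addrC subrK.
Qed.

Lemma Kcoef_gt0 : 0 < cRe (Kcoef m) /\ 0 < cIm (Kcoef m).
Proof.
have [c0 c1 _ _] := cstar_facts; rewrite /Kcoef; set L := ln _.
have q0 : 0 < q by rewrite sqrtr_gt0; have := sqr_ge0 m => *; lra.
have L0 : 0 < L.
  by rewrite ln_gt0 // ltr_pdivlMr ?subr_gt0 //; lra.
have P : 0 < (1 - cstar m ^+ 2) / (8 * cstar m ^+ 2 * q).
  by rewrite divr_gt0 ?subr_gt0 ?expr_lt1 ?(ltW c0) // !mulr_gt0 // exprn_gt0.
rewrite cReM cImM /= !mul0r subr0 addr0; split; apply: (mulr_gt0 P).
  by rewrite !mulr_gt0 ?pi_gt0.
by rewrite addr_gt0 // !mulr_gt0.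
Qed.

Lemma dispersion_quot_cstar :
  dispersion_quot m (cstar m)%:C (cstar m)%:C = (16 * cstar m ^+ 2 * q)%:C.
Proof.
have [_ _ e <-] := cstar_facts; rewrite dispersion_quot_root.
  by apply: complex_ext; rewrite /=; ring.
move: (cstar m) (m ^+ 2) e => c mm e.
transitivity ((2 * (1 + c ^+ 2))%:C); first by apply: complex_ext; rewrite /=; ring.
by rewrite e; apply: complex_ext; rewrite /=; ring.
Qed.

Lemma Kcoef_eq : (16 * cstar m ^+ 2 * q)%:C * Kcoef m = limit_correction (cstar m).
Proof.
have [c0 _ _ _] := cstar_facts.
have q0 : 0 < q by rewrite sqrtr_gt0; have := sqr_ge0 m => *; lra.
rewrite /Kcoef /limit_correction mulrA -rmorphM; congr (_%:C * _).
by field; rewrite !gt_eqF.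
Qed.

(** The simple real root [cstar] moves into the upper half plane with speed
    [Kcoef], the quotient of the correction by the derivative of the
    dispersion function there.  On the ball of radius [C alpha^2] around
    [cstar + Kcoef alpha] the imaginary part stays comparable to [alpha],
    which is what keeps the logarithm of the tanh profile under control. *)
Lemma supersonic_modes : exists alpha0 C : R, [/\ 0 < alpha0, 0 <= C &
  forall alpha, 0 < alpha < alpha0 -> exists c, [/\ has_mode m (@tanh R) alpha c,
    nrm (c - ((cstar m)%:C + Kcoef m * alpha%:C)) <= C * alpha ^+ 2 & 0 < cIm c]].
Proof.
have [s0 s1 se _] := cstar_facts; have [_ Ki] := Kcoef_gt0.
have qP : 0 < q by rewrite sqrtr_gt0; have := sqr_ge0 m => *; lra.
have c01 : 0 <= cstar m < 1 by rewrite ltW.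
have K0 : 0 < 2 / cIm (Kcoef m) by rewrite divr_gt0.
have [delta [alpha1 [M [N [d0 a1 M0 HN]]]]] := tanh_reduction m_gt0 c01 K0 se.
have LE := dispersion_quot_cstar; have KE := Kcoef_eq.
set c0 : R[i] := (cstar m)%:C in LE HN *.
set ki := cIm (Kcoef m) in Ki K0 HN.
set L : R[i] := (16 * cstar m ^+ 2 * q)%:C in LE KE.
have LP : 0 < nrm L.
  by rewrite nrmR normr_gt0 gt_eqF // !mulr_gt0 // exprn_gt0.
have L0 : L != 0 by rewrite -nrm_gt0.
have dr : dispersion m c0 = 0.
  apply: dispersion_root; rewrite /c0; move: (cstar m) (m ^+ 2) se => c mm e.
  transitivity ((2 * (1 + c ^+ 2))%:C); first by apply: complex_ext; rewrite /=; ring.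
  by rewrite e; apply: complex_ext; rewrite /=; ring.
pose k := nrm (Kcoef m); have k0 : 0 <= k := nrm_ge0 _.
pose C1 := 24 + 64 * m ^+ 2.
have C10 : 0 < C1 by rewrite /C1; have := sqr_ge0 m => *; lra.
pose C := 8 * (C1 * k ^+ 2 + M * (1 + k)) / nrm L.
have C0 : 0 <= C.
  by rewrite divr_ge0 ?(ltW LP) // mulr_ge0 // addr_ge0 // mulr_ge0 ?exprn_ge0 ?(ltW C10) // addr_ge0.
have p1 : 0 < C1 + M by lra.
have p2 : 0 < k + 1 by lra.
pose alpha0 := Num.min alpha1 (Num.min (Num.min 1 (Num.min 1 (ki / 2) / (C + 1)))
  (Num.min (delta / (k + 1)) (nrm L / (8 * (C1 + M) * (k + 1))))).
have a00 : 0 < alpha0.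
  rewrite !lt_min a1 ltr01 /=; apply/and3P; split; rewrite divr_gt0 ?ltr_wpDl //.
    by rewrite lt_min ltr01 divr_gt0.
  by rewrite !mulr_gt0.
exists alpha0, C; split => // alpha /andP[ap]; rewrite !lt_min.
move=> /and3P[/ltW h1 /andP[/ltW h2 /ltW h3] /andP[/ltW h4 /ltW h5]].
have a0 := ltW ap.
move: h3 h4 h5; rewrite ler_pdivlMr ?ltr_wpDl // le_min => /andP[h3 h3'].
rewrite ler_pdivlMr // ler_pdivlMr ?mulr_gt0 // => h4 h5.
pose b := c0 + Kcoef m * alpha%:C.
have bc : nrm (b - c0) = k * alpha by rewrite /b addrAC subrr add0r nrmM nrmR gtr0_norm.
have r0 : 0 <= C * alpha ^+ 2 by rewrite mulr_ge0 // exprn_ge0.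
have rr : C * alpha ^+ 2 <= alpha by rewrite expr2; nra.
have near c : nrm (c - b) <= C * alpha ^+ 2 -> nrm (c - c0) <= (k + 1) * alpha.
  move=> hc; have -> : c - c0 = (c - b) + (b - c0) by ring.
  by rewrite (le_trans (nrmD _ _)) // bc mulrDl mul1r addrC lerD // (le_trans hc).
have ndel c : nrm (c - b) <= C * alpha ^+ 2 -> nrm (c - c0) <= delta.
  by move=> /near h; rewrite (le_trans h) // mulrC.
have him c : nrm (c - b) <= C * alpha ^+ 2 -> alpha <= 2 / ki * cIm c.
  move=> hc; have := le_trans (ler_Im_nrm _) hc.
  rewrite cImB ler_norml => /andP[hl _].
  have ib : cIm b = ki * alpha by rewrite /b cImD cImM /= mulr0 add0r add0r.
  rewrite mulrAC ler_pdivlMr //; rewrite ib in hl.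
  have : C * alpha ^+ 2 <= ki / 2 * alpha by rewrite expr2; nra.
  by rewrite (mulrC alpha ki); lra.
have aI : 0 < alpha <= alpha1 by rewrite ap.
have bb : nrm (b - b) <= C * alpha ^+ 2 by rewrite subrr nrm0.
have n1 c : nrm (c - b) <= C * alpha ^+ 2 -> nrm c <= 1.
  by move=> hc; have [_ _ _ []] := HN alpha c aI (ndel c hc) (him c hc).
have n10 : nrm c0 <= 1 by rewrite nrmR gtr0_norm // ltW.
have C1M : C1 * ((k + 1) * alpha + (k + 1) * alpha) <= nrm L / 4.
  have : 0 <= M * (k + 1) * alpha by rewrite !mulr_ge0 // addr_ge0.
  by move: h5; rewrite -!mulrA; nra.
have aM : alpha * M <= nrm L / 4.
  have : 0 <= M * k * alpha by rewrite !mulr_ge0.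
  have : 0 <= C1 * (k + 1) * alpha by rewrite !mulr_ge0 ?(ltW C10) // addr_ge0.
  have : 0 <= M * alpha by rewrite !mulr_ge0.
  by move: h5; rewrite -!mulrA; nra.
have [c c' hc hc'|c c' hc hc'||c hc Fc] := @newton_root R (dispersion m)
   (fun c => alpha%:C * N alpha c) b L (C * alpha ^+ 2) r0 L0.
- rewrite dispersion_quotE -mulrBl nrmM ler_wpM2r ?nrm_ge0 // -[X in nrm (_ - X)]LE.
  apply: (le_trans (dispersion_quot_dist _ (n1 _ hc) (n1 _ hc') n10)).
  by apply: le_trans C1M; rewrite -/C1 ler_wpM2l ?(ltW C10) // lerD // near.
- rewrite -mulrBr nrmM nrmR (gtr0_norm ap).
  have [_ hL _ _] := HN alpha c aI (ndel c hc) (him c hc).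
  rewrite (le_trans (ler_wpM2l a0 (hL c' (ndel _ hc') (him _ hc')))) // mulrA.
  by rewrite ler_wpM2r ?nrm_ge0.
- have [hl _ _ _] := HN alpha b aI (ndel b bb) (him b bb).
  have -> : dispersion m b - alpha%:C * N alpha b =
     (dispersion_quot m b c0 - L) * (b - c0) - alpha%:C * (N alpha b - limit_correction (cstar m)).
    rewrite mulrBl -dispersion_quotE dr subr0 -KE /b; ring.
  rewrite (le_trans (nrmB _ _)) // !nrmM bc nrmR (gtr0_norm ap).
  have hq : nrm (dispersion_quot m b c0 - L) <= C1 * (k * alpha).
    by have := dispersion_quot_dist m (n1 _ bb) n10 n10; rewrite subrr nrm0 addr0 bc LE.
  have -> : nrm L * (C * alpha ^+ 2) / 8 =
      C1 * (k * alpha) * (k * alpha) + alpha * (M * (alpha + k * alpha)).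
    by rewrite /C; field; rewrite gt_eqF.
  rewrite lerD //; first by rewrite ler_wpM2r // mulr_ge0.
  by rewrite ler_wpM2l //; rewrite bc in hl.
exists c; have [_ _ hm [_ ic]] := HN alpha c aI (ndel c hc) (him c hc).
by split => //; exact: hm.
Qed.

End Supersonic.

Section Sonic.
Context {R : realType} (m : R) (m_eq : m = Num.sqrt 2).

(** At [m = sqrt 2] the three roots merge at [c = 0], where the dispersion
    function is [24 c^3 - 8 c^5] and the correction is [8 i]; balancing
    [24 c^3] with [8 i alpha] gives three cube roots, of which [s] is the one in
    the open first quadrant.  In terms of [t = |s|] the
    wave number is [3 t^3], the derivative at [s] has size [72 t^2] and the
    residual has size [t^4], so that the Newton iteration works on a ball of
    radius of order [t^2]. *)
Lemma sonic_modes : exists alpha0 C : R, [/\ 0 < alpha0, 0 <= C &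
  forall alpha, 0 < alpha < alpha0 -> exists c, [/\ has_mode m (@tanh R) alpha c,
    nrm (c - expC ((pi / 6)%:C * 'i%C) * ((alpha / 3) `^ 3^-1)%:C)
      <= C * ((alpha / 3) `^ 3^-1) ^+ 2 & 0 < cIm c]].
Proof.
have m0 : 0 < m by rewrite m_eq sqrtr_gt0.
have m2 : m ^+ 2 = 2 by rewrite m_eq sqr_sqrtr.
have c01 : (0 : R) <= 0 < (1 : R) by rewrite lexx ltr01.
have se : 2 * (1 + 0 ^+ 2) = m ^+ 2 * (1 - 0 ^+ 2) ^+ 2 by rewrite m2; ring.
have [delta [alpha1 [M [N [d0 a1 M0 HN]]]]] := tanh_reduction m0 c01 ltr01 se.
have lim : limit_correction 0 = 8 * 'i%C :> R[i].
  by rewrite /limit_correction; apply: complex_ext; rewrite /=; ring.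
pose e : R[i] := expC ((pi / 6)%:C * 'i%C).
have e3 : e ^+ 3 = 'i%C := expC_pi6_cube.
have ne : nrm e = 1 by rewrite nrm_expC /= !(mulr0, mul0r) subr0 expR0.
have ie : cIm e = 2^-1 by rewrite /e expC_pi6.
pose C := 1 + 2 * M; have C1 : 1 <= C by rewrite lerDl mulr_ge0.
pose t0 := Num.min (10^-1) (Num.min (Num.min alpha1 (delta / 2))
   (Num.min ((20 * C)^-1) (6 / (M + 1)))).
have t00 : 0 < t0.
  rewrite !lt_min; apply/and3P; split; first by rewrite invr_gt0.
    by rewrite a1 divr_gt0.
  by rewrite invr_gt0 mulr_gt0 ?(lt_le_trans ltr01 C1) //= divr_gt0 // ltr_wpDl.
exists (3 * t0 ^+ 3), C; split; [by rewrite mulr_gt0 // exprn_gt0|by lra|].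
move=> alpha /andP[ap]; have [tp aE] := cube_root_third ap.
set t := (alpha / 3) `^ 3^-1 in tp aE *; have tg := ltW tp.
rewrite [in X in X -> _]aE ltr_pM2l // ltr_pXn2r ?nnegrE ?(ltW t00) // !lt_min.
move=> /and3P[/ltW h1 /andP[/ltW h2 /ltW h3] /andP[/ltW h4 /ltW h5]].
move: h4 h5; rewrite -div1r ler_pdivlMr ?mulr_gt0 ?(lt_le_trans ltr01 C1) // => h4.
rewrite ler_pdivlMr ?ltr_wpDl // => h5.
pose s := e * t%:C.
have ns : nrm s = t by rewrite nrmM ne mul1r nrmR gtr0_norm.
have is' : cIm s = t / 2 by rewrite cImM (_ : cIm t%:C = 0) // mulr0 add0r ie mulrC.
have r0 : 0 <= C * t ^+ 2 by rewrite mulr_ge0 ?exprn_ge0 //; lra.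
have rr : C * t ^+ 2 <= t / 20 by rewrite expr2; nra.
have a0 := ltW ap.
have s3 : s ^+ 3 = 'i%C * (t ^+ 3)%:C by rewrite /s exprMn e3 rmorphXn.
have tt : t ^+ 2 <= 100^-1 by rewrite expr2; nra.
have near c : nrm (c - s) <= C * t ^+ 2 -> nrm c <= 21 / 20 * t.
  move=> hc; have -> : c = (c - s) + s by rewrite subrK.
  by rewrite (le_trans (nrmD _ _)) // ns; lra.
have ndel c : nrm (c - s) <= C * t ^+ 2 -> nrm (c - (0 : R)%:C) <= delta.
  by move=> /near h; rewrite rmorph0 subr0; lra.
have a4 : alpha <= t / 4 by rewrite aE exprS; nra.
have him c : nrm (c - s) <= C * t ^+ 2 -> alpha <= 1 * cIm c.
  move=> hc; have := le_trans (ler_Im_nrm _) hc.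
  by rewrite cImB is' ler_norml => /andP[hl _]; lra.
have aI : 0 < alpha <= alpha1 by rewrite ap /=; lra.
have ss : nrm (s - s) <= C * t ^+ 2 by rewrite subrr nrm0.
have L0 : 72 * s ^+ 2 != 0.
  by rewrite mulf_neq0 ?pnatr_eq0 // expf_neq0 // -nrm_gt0 ns.
have nL : nrm (72 * s ^+ 2) = 72 * t ^+ 2 by rewrite nrmM nrm_nat nrmX ns.
have qE c c' : dispersion_quot m c c' =
    24 * (c ^+ 2 + c * c' + c' ^+ 2) - 8 * (c ^+ 4 + c ^+ 3 * c' + c ^+ 2 * c' ^+ 2 + c * c' ^+ 3 + c' ^+ 4).
  by rewrite /dispersion_quot m2 rmorph_nat; ring.
have [c c' hc hc'|c c' hc hc'||c hc Fc] := @newton_root R (dispersion m)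
   (fun c => alpha%:C * N alpha c) s (72 * s ^+ 2) (C * t ^+ 2) r0 L0.
- rewrite nL dispersion_quotE -mulrBl nrmM ler_wpM2r ?nrm_ge0 // qE.
  set u := c - s in hc; set v := c' - s in hc'.
  have hu : nrm u <= t / 20 := le_trans hc rr; have hv : nrm v <= t / 20 := le_trans hc' rr.
  have -> : forall P, 24 * (c ^+ 2 + c * c' + c' ^+ 2) - 8 * P - 72 * s ^+ 2 =
     (72 * (s * (u + v)) + 24 * (u ^+ 2 + u * v + v ^+ 2)) - 8 * P.
    by move=> P; rewrite /u /v; ring.
  have pw (x y : R[i]) (a1' b1' : R) : nrm x <= a1' -> nrm y <= b1' -> nrm (x * y) <= a1' * b1'.
    by move=> hx hy; rewrite nrmM ler_pM ?nrm_ge0.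
  have pX (x : R[i]) (a1' : R) n : nrm x <= a1' -> nrm (x ^+ n) <= a1' ^+ n.
    by move=> hx; rewrite nrmX; apply: lerXn2r; rewrite ?nnegrE ?nrm_ge0 // (le_trans (nrm_ge0 _) hx).
  have [k k'] := (near c hc, near c' hc').
  have g1 : nrm (72 * (s * (u + v))) <= 72 * (t * (t / 20 + t / 20)).
    by rewrite nrmM nrm_nat ler_pM2l // pw ?ns // (le_trans (nrmD _ _)) // lerD.
  have g2 : nrm (24 * (u ^+ 2 + u * v + v ^+ 2)) <= 24 * ((t / 20) ^+ 2 + t / 20 * (t / 20) + (t / 20) ^+ 2).
    rewrite nrmM nrm_nat ler_pM2l // (le_trans (nrmD _ _)) // lerD ?pX //.
    by rewrite (le_trans (nrmD _ _)) // lerD ?pX // pw.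
  have g3 : nrm (8 * (c ^+ 4 + c ^+ 3 * c' + c ^+ 2 * c' ^+ 2 + c * c' ^+ 3 + c' ^+ 4))
      <= 8 * (5 * (21 / 20 * t) ^+ 4).
    rewrite nrmM nrm_nat ler_pM2l //.
    set w := 21 / 20 * t.
    have -> : 5 * w ^+ 4 = w ^+ 4 + w ^+ 3 * w + w ^+ 2 * w ^+ 2 + w * w ^+ 3 + w ^+ 4 by ring.
    have tri (x y : R[i]) (a' b' : R) : nrm x <= a' -> nrm y <= b' -> nrm (x + y) <= a' + b'.
      by move=> hx hy; rewrite (le_trans (nrmD _ _)) // lerD.
    refine (tri _ _ _ _ (tri _ _ _ _ (tri _ _ _ _ (tri _ _ _ _ (pX _ _ _ k) _) _) _) (pX _ _ _ k')).
    - exact: pw (pX _ _ _ k) k'.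
    - exact: pw (pX _ _ _ k) (pX _ _ _ k').
    - exact: pw k (pX _ _ _ k').
  rewrite (le_trans (nrmB _ _)) //.
  apply: (le_trans (lerD (le_trans (nrmD _ _) (lerD g1 g2)) g3)).
  have -> : 8 * (5 * (21 / 20 * t) ^+ 4) = 40 * (21 / 20) ^+ 4 * (t ^+ 2 * t ^+ 2) by ring.
  have -> : 72 * (t * (t / 20 + t / 20)) + 24 * ((t / 20) ^+ 2 + t / 20 * (t / 20) + (t / 20) ^+ 2)
     = (72 / 10 + 72 / 400) * t ^+ 2 by field.
  have : 0 <= t ^+ 2 by rewrite exprn_ge0.
  move: (t ^+ 2) tt => T hT T0.
  have : T * T <= 100^-1 * T by rewrite ler_wpM2r.
  have : (21 / 20) ^+ 4 <= 2 :> R by rewrite !exprS expr0; lra.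
  have : 0 <= T * T by rewrite mulr_ge0.
  by move: ((21 / 20) ^+ 4) (T * T) => x y *; nra.
- rewrite nL -mulrBr nrmM nrmR (gtr0_norm ap).
  have [_ hL _ _] := HN alpha c aI (ndel c hc) (him c hc).
  rewrite (le_trans (ler_wpM2l a0 (hL c' (ndel _ hc') (him _ hc')))) // mulrA.
  rewrite ler_wpM2r ?nrm_ge0 // aE.
  have -> : 3 * t ^+ 3 * M = 3 * t ^+ 2 * (t * M) by ring.
  have -> : 72 * t ^+ 2 / 4 = 3 * t ^+ 2 * 6 by field.
  by rewrite ler_wpM2l ?mulr_ge0 ?exprn_ge0 //; lra.
- have [hl _ _ _] := HN alpha s aI (ndel s ss) (him s ss).
  have -> : dispersion m s - alpha%:C * N alpha s =
      - (8 * s ^+ 5) - alpha%:C * (N alpha s - limit_correction 0).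
    have -> : dispersion m s = 24 * s ^+ 3 - 8 * s ^+ 5 by rewrite /dispersion m2 rmorph_nat; ring.
    have -> : alpha%:C = 3 * (t ^+ 3)%:C :> R[i] by rewrite [in LHS]aE rmorphM rmorph_nat.
    by rewrite s3 lim; ring.
  rewrite nL (le_trans (nrmB _ _)) // nrmN (nrmM 8) nrm_nat (nrmX s) ns (nrmM alpha%:C) nrmR (gtr0_norm ap).
  rewrite rmorph0 subr0 ns in hl.
  have ht : M * (alpha + t) <= M * (2 * t) by rewrite ler_wpM2l //; lra.
  have h : alpha * nrm (N alpha s - limit_correction 0) <= 6 * M * t ^+ 4.
    rewrite (le_trans (ler_wpM2l a0 (le_trans hl ht))) // {1}aE.
    by rewrite le_eqVlt; apply/orP; left; apply/eqP; ring.
  have t5 : 8 * t ^+ 5 <= 8 * t ^+ 4 by rewrite ler_pM2l // ler_wiXn2l //; lra.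
  rewrite (le_trans (lerD t5 h)) // /C.
  have -> : 72 * t ^+ 2 * ((1 + 2 * M) * t ^+ 2) / 8 = (9 + 18 * M) * t ^+ 4 by field.
  by rewrite -mulrDl ler_wpM2r ?exprn_ge0 //; lra.
exists c; have [_ _ hm [_ ic]] := HN alpha c aI (ndel c hc) (him c hc).
by split => //; exact: hm.
Qed.

End Sonic.
(** * Asymptotic expansions of the wave speed *)

Section Asymptotics.
Context {R : realType}.

Lemma bigO_right (f g : R -> R) (a0 C : R) : 0 < a0 ->
  (forall a, 0 < a < a0 -> `|f a| <= C * `|g a|) -> f =O_ (0^'+) g.
Proof.
move=> h H; apply/eqOP; near=> k; near=> a.
have /H h1 : 0 < a < a0 by apply/andP; split; near: a; [exact: nbhs_right_gt|exact: nbhs_right_lt].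
rewrite (le_trans h1) // ler_wpM2r //.
Unshelve. all: by end_near. Qed.

Lemma littleo_right (f g : R -> R) :
  (forall e, 0 < e -> exists2 d, 0 < d & forall a, 0 < a < d -> `|f a| <= e * `|g a|) ->
  f =o_ (0^'+) g.
Proof.
move=> H; apply/eqoP => e /H [d d0 {}H]; near=> a; apply: H.
by apply/andP; split; near: a; [exact: nbhs_right_gt|exact: nbhs_right_lt].
Unshelve. all: by end_near. Qed.

(** The form in which the expansions are consumed: an error of size
    [C t ^ 2], where [t] tends to zero with [a] and is dominated by the gauge
    [g]. *)
Lemma littleo_sqr (f g t : R -> R) (a0 C : R) : 0 < a0 -> 0 <= C ->
  (forall a, 0 < a -> 0 <= t a <= `|g a|) ->
  (forall e, 0 < e -> exists2 d, 0 < d & forall a, 0 < a < d -> t a <= e) ->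
  (forall a, 0 < a < a0 -> `|f a| <= C * t a ^+ 2) -> f =o_ (0^'+) g.
Proof.
move=> h C0 tg t0 H; apply: littleo_right => e e0.
have C1 : 0 < C + 1 by rewrite ltr_wpDl.
have [d d0 Hd] := t0 (e / (C + 1)) (divr_gt0 e0 C1).
exists (Num.min a0 d) => [|a /andP[ap]]; first by rewrite lt_min h.
rewrite lt_min => /andP[h1 h2].
have ha : 0 < a < a0 by rewrite ap.
have had : 0 < a < d by rewrite ap.
have /andP[t1 t2] := tg a ap; have := Hd a had; rewrite ler_pdivlMr // => t3.
rewrite (le_trans (H a ha)) // expr2 mulrA ler_pM ?mulr_ge0 //.
by nra.
Qed.

Lemma mode_selection (m a0 : R) (U : R -> R) (P : R -> R[i] -> Prop) :
  (forall alpha, 0 < alpha < a0 -> exists c, [/\ has_mode m U alpha c, P alpha c & 0 < cIm c]) ->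
  exists c : R -> R[i], forall alpha, 0 < alpha < a0 ->
    [/\ has_mode m U alpha (c alpha), P alpha (c alpha) & 0 < cIm (c alpha)].
Proof.
move=> H; suff /choice[c Hc] : forall alpha, exists c, 0 < alpha < a0 ->
    [/\ has_mode m U alpha c, P alpha c & 0 < cIm c] by exists c.
move=> alpha; case: (boolP (0 < alpha < a0)) => [/H[c Hc]|_]; first by exists c.
by exists 0.
Qed.

End Asymptotics.

Theorem theorem1p1 (R : realType) (m : R) (Us : R -> R)
    (hm : 0 < m)
    (hsub : m < Num.sqrt 2 -> shear_profile Us)
    (hsup : Num.sqrt 2 <= m -> Us = tanh) :
  exists2 alpha0 : R, 0 < alpha0 &
  exists c : R -> R[i],
  [/\ forall alpha : R, 0 < alpha < alpha0 ->
        exists rho u v : R -> R[i],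
        [/\ nontrivial (wave alpha (c alpha) rho) (wave alpha (c alpha) u)
              (wave alpha (c alpha) v),
            linearized_euler_solution m Us (wave alpha (c alpha) rho)
              (wave alpha (c alpha) u) (wave alpha (c alpha) v),
            [/\ WinftyC 1 rho, WinftyC 1 u & WinftyC 2 v] &
            mode_equations m Us alpha (c alpha) rho u v],
      m < Num.sqrt 2 ->
        [/\ 0 < sigma m,
            (fun alpha => Normc.normc (c alpha - 'i%C * (sigma m)%:C))
              =O_ (0^'+) (fun alpha : R => alpha),
            (fun alpha => complex.Re (c alpha))
              =O_ (0^'+) (fun alpha : R => alpha),
            (fun alpha => complex.Im (c alpha) - sigma m)
              =O_ (0^'+) (fun alpha : R => alpha) &
            forall alpha : R, 0 < alpha < alpha0 -> 0 < complex.Im (c alpha)],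
      m = Num.sqrt 2 ->
        [/\ (fun alpha => Normc.normc (c alpha
               - expC ((pi / 6)%:C * 'i%C) * ((alpha / 3) `^ 3^-1)%:C))
              =o_ (0^'+) (fun alpha : R => alpha `^ 3^-1),
            (fun alpha => complex.Re (c alpha)
               - Num.sqrt 3 / 2 * (alpha / 3) `^ 3^-1)
              =o_ (0^'+) (fun alpha : R => alpha `^ 3^-1),
            (fun alpha => complex.Im (c alpha) - 2^-1 * (alpha / 3) `^ 3^-1)
              =o_ (0^'+) (fun alpha : R => alpha `^ 3^-1) &
            forall alpha : R, 0 < alpha < alpha0 -> 0 < complex.Im (c alpha)] &
      Num.sqrt 2 < m ->
        [/\ 0 < cstar m < 1,
            0 < complex.Re (Kcoef m) /\ 0 < complex.Im (Kcoef m),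
            (fun alpha => Normc.normc (c alpha
               - ((cstar m)%:C + Kcoef m * alpha%:C)))
              =o_ (0^'+) (fun alpha : R => alpha),
            (fun alpha => complex.Re (c alpha)
               - (cstar m + complex.Re (Kcoef m) * alpha))
              =o_ (0^'+) (fun alpha : R => alpha) /\
            (fun alpha => complex.Im (c alpha) - complex.Im (Kcoef m) * alpha)
              =o_ (0^'+) (fun alpha : R => alpha) &
            forall alpha : R, 0 < alpha < alpha0 -> 0 < complex.Im (c alpha)]].
Proof.
have [lt|gt|eq] := ltgtP m (Num.sqrt 2).
- have [a0 [C [a00 C0 /mode_selection[c Hc]]]] := subsonic_modes hm lt (hsub lt).
  exists a0 => //; exists c.
  split=> [alpha /Hc[]//||e|g]; [move=> _|by exfalso; lra|by exfalso; lra].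
  have ab a : C * a <= C * `|a| by rewrite ler_wpM2l // ler_norm.
  split; last by move=> alpha /Hc[].
  + by have [] := sigma_facts hm lt.
  + apply: (bigO_right a00) => a ha /=; have [_ h _] := Hc a ha.
    by rewrite ger0_norm ?nrm_ge0 //; exact: le_trans h (ab a).
  + apply: (bigO_right a00) => a ha /=; have [_ h _] := Hc a ha.
    apply: le_trans (ab a); apply: le_trans h; apply: le_trans (ler_Re_nrm _).
    by rewrite cReB cReM /= !mul0r mulr0 !subr0.
  + apply: (bigO_right a00) => a ha /=; have [_ h _] := Hc a ha.
    apply: le_trans (ab a); apply: le_trans h; apply: le_trans (ler_Im_nrm _).
    by rewrite cImB cImM /= !mul0r mul1r add0r.
- have [a0 [C [a00 C0 /mode_selection[c Hc]]]] := supersonic_modes hm gt.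
  rewrite (hsup (ltW gt)); exists a0 => //; exists c.
  have [c0 c1 _ _] := cstar_facts hm gt.
  split=> [alpha /Hc[]//|l|e|_]; [by exfalso; lra|by exfalso; lra|].
  have tg (a : R) : 0 < a -> 0 <= a <= `|a| by move=> ha; rewrite gtr0_norm // ltW // lexx.
  have t0 (e : R) : 0 < e -> exists2 d, 0 < d & forall a, 0 < a < d -> a <= e.
    by move=> e0; exists e => // a /andP[_ /ltW].
  split; last by move=> alpha /Hc[].
  + by rewrite c0.
  + exact: Kcoef_gt0.
  + apply: (@littleo_sqr R _ (fun a => a) (fun a => a) a0 C a00 C0 tg t0) => a ha /=; have [_ h _] := Hc a ha.
    by rewrite ger0_norm ?nrm_ge0.
  + split; apply: (@littleo_sqr R _ (fun a => a) (fun a => a) a0 C a00 C0 tg t0) => a ha /=; have [_ h _] := Hc a ha; apply: le_trans h.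
      apply: le_trans (ler_Re_nrm _).
      by rewrite cReB cReD cReM (_ : cIm a%:C = 0) // mulr0 subr0.
    apply: le_trans (ler_Im_nrm _).
    by rewrite cImB cImD cImM (_ : cIm a%:C = 0) // mulr0 !add0r.
- have [a0 [C [a00 C0 /mode_selection[c Hc]]]] := sonic_modes eq.
  have le2 : Num.sqrt 2 <= m by rewrite eq.
  rewrite (hsup le2); exists a0 => //; exists c.
  split=> [alpha /Hc[]//|l|_|g]; [by exfalso; lra| |by exfalso; lra].
  have tg (a : R) : 0 < a -> 0 <= (a / 3) `^ 3^-1 <= `|a `^ 3^-1|.
    move=> ha; rewrite powR_ge0 ger0_norm ?powR_ge0 //.
    by rewrite ge0_ler_powR ?nnegrE ?divr_ge0 ?(ltW ha) // ler_pdivrMr // ler_peMr ?(ltW ha) // ler1n.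
  have t0 (e : R) : 0 < e -> exists2 d, 0 < d & forall a, 0 < a < d -> (a / 3) `^ 3^-1 <= e.
    move=> e0; exists (3 * e ^+ 3); first by rewrite mulr_gt0 // exprn_gt0.
    move=> a /andP[ha]; have [tp {1}->] := cube_root_third ha.
    by rewrite ltr_pM2l // ltr_pXn2r ?nnegrE ?(ltW tp) ?(ltW e0) // => /ltW.
  split; last by move=> alpha /Hc[].
  + apply: (@littleo_sqr R _ (fun a => a `^ 3^-1) (fun a => (a / 3) `^ 3^-1) a0 C a00 C0 tg t0) => a ha /=; have [_ h _] := Hc a ha.
    by rewrite ger0_norm ?nrm_ge0.
  + apply: (@littleo_sqr R _ (fun a => a `^ 3^-1) (fun a => (a / 3) `^ 3^-1) a0 C a00 C0 tg t0) => a ha /=; have [_ h _] := Hc a ha; apply: le_trans h.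
    apply: le_trans (ler_Re_nrm _).
    by rewrite expC_pi6 cReB cReM (_ : cIm _%:C = 0) // mulr0 subr0.
  + apply: (@littleo_sqr R _ (fun a => a `^ 3^-1) (fun a => (a / 3) `^ 3^-1) a0 C a00 C0 tg t0) => a ha /=; have [_ h _] := Hc a ha; apply: le_trans h.
    apply: le_trans (ler_Im_nrm _).
    by rewrite expC_pi6 cImB cImM (_ : cIm _%:C = 0) // mulr0 !add0r.
Qed.
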